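(* Let $\mu$ and $\eta$ be finite atomless Borel measures on $\mathbb{R}$ such that $\operatorname{supp}(\eta)\subseteq\operatorname{supp}(\mu)\subseteq[0,1]$ and $\eta$ is singular to $\mu$, and let $\sigma\in L^2(\mu)$ be non-negative. Assume that both $\mu$ and $\nu:=\sigma^2\mu+\eta$ are probability measures. Then for $\gamma\in\{(0,0),(\pi/2,\pi/2)\}$, $$\lim_{x\to\infty}\frac{N^\gamma_{\nu,\mu}(x)}{x^{1/2}}=\frac1\pi\int\sigma\,d\mu.$$
   Context: $\sigma^2\mu$ is the measure with density $\sigma^2$ with respect to $\mu$. $F_\mu$ is the distribution function of $\mu$. A function $f\in C([0,1])$ lies in $\mathcal{D}^w(\Delta_{\nu,\mu})$ if there are $a,b\in\mathbb{R}$ and $g\in L^2(\nu)$ with $$f(x)=a+bF_\mu(x)+\int_{[0,x]}(F_\mu(x)-F_\mu(y))g(y)\,d\nu(y)\quad\text{for all }x\in[0,1].$$ Then $a$, $b$ and $g$ (in $L^2(\nu)$) are uniquely determined by $f$, and one sets $\Delta_{\nu,\mu}f:=g$, $\nabla_\mu f(0):=b$, $\nabla_\mu f(1):=b+\int g\,d\nu$. For $\gamma=(\alpha,\beta)\in[0,\pi/2]^2$, $\mathcal{D}^w_\gamma(\Delta_{\nu,\mu})$ is the set of $f\in\mathcal{D}^w(\Delta_{\nu,\mu})$ with $f(0)\cos\alpha-\nabla_\mu f(0)\sin\alpha=0$ and $f(1)\cos\beta+\nabla_\mu f(1)\sin\beta=0$; $\gamma=(0,0)$ is the Dirichlet case and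 $\gamma=(\pi/2,\pi/2)$ the Neumann case. $N^\gamma_{\nu,\mu}(x)$ is the number of eigenvalues of $-\Delta_{\nu,\mu}$ with domain $\mathcal{D}^w_\gamma(\Delta_{\nu,\mu})$ (as an operator on $L^2(\nu)$) not exceeding $x$. *)

(* Defs.v *)
From HB Require Import structures.
From mathcomp Require Import all_boot all_order all_algebra.
From mathcomp Require Import all_classical all_reals all_analysis.

Set Implicit Arguments.
Unset Strict Implicit.
Unset Printing Implicit Defensive.
Import Order.TTheory GRing.Theory Num.Theory.
Import numFieldNormedType.Exports.
Local Open Scope classical_set_scope.
Local Open Scope ring_scope.

Definition supp (R : realType)
    (mu : {measure set (measurableTypeR R) -> \bar R}) : set R :=
  [set x | forall U : set R, open U -> U x -> (0 < mu U)%E].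

Definition atomless (R : realType)
    (mu : {measure set (measurableTypeR R) -> \bar R}) : Prop :=
  forall x : R, mu [set x] = 0%E.

Definition singular (R : realType)
    (m1 m2 : {measure set (measurableTypeR R) -> \bar R}) : Prop :=
  exists A : set (measurableTypeR R),
    [/\ measurable A, m1 A = 0%E & m2 (~` A) = 0%E].

(* Real-valued; only meant for finite measures, where [fine] loses nothing. *)
Definition distr_fun (R : realType)
    (mu : {measure set (measurableTypeR R) -> \bar R}) (x : R) : R :=
  fine (mu `]-oo, x]%classic).

Section weak_laplacian.
Context (R : realType).
Variables mu nu : {measure set (measurableTypeR R) -> \bar R}.

(* A function in C([0,1]) is a total function [f : R -> R] whose restriction
   to [0,1] is continuous; its values off [0,1] play no role.  An element of
   L^2(nu) is given by a representative [g].  In the settings considered here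
   [a], [b] and the nu-class of [g] are determined by [f], so that this says:
   [f] lies in the weak domain, [g] is (a representative of) its Laplacian,
   and [b] is its mu-derivative at 0. *)
Definition weak_laplacian (f : R -> R) (a b : R) (g : R -> R) : Prop :=
  [/\ {within `[0, 1], continuous f},
      g \in Lfun nu 2%:E &
      forall x : R, x \in `[0, 1] ->
        f x = a + b * distr_fun mu x
            + \int[nu]_(y in `[0, x])
                ((distr_fun mu x - distr_fun mu y) * g y)].

(* The graph of the Laplacian restricted by the boundary conditions
   [gamma = (alpha, beta)]. *)
Definition laplacian_graph (gamma : R * R) (f g : R -> R) : Prop :=
  exists a b : R,
    [/\ weak_laplacian f a b g,
        f 0 * cos gamma.1 - b * sin gamma.1 = 0 &
        f 1 * cos gamma.2 + (b + \int[nu]_y g y) * sin gamma.2 = 0].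

(* [l] is an eigenvalue of minus the Laplacian as an operator on L^2(nu): both
   the equation and [f <> 0] are understood nu-almost everywhere. *)
Definition eigenvalue_of (gamma : R * R) (l : R) : Prop :=
  exists f g : R -> R,
    [/\ laplacian_graph gamma f g,
        ~ {ae nu, forall x : R, x \in `[0, 1] -> f x = 0} &
        {ae nu, forall x : R, x \in `[0, 1] -> - g x = l * f x}].

(* [+oo] if there are infinitely many such eigenvalues.  Eigenvalues are
   counted as a set: they are simple, since an eigenfunction is determined by
   its values of [a] and [b], one linear relation between which is the
   boundary condition at 0. *)
Definition eigenvalue_count (gamma : R * R) (x : R) : \bar R :=
  counting [set l : R | eigenvalue_of gamma l /\ l <= x].

End weak_laplacian.

(* Main.v *)
(* Write A and B for the distribution functions of mu and nu.  An eigenfunction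
   f for l, together with its mu-derivative p, solves df = p dA, dp = - l f dB,
   and for k > 0 the angle th of the vector (p / k, f) satisfies
   dth = k cos^2 th dA + (l / k) sin^2 th dB.  For k = 1 its total increase T(l)
   over [0,1] is continuous and strictly increasing in l, and l > 0 is an
   eigenvalue exactly when T(l) is a multiple of pi, so the number of
   eigenvalues up to x is T(x) / pi + O(1).
   Angles for different k share their quadrant, hence differ by less than
   pi / 2, so k may be changed at the ends of finitely many subintervals at the
   cost of a bounded error.  With k = sqrt l * s on each of them,
   dth = sqrt l (s cos^2 th dmu + (sigma^2 / s) sin^2 th dmu + sin^2 th / s deta),
   which is close to sqrt l * sigma dmu once the step function s is close to
   sigma in L^2(mu) and large on most of eta; such an s exists because
   continuous functions are dense in L^2(mu + eta). *)

(* [mu] and [nu] need not be comparable with Lebesgue measure or with each other, so there is no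
   pointwise equation for the angle. All calculus is done with increments, up to an error small
   against the increment of A + B. Chain and product rules survive because atomless measures have
   continuous clocks, which makes squares of increments negligible. T increases because of the
   Wronskian: for l' near l, sin (T l' - T l) is a positive multiple of l' - l times the integral of
   f_l f_l' dnu, which is close to that of f_l ^ 2. The latter is positive unless f_l is zero
   nu-almost everywhere; in the Dirichlet case A would then be zero nu-almost everywhere, which the
   inclusion of supports excludes. The scale k = sqrt l * s is chosen because s c + (sigma ^ 2 / s)
   (1 - c) equals sigma for every c when s = sigma, so nothing has to be known about the angle
   itself. The number of subintervals depends on the accuracy but not on l, so the cost of changing
   k disappears after division by sqrt l. *)
Require Import Defs.
From HB Require Import structures.
From mathcomp Require Import all_boot all_order all_algebra.
From mathcomp Require Import all_classical all_reals all_analysis.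
From mathcomp Require Import measurable_realfun zify ring lra.
Import Order.TTheory GRing.Theory Num.Theory.
Import numFieldNormedType.Exports.
Local Open Scope classical_set_scope.
Local Open Scope ring_scope.

Set Implicit Arguments.
Unset Strict Implicit.

(** * Continuity on the unit interval *)

Section continuity_on_01.
Context {R : realType}.
Implicit Types (f g h : R -> R) (x y e : R).

Definition clamp x : R := Order.max 0 (Order.min x 1).

Lemma clamp_ge0 x : 0 <= clamp x. Proof. by rewrite le_max lexx. Qed.

Lemma clamp_le1 x : clamp x <= 1.
Proof. by rewrite ge_max ler01 ge_min lexx orbT. Qed.

Lemma clamp01 x : 0 <= clamp x <= 1.
Proof. by rewrite clamp_ge0 clamp_le1. Qed.

Lemma clampE x : 0 <= x <= 1 -> clamp x = x.
Proof. by case/andP=> x0 x1; rewrite /clamp min_l// max_r. Qed.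

Lemma continuous_clamp : continuous clamp.
Proof.
move=> x; apply: (@continuous_max _ R (fun=> 0) (fun t => Order.min t 1)); first exact: cst_continuous.
by apply: (@continuous_min _ R id (fun=> 1)); [exact: id|exact: cst_continuous].
Qed.

(* Continuity on [0,1], phrased so that the behaviour of [h] off [0,1] is
   irrelevant and the global continuity lemmas apply. *)
Definition cont h := continuous (h \o clamp).

Lemma cont_ext f g : (forall x, 0 <= x <= 1 -> f x = g x) -> cont f -> cont g.
Proof.
move=> fg; rewrite /cont (_ : f \o clamp = g \o clamp)//.
by apply/funext => x /=; rewrite fg// clamp01.
Qed.

Lemma continuous_cont f : continuous f -> cont f.
Proof. by move=> cf x; apply: continuous_comp; [exact: continuous_clamp|exact: cf]. Qed.

Lemma cont_cst c : cont (fun=> c).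
Proof. by move=> x; exact: cst_continuous. Qed.

Lemma contD f g : cont f -> cont g -> cont (fun x => f x + g x).
Proof. by move=> cf cg x; apply: continuousD; [exact: cf|exact: cg]. Qed.

Lemma contN f : cont f -> cont (fun x => - f x).
Proof. by move=> cf x; apply: continuousN; exact: cf. Qed.

Lemma contB f g : cont f -> cont g -> cont (fun x => f x - g x).
Proof. by move=> cf cg; apply: contD => //; exact: contN. Qed.

Lemma contM f g : cont f -> cont g -> cont (fun x => f x * g x).
Proof. by move=> cf cg x; apply: continuousM; [exact: cf|exact: cg]. Qed.

Lemma contX f n : cont f -> cont (fun x => f x ^+ n).
Proof.
move=> cf; elim: n => [|n IH]; first exact: cont_cst.
by rewrite (_ : (fun _ => _) = (fun x => f x * f x ^+ n)); [exact: contM|apply/funext => x; rewrite exprS].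
Qed.

Lemma contV f : (forall x, 0 <= x <= 1 -> f x != 0) -> cont f -> cont (fun x => (f x)^-1).
Proof. by move=> f0 cf x; apply: continuousV; [apply: f0; exact: clamp01|exact: cf]. Qed.

Lemma cont_comp f g : continuous g -> cont f -> cont (fun x => g (f x)).
Proof. by move=> cg cf x; apply: (@continuous_comp _ _ _ (f \o clamp) g); [exact: cf|exact: cg]. Qed.

Lemma cont_unif h : cont h -> forall e, 0 < e -> exists2 d, 0 < d &
  forall x y, 0 <= x <= 1 -> 0 <= y <= 1 -> `|x - y| < d -> `|h x - h y| <= e.
Proof.
move=> ch e e0.
have /compact_near_coveringP : compact `[0 : R, 1] by exact: segment_compact.
(* The parameter filter is that of right neighbourhoods of 0: around each point some modulus serves
   all small d, and compactness makes one d serve all x. *)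
move=> /(_ R (0^'+) (fun d x => forall y, 0 <= y <= 1 -> `|x - y| < d -> `|(h \o clamp) x - (h \o clamp) y| <= e) _) [].
  move=> x _; have /cvgrPdist_lt/(_ (e / 2) ltac:(by rewrite divr_gt0)) := ch x.
  move=> [d /= d0 hd].
  exists (ball x (d / 2), [set t : R | 0 < t < d / 2]).
    split; first by apply: nbhsx_ballx; rewrite divr_gt0.
    by near=> t; apply/andP; split; near: t;
      [exact: nbhs_right_gt|apply: nbhs_right_lt; rewrite divr_gt0].
  move=> [x' t] /= [xx' /andP[t0 td]] y y01 x'y.
  have h1 : `|h (clamp x) - h (clamp x')| < e / 2.
    by apply: hd; apply: (lt_le_trans xx'); lra.
  have h2 : `|h (clamp x) - h (clamp y)| < e / 2.
    apply: hd; rewrite /ball_/= (_ : x - y = (x - x') + (x' - y)); last by ring.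
    by apply: (le_lt_trans (ler_normD _ _)); rewrite /ball/= in xx'; lra.
  rewrite (_ : _ - _ = (h (clamp x) - h (clamp y)) - (h (clamp x) - h (clamp x'))); last by ring.
  by apply: (le_trans (ler_normB _ _)); lra.
move=> d /= d0 hd; exists (d / 2); first by rewrite divr_gt0.
move=> x y x01 y01 xy.
have d2 : 0 < d / 2 by rewrite divr_gt0.
have := hd (d / 2); rewrite /ball/= sub0r normrN (gtr0_norm d2).
move=> /(_ ltac:(lra) d2 x) /=; rewrite in_itv/= => /(_ x01 y y01 xy).
by rewrite !clampE.
Unshelve. all: end_near. Qed.

Lemma cont_bounded h : cont h -> exists2 C, 0 < C & forall x, 0 <= x <= 1 -> `|h x| <= C.
Proof.
move=> ch.
have ch' : {within `[0, 1], continuous (fun x => `|(h \o clamp) x|)}.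
  apply: continuous_subspaceT => x.
  by apply: (@continuous_comp _ _ _ (h \o clamp) Num.norm); [exact: ch|exact: norm_continuous].
have [c c01 hc] := EVT_max ler01 ch'.
exists (`|h (clamp c)| + 1); first by rewrite ltr_wpDl.
by move=> x x01; have := hc x; rewrite in_itv/= => /(_ x01); rewrite clampE//; lra.
Qed.

Lemma cont_pos h : cont h -> (forall x, 0 <= x <= 1 -> 0 < h x) ->
  exists2 c, 0 < c & forall x, 0 <= x <= 1 -> c <= h x.
Proof.
move=> ch h0; have ch' : {within `[0, 1], continuous (h \o clamp)}.
  by apply: continuous_subspaceT => x; exact: ch.
have [c c01 hc] := EVT_min ler01 ch'.
exists (h (clamp c)); first by apply: h0; exact: clamp01.
by move=> x x01; have := hc x; rewrite in_itv/= => /(_ x01); rewrite /= (clampE x01).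
Qed.

Lemma unif_cont h : (forall e, 0 < e -> exists2 d, 0 < d &
  forall x y, 0 <= x <= 1 -> 0 <= y <= 1 -> `|x - y| < d -> `|h x - h y| <= e) -> cont h.
Proof.
move=> H x; apply/cvgrPdist_le => e e0.
have [d d0 hd] := H e e0.
have /cvgrPdist_lt/(_ d d0) := @continuous_clamp x.
apply: filterS => t /= xt.
by apply: hd => //; exact: clamp01.
Qed.

Lemma cont_within h : cont h -> {within `[0, 1], continuous h}.
Proof.
move=> ch; apply: (@subspace_eq_continuous _ _ _ (h \o clamp)).
  by move=> x; rewrite inE/= in_itv/= => x01; rewrite /from_subspace/= clampE.
exact: continuous_subspaceT.
Qed.

Lemma within_cont h : {within `[0, 1], continuous h} -> cont h.
Proof.
move=> /subspace_continuousP ch x; apply/cvgrPdist_le => e e0.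
have := ch (clamp x); rewrite /= in_itv/= clamp01 => /(_ isT) /cvgrPdist_le/(_ e e0).
rewrite near_withinE => H.
have := @continuous_clamp x _ H; rewrite nbhs_simpl /=.
by apply: filterS => t /=; apply; rewrite in_itv/= clamp01.
Qed.

Lemma unif_lim_cont h : (forall e, 0 < e -> exists2 g, cont g &
  forall x, 0 <= x <= 1 -> `|h x - g x| <= e) -> cont h.
Proof.
move=> H; apply: unif_cont => e e0.
have [g cg hg] := H (e / 3) ltac:(by rewrite divr_gt0).
have [d d0 hd] := cont_unif cg (e := e / 3) ltac:(by rewrite divr_gt0).
exists d => // x y x01 y01 xy.
rewrite (_ : _ - _ = (h x - g x) + (g x - g y) - (h y - g y)); last by ring.
have := hg x x01; have := hg y y01; have := hd x y x01 y01 xy.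
by move=> ? ? ?; apply: (le_trans (ler_normB _ _)); have := ler_normD (h x - g x) (g x - g y); lra.
Qed.

End continuity_on_01.

(** * Differentials with respect to two clocks *)

Section mean_value.
Context {R : realType}.
Implicit Types (x y : R) (W M : R -> R).

Lemma telescope_le W M x y d e : 0 < d -> x <= y ->
  (forall s t, x <= s -> s <= t -> t <= y -> t - s < d -> W t - W s <= e * (M t - M s)) ->
  W y - W x <= e * (M y - M x).
Proof.
move=> d0 xy H.
have [n nd] : exists n : nat, (y - x) / n.+1%:R < d.
  have := archi_boundP (x := (y - x) / d) ltac:(by rewrite divr_ge0 ?subr_ge0// ltW).
  set n := Num.bound _ => hn; exists n.
  rewrite ltr_pdivrMr ?ltr0Sn// mulrC -ltr_pdivrMr//.
  by apply: (lt_trans hn); rewrite ltr_nat.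
set h := (y - x) / n.+1%:R in nd.
have h0 : 0 <= h by rewrite divr_ge0// subr_ge0.
have yE : y = x + n.+1%:R * h by rewrite /h mulrCA mulfV ?mulr1 ?pnatr_eq0// addrC subrK.
have claim k : (k <= n.+1)%N -> W (x + k%:R * h) - W x <= e * (M (x + k%:R * h) - M x).
  elim: k => [_|k IH kn]; first by rewrite mul0r addr0 !subrr mulr0.
  have xk : x + k.+1%:R * h <= y by rewrite yE lerD2l ler_wpM2r// ler_nat.
  have := H (x + k%:R * h) (x + k.+1%:R * h).
  rewrite lerDl mulr_ge0// lerD2l ler_wpM2r ?ler_nat//.
  move=> /(_ isT isT xk); rewrite -natr1 (_ : _ - _ = h); last by ring.
  move=> /(_ nd); have := IH (ltnW kn); lra.
by rewrite yE; exact: claim.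
Qed.

(** A positive gap W y - W x is incompatible with local increments below e times those of M for
    every e. This takes the place of the mean value theorem, no derivative in x being available. *)
Lemma mean_value_le W M x y : x <= y ->
  (forall e, 0 < e -> exists2 d, 0 < d & forall s t, x <= s -> s <= t -> t <= y ->
     t - s < d -> W t - W s <= e * (M t - M s)) ->
  W y <= W x.
Proof.
move=> xy H; rewrite leNgt; apply/negP => Wxy.
set m := M y - M x.
have m1 : 0 < `|m| + 1 by rewrite ltr_wpDl.
(* With this e the telescoped bound is at most half the gap; the added 1 covers m = 0. *)
set e := (W y - W x) / (2 * (`|m| + 1)).
have e0 : 0 < e by rewrite divr_gt0 ?subr_gt0// mulr_gt0.
have [d d0 hd] := H e e0.
have := telescope_le d0 xy hd; rewrite -/m.
have : e * m <= e * `|m| by rewrite ler_wpM2l ?ler_norm// ltW.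
have : e * (2 * (`|m| + 1)) = W y - W x by rewrite /e divfK// gt_eqF// mulr_gt0.
by nra.
Qed.

End mean_value.

Section stieltjes_differential.
Context {R : realType}.
Implicit Types (x y t e : R) (u v h g A B : R -> R).

(* [u] has differential [h1 dA + h2 dB] on [0,1]; the error is little-o of
   the increment of A + B, uniformly. *)
Definition sdiff A B (u h1 h2 : R -> R) := [/\ cont h1, cont h2 &
  forall e, 0 < e -> exists2 d, 0 < d & forall x y, 0 <= x -> x <= y -> y <= 1 -> y - x < d ->
  `|u y - u x - h1 x * (A y - A x) - h2 x * (B y - B x)|
    <= e * ((A y + B y) - (A x + B x))].

(** All that the calculus uses of the two distribution functions. Integration theory enters only
    through [clock_primitive], and continuity of A and B reflects atomlessness. *)
Record clocks A B : Prop := Clocks {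
  clock_mono1 : forall x y, 0 <= x -> x <= y -> y <= 1 -> A x <= A y;
  clock_mono2 : forall x y, 0 <= x -> x <= y -> y <= 1 -> B x <= B y;
  clock_cont1 : cont A;
  clock_cont2 : cont B;
  clock01 : A 0 = 0;
  clock02 : B 0 = 0;
  clock11 : A 1 = 1;
  clock12 : B 1 = 1;
  clock_primitive : forall h1 h2, cont h1 -> cont h2 ->
    exists2 u, sdiff A B u h1 h2 & u 0 = 0 }.

End stieltjes_differential.

Section stieltjes_calculus.
Context {R : realType} (A B : R -> R).
Implicit Types (x y t e : R) (u v h g : R -> R).
Hypothesis AB : clocks A B.
Let A_mono := clock_mono1 AB.
Let B_mono := clock_mono2 AB.
Let A_cont := clock_cont1 AB.
Let B_cont := clock_cont2 AB.
Local Notation sdiff := (sdiff A B).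

(** Applied to - u, [mean_value_le] only has to absorb the error term, because both parts of the
    differential are non-negative. *)
Lemma sdiff_le u h1 h2 x y : sdiff u h1 h2 ->
  (forall t, 0 <= t <= 1 -> 0 <= h1 t) -> (forall t, 0 <= t <= 1 -> 0 <= h2 t) ->
  0 <= x -> x <= y -> y <= 1 -> u x <= u y.
Proof.
move=> [_ _ H] h1p h2p x0 xy y1; rewrite -lerN2.
apply: (@mean_value_le _ (fun t => - u t) (fun t => A t + B t)) => // e e0.
have [d d0 hd] := H e e0; exists d => // s t xs st ty std.
have s0 : 0 <= s by exact: le_trans xs.
have t1 : t <= 1 by exact: le_trans y1.
have := hd s t s0 st t1 std; rewrite ler_norml => /andP[+ _].
have := h1p s; have := h2p s; rewrite s0 (le_trans st t1) => /(_ isT) h2s /(_ isT) h1s.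
have := A_mono s0 st t1; have := B_mono s0 st t1 => ? ?.
have : 0 <= h1 s * (A t - A s) by rewrite mulr_ge0// subr_ge0.
have : 0 <= h2 s * (B t - B s) by rewrite mulr_ge0// subr_ge0.
lra.
Qed.

Lemma sdiff_ext u v h1 h2 g1 g2 : sdiff u h1 h2 ->
  (forall x, 0 <= x <= 1 -> u x = v x) ->
  (forall x, 0 <= x <= 1 -> h1 x = g1 x) -> (forall x, 0 <= x <= 1 -> h2 x = g2 x) ->
  sdiff v g1 g2.
Proof.
move=> [c1 c2 H] uv hg1 hg2; split; [exact: cont_ext c1|exact: cont_ext c2|].
move=> e e0; have [d d0 hd] := H e e0; exists d => // x y x0 xy y1 xyd.
have x01 : 0 <= x <= 1 by rewrite x0 (le_trans xy).
have y01 : 0 <= y <= 1 by rewrite y1 (le_trans x0).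
by rewrite -!uv// -hg1// -hg2//; exact: hd.
Qed.

Lemma sdiff_cst c : sdiff (fun=> c) (fun=> 0) (fun=> 0).
Proof.
split; [exact: cont_cst|exact: cont_cst|move=> e e0; exists 1 => // x y x0 xy y1 _].
rewrite !mul0r subrr !subr0 normr0; apply: mulr_ge0; first exact: ltW.
by have := A_mono x0 xy y1; have := B_mono x0 xy y1; lra.
Qed.

Lemma sdiff_A : sdiff A (fun=> 1) (fun=> 0).
Proof.
split; [exact: cont_cst|exact: cont_cst|move=> e e0; exists 1 => // x y x0 xy y1 _].
rewrite mul0r mul1r subrr subr0 normr0; apply: mulr_ge0; first exact: ltW.
by have := A_mono x0 xy y1; have := B_mono x0 xy y1; lra.
Qed.

Lemma sdiff_B : sdiff B (fun=> 0) (fun=> 1).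
Proof.
split; [exact: cont_cst|exact: cont_cst|move=> e e0; exists 1 => // x y x0 xy y1 _].
rewrite mul0r mul1r subr0 subrr normr0; apply: mulr_ge0; first exact: ltW.
by have := A_mono x0 xy y1; have := B_mono x0 xy y1; lra.
Qed.

Lemma sdiffD u v h1 h2 g1 g2 : sdiff u h1 h2 -> sdiff v g1 g2 ->
  sdiff (fun x => u x + v x) (fun x => h1 x + g1 x) (fun x => h2 x + g2 x).
Proof.
move=> [ch1 ch2 Hu] [cg1 cg2 Hv]; split; [exact: contD|exact: contD|move=> e e0].
have e20 : 0 < e / 2 by rewrite divr_gt0.
have [d d0 hd] := Hu _ e20; have [d' d'0 hd'] := Hv _ e20.
exists (Order.min d d'); first by rewrite lt_min d0.
move=> x y x0 xy y1; rewrite lt_min => /andP[xyd xyd'].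
have := hd x y x0 xy y1 xyd; have := hd' x y x0 xy y1 xyd'.
rewrite !ler_norml => /andP[? ?] /andP[? ?]; apply/andP; split; lra.
Qed.

Lemma sdiff_scale u h1 h2 c : sdiff u h1 h2 ->
  sdiff (fun x => c * u x) (fun x => c * h1 x) (fun x => c * h2 x).
Proof.
move=> [ch1 ch2 Hu]; split; [by apply: contM => //; exact: cont_cst..|move=> e e0].
have c1 : 0 < `|c| + 1 by rewrite ltr_wpDl.
have [d d0 hd] := Hu (e / (`|c| + 1)) ltac:(by rewrite divr_gt0).
exists d => // x y x0 xy y1 xyd.
rewrite (_ : _ - _ = c * (u y - u x - h1 x * (A y - A x) - h2 x * (B y - B x))); last by ring.
rewrite normrM; have {hd} := hd x y x0 xy y1 xyd.
set E := `|_ - h2 x * _|; set m := _ - _ => hE.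
apply: (@le_trans _ _ ((`|c| + 1) * E)); first by apply: ler_wpM2r; rewrite ?lerDl// /E normr_ge0.
by rewrite mulrC -ler_pdivlMr// mulrAC.
Qed.

Lemma sdiffN u h1 h2 : sdiff u h1 h2 ->
  sdiff (fun x => - u x) (fun x => - h1 x) (fun x => - h2 x).
Proof. by move=> H; apply: (sdiff_ext (sdiff_scale (-1) H)) => x _; rewrite mulN1r. Qed.

Lemma sdiffB u v h1 h2 g1 g2 : sdiff u h1 h2 -> sdiff v g1 g2 ->
  sdiff (fun x => u x - v x) (fun x => h1 x - g1 x) (fun x => h2 x - g2 x).
Proof. by move=> Hu Hv; exact: (sdiffD Hu (sdiffN Hv)). Qed.

(** Both u - v and v - u have zero differential, so [sdiff_le] applies in both directions.
    Identities below are proved by comparing differentials and values at 0. *)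
Lemma sdiff_eq u v h1 h2 g1 g2 x : sdiff u h1 h2 -> sdiff v g1 g2 ->
  (forall t, 0 <= t <= 1 -> h1 t = g1 t) -> (forall t, 0 <= t <= 1 -> h2 t = g2 t) ->
  u 0 = v 0 -> 0 <= x <= 1 -> u x = v x.
Proof.
move=> Hu Hv e1 e2 e0 /andP[x0 x1]; apply/eqP; rewrite eq_le; apply/andP; split.
  have := @sdiff_le _ _ _ 0 x (sdiffB Hv Hu); rewrite lexx => /(_ _ _ isT x0 x1).
  by rewrite e0 subrr subr_ge0; apply=> t t01; rewrite ?e1 ?e2 ?subrr.
have := @sdiff_le _ _ _ 0 x (sdiffB Hu Hv); rewrite lexx => /(_ _ _ isT x0 x1).
by rewrite e0 subrr subr_ge0; apply=> t t01; rewrite ?e1 ?e2 ?subrr.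
Qed.

Lemma sdiff_const u h1 h2 x : sdiff u h1 h2 ->
  (forall t, 0 <= t <= 1 -> h1 t = 0) -> (forall t, 0 <= t <= 1 -> h2 t = 0) ->
  0 <= x <= 1 -> u x = u 0.
Proof. by move=> Hu e1 e2 x01; exact: (sdiff_eq Hu (sdiff_cst (u 0)) e1 e2 erefl x01). Qed.

Lemma sdiff_lip u h1 h2 : sdiff u h1 h2 -> exists2 C, 0 < C &
  exists2 d, 0 < d & forall x y, 0 <= x -> x <= y -> y <= 1 -> y - x < d ->
  `|u y - u x| <= C * ((A y + B y) - (A x + B x)).
Proof.
move=> [ch1 ch2 /(_ 1 ltr01) [d d0 hd]].
have [C1 C10 b1] := cont_bounded ch1; have [C2 C20 b2] := cont_bounded ch2.
exists (C1 + C2 + 1); first by lra.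
exists d => // x y x0 xy y1 xyd.
have x01 : 0 <= x <= 1 by rewrite x0 (le_trans xy).
have := hd x y x0 xy y1 xyd; have := A_mono x0 xy y1; have := B_mono x0 xy y1.
have := b1 x x01; have := b2 x x01; rewrite !ler_norml => /andP[? ?] /andP[? ?] ? ? /andP[? ?].
by apply/andP; split; nra.
Qed.

Lemma clock_unif e : 0 < e -> exists2 d, 0 < d & forall x y, 0 <= x -> x <= y -> y <= 1 -> y - x < d ->
  (A y + B y) - (A x + B x) <= e.
Proof.
move=> e0; have [d d0 hd] := cont_unif (contD A_cont B_cont) e0.
exists d => // x y x0 xy y1 xyd.
apply: (le_trans (ler_norm _)); apply: hd; rewrite ?y1 ?x0 ?(le_trans xy y1) ?(le_trans x0 xy)//.
by rewrite ger0_norm// subr_ge0.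
Qed.

Lemma sdiff_cont u h1 h2 : sdiff u h1 h2 -> cont u.
Proof.
move=> /sdiff_lip [C C0 [d d0 hd]]; apply: unif_cont => e e0.
have [d' d'0 hd'] := clock_unif (e := e / C) ltac:(by rewrite divr_gt0).
exists (Order.min d d'); first by rewrite lt_min d0.
have key x y : 0 <= x -> x <= y -> y <= 1 -> y - x < Order.min d d' -> `|u y - u x| <= e.
  move=> x0 xy y1; rewrite lt_min => /andP[xyd xyd'].
  apply: (le_trans (hd x y x0 xy y1 xyd)).
  by rewrite mulrC -ler_pdivlMr//; exact: hd'.
move=> x y /andP[x0 x1] /andP[y0 y1]; case: (leP x y) => [xy|/ltW yx].
  by rewrite distrC => xyd; rewrite distrC; apply: key => //; exact: le_lt_trans (ler_norm _) _.
by move=> xyd; apply: key => //; exact: le_lt_trans (ler_norm _) _.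
Qed.

(** Chain rule. The Taylor remainder is quadratic in the increment of u, hence by [sdiff_lip] in the
    increment m of A + B, and m ^ 2 is a small multiple of m because the clocks are uniformly
    continuous. *)
Lemma sdiff_comp u h1 h2 (F dF : R -> R) C : sdiff u h1 h2 ->
  cont (fun x => dF (u x)) ->
  (forall x y, 0 <= x <= 1 -> 0 <= y <= 1 ->
     `|F (u y) - F (u x) - dF (u x) * (u y - u x)| <= C * (u y - u x) ^+ 2) ->
  sdiff (fun x => F (u x)) (fun x => dF (u x) * h1 x) (fun x => dF (u x) * h2 x).
Proof.
move=> Hu cdF Htay; have [C0 C00 [d0 d00 hlip]] := sdiff_lip Hu.
case: (Hu) => ch1 ch2 H; split; [exact: contM|exact: contM|move=> e e0].
have [K K0 bK] := cont_bounded cdF.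
have [d1 d10 hd1] := H (e / (2 * K)) ltac:(by rewrite divr_gt0// mulr_gt0).
have L0 : 0 < 2 * (`|C| + 1) * C0 ^+ 2 by rewrite !mulr_gt0// ?exprn_gt0// ltr_wpDl.
have [d2 d20 hd2] := clock_unif (e := e / (2 * (`|C| + 1) * C0 ^+ 2)) ltac:(by rewrite divr_gt0).
exists (Order.min d0 (Order.min d1 d2)); first by rewrite !lt_min d00 d10.
move=> x y x0 xy y1; rewrite !lt_min => /and3P[xyd0 xyd1 xyd2].
have x01 : 0 <= x <= 1 by rewrite x0 (le_trans xy).
have y01 : 0 <= y <= 1 by rewrite y1 (le_trans x0).
have {hlip} := hlip x y x0 xy y1 xyd0; have {hd1} := hd1 x y x0 xy y1 xyd1.
have {hd2} := hd2 x y x0 xy y1 xyd2; have {Htay} := Htay x y x01 y01; have {bK} := bK x x01.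
have m0 : 0 <= (A y + B y) - (A x + B x).
  by have := A_mono x0 xy y1; have := B_mono x0 xy y1; lra.
set m := (A y + B y) - _ in m0 *; set du := u y - u x; set k := dF (u x).
set a := A y - A x; set b := B y - B x.
move=> hk htay hm hdu hlip.
rewrite (_ : F (u y) - F (u x) - _ - _ = (F (u y) - F (u x) - k * du) + k * (du - h1 x * a - h2 x * b)); last by ring.
apply: (le_trans (ler_normD _ _)); rewrite normrM.
have t1 : `|k| * `|du - h1 x * a - h2 x * b| <= e / 2 * m.
  apply: (@le_trans _ _ (K * (e / (2 * K) * m))); first exact: ler_pM.
  by rewrite mulrA le_eqVlt; apply/orP; left; apply/eqP; congr (_ * _); field; rewrite gt_eqF.
have t2 : C * du ^+ 2 <= e / 2 * m.
  apply: (@le_trans _ _ ((`|C| + 1) * (C0 * m) ^+ 2)).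
    apply: (@le_trans _ _ ((`|C| + 1) * du ^+ 2)).
      by rewrite ler_wpM2r ?sqr_ge0//; have := ler_norm C; lra.
    by rewrite ler_wpM2l ?addr_ge0// -[du ^+ 2]real_normK ?num_real// ler_pXn2r ?nnegrE ?mulr_ge0// ltW.
  have := ler_wpM2r m0 hm; rewrite -(ler_pM2l L0).
  rewrite [X in _ <= X]mulrA (mulrCA _ e) mulfV ?gt_eqF// mulr1.
  have -> : 2 * (`|C| + 1) * C0 ^+ 2 * (m * m) = 2 * ((`|C| + 1) * (C0 * m) ^+ 2) by ring.
  lra.
have := le_trans htay t2; lra.
Qed.

Lemma sdiff_sqr u h1 h2 : sdiff u h1 h2 ->
  sdiff (fun x => u x ^+ 2) (fun x => 2 * u x * h1 x) (fun x => 2 * u x * h2 x).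
Proof.
move=> Hu; apply: (@sdiff_comp u h1 h2 (fun t => t ^+ 2) (fun t => 2 * t) 1) => //.
  by apply: contM; [exact: cont_cst|exact: sdiff_cont Hu].
by move=> x y _ _; rewrite mul1r le_eqVlt -[X in _ == X]ger0_norm ?sqr_ge0//; apply/orP; left; apply/eqP; congr `|_|; ring.
Qed.

(* Polarization reduces the product rule to squares. *)
Lemma sdiffM u v h1 h2 g1 g2 : sdiff u h1 h2 -> sdiff v g1 g2 ->
  sdiff (fun x => u x * v x) (fun x => u x * g1 x + v x * h1 x) (fun x => u x * g2 x + v x * h2 x).
Proof.
move=> Hu Hv; apply: (sdiff_ext (sdiff_scale (1 / 2)
  (sdiffB (sdiff_sqr (sdiffD Hu Hv)) (sdiffD (sdiff_sqr Hu) (sdiff_sqr Hv))))) => x _; by field.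
Qed.

(** The Taylor remainder equals (u y)^-1 (u x)^-2 (u y - u x)^2, whence the constant c^-3 for a
    positive lower bound c of u. *)
Lemma sdiff_inv u h1 h2 : sdiff u h1 h2 -> (forall x, 0 <= x <= 1 -> 0 < u x) ->
  sdiff (fun x => (u x)^-1) (fun x => - (u x) ^- 2 * h1 x) (fun x => - (u x) ^- 2 * h2 x).
Proof.
move=> Hu up; have cu := sdiff_cont Hu.
have [c c0 hc] := cont_pos cu up.
apply: (@sdiff_comp u h1 h2 (fun t => t^-1) (fun t => - t ^- 2) (c ^- 3)) => //.
  apply: contN; apply: contV; last exact: contX.
  by move=> x x01; rewrite expf_eq0/= gt_eqF// up.
move=> x y x01 y01.
have ux := up x x01; have uy := up y y01.
have -> : (u y)^-1 - (u x)^-1 - - (u x) ^- 2 * (u y - u x) = (u y)^-1 * (u x) ^- 2 * (u y - u x) ^+ 2.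
  by field; rewrite !gt_eqF.
rewrite ger0_norm; last by apply: mulr_ge0; [apply: mulr_ge0; rewrite invr_ge0 ?sqr_ge0// ltW|exact: sqr_ge0].
rewrite ler_wpM2r ?sqr_ge0// -invfM lef_pV2 ?posrE ?mulr_gt0 ?exprn_gt0//.
rewrite exprS; apply: ler_pM; [exact: ltW|exact/exprn_ge0/ltW|exact: hc|].
by rewrite ler_pXn2r ?nnegrE ?hc// ltW.
Qed.

(** The mean value theorem replaces the increment by a derivative at an intermediate point, and that
    derivative is itself 1-Lipschitz. *)
Lemma sin_cos_taylor (a b : R) :
  `|sin b - sin a - cos a * (b - a)| <= (b - a) ^+ 2 /\
  `|cos b - cos a - - sin a * (b - a)| <= (b - a) ^+ 2.
Proof.
have mvt (f df : R -> R) (s t : R) : (forall x : R, is_derive x 1 f (df x)) ->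
    exists2 c, `|c - s| <= `|t - s| & f t - f s = df c * (t - s).
  move=> fd; have cf : continuous f.
    by move=> x; apply/differentiable_continuous/derivable1_diffP; case: (fd x).
  case: (leP s t) => [st|/ltW ts].
    have [c] := MVT_segment st (fun x _ => fd x) (continuous_subspaceT cf).
    rewrite in_itv/= => /andP[sc ct] ->; exists c => //.
    by rewrite !ger0_norm ?subr_ge0// lerD2r.
  have [c] := MVT_segment ts (fun x _ => fd x) (continuous_subspaceT cf).
  rewrite in_itv/= => /andP[sc ct] E; exists c.
    by rewrite !ler0_norm ?subr_le0// lerN2 lerD2r.
  by rewrite -opprB E -mulrN opprB.
have lip (f df : R -> R) (s t : R) : (forall x : R, is_derive x 1 f (df x)) -> (forall x, `|df x| <= 1) ->
    `|f t - f s| <= `|t - s|.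
  move=> fd df1; have [c _ ->] := mvt f df s t fd.
  by rewrite normrM ler_piMl.
have ls := fun s t => lip _ _ s t (@is_derive_sin R) (@cos_max R).
have lc := fun s t => lip _ _ s t (@is_derive_cos R) (fun x => eq_ind_r (fun z => is_true (z <= 1)) (@sin_max R x) (normrN (sin x))).
split.
  have [c hc ->] := mvt _ _ a b (@is_derive_sin R).
  rewrite -mulrBl normrM -[(b - a) ^+ 2]real_normK ?num_real// expr2 ler_wpM2r//.
  exact: le_trans (lc _ _) hc.
have [c hc ->] := mvt _ _ a b (@is_derive_cos R).
rewrite -mulrBl normrM -[(b - a) ^+ 2]real_normK ?num_real// expr2 ler_wpM2r//.
by rewrite -opprD normrN; exact: le_trans (ls _ _) hc.
Qed.

Lemma sdiff_sin u h1 h2 : sdiff u h1 h2 ->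
  sdiff (fun x => sin (u x)) (fun x => cos (u x) * h1 x) (fun x => cos (u x) * h2 x).
Proof.
move=> Hu; apply: (@sdiff_comp u h1 h2 sin cos 1) => //.
  by apply: cont_comp; [exact: continuous_cos|exact: sdiff_cont Hu].
by move=> x y _ _; rewrite mul1r; exact: (sin_cos_taylor _ _).1.
Qed.

Lemma sdiff_cos u h1 h2 : sdiff u h1 h2 ->
  sdiff (fun x => cos (u x)) (fun x => - sin (u x) * h1 x) (fun x => - sin (u x) * h2 x).
Proof.
move=> Hu; apply: (@sdiff_comp u h1 h2 cos (fun t => - sin t) 1) => //.
  by apply: contN; apply: cont_comp; [exact: continuous_sin|exact: sdiff_cont Hu].
by move=> x y _ _; rewrite mul1r; exact: (sin_cos_taylor _ _).2.
Qed.

End stieltjes_calculus.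

(** * The linear system df = p dA, dp = - l f dB *)

Section exponential_domination.
Context {R : realType}.
Implicit Types (c : R ^nat) (K L : R).

Lemma exp_coeff_small K L e : 0 <= L -> 0 < e ->
  exists N : nat, forall n, (N <= n)%N ->
    K * (expR L - series (exp_coeff L) n) <= e.
Proof.
move=> L0 e0; have K1 : 0 < `|K| + 1 by rewrite ltr_wpDl.
have /cvgrPdist_le/(_ (e / (`|K| + 1)) ltac:(by rewrite divr_gt0)) :=
  is_cvg_series_exp_coeff L.
move=> [N _ HN]; exists N => n Nn; have := HN n Nn; rewrite -/(expR L) => h.
apply: (le_trans (ler_norm _)); rewrite normrM.
apply: (@le_trans _ _ ((`|K| + 1) * `|expR L - series (exp_coeff L) n|)).
  by apply: ler_wpM2r => //; rewrite lerDl.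
by rewrite mulrC -ler_pdivlMr.
Qed.

(** The tail is compared with that of the exponential series; as only K and L enter, the bound is
    uniform in x for series of functions. *)
Lemma series_dominated c K L : 0 <= L -> (forall n, `|c n| <= K * (L ^+ n / n`!%:R)) ->
  forall N, `|limn (series c) - series c N| <= K * (expR L - series (exp_coeff L) N).
Proof.
move=> L0 cK N.
have K0 : 0 <= K by have := cK 0%N; rewrite expr0 divr1 mulr1; exact: le_trans.
have cs : cvgn (series c).
  apply: normed_cvg; apply: (@series_le_cvg _ _ (K *: exp_coeff L)) => //.
  - by move=> n; exact: normr_ge0.
  - by move=> n; exact: (mulr_ge0 K0 (exp_coeff_ge0 n L0)).
  - exact/is_cvg_seriesZ/is_cvg_series_exp_coeff.
have fin M : (N <= M)%N -> `|series c M - series c N| <= K * (expR L - series (exp_coeff L) N).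
  move=> NM; rewrite sub_series_geq//; apply: (le_trans (ler_norm_sum _ _ _)).
  apply: (@le_trans _ _ (K * \sum_(N <= k < M) exp_coeff L k)).
    by rewrite mulr_sumr; apply: ler_sum => i _; exact: cK.
  rewrite -sub_series_geq// ler_wpM2l// lerD2r.
  apply: nondecreasing_cvgn_le; last exact: is_cvg_series_exp_coeff.
  by apply: nondecreasing_series => n _ _; exact: exp_coeff_ge0.
apply/ler_addgt0Pr => e e0.
have /cvgrPdist_le/(_ e e0) [M _ HM] := cs.
have := HM (maxn M N) (leq_maxl _ _); have := fin (maxn M N) (leq_maxr _ _).
set s := series c (maxn M N) => h1 h2.
rewrite (_ : _ - _ = (s - series c N) + (limn (series c) - s)); last by ring.
by apply: (le_trans (ler_normD _ _)); rewrite lerD.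
Qed.

End exponential_domination.

Section linear_system.
Context {R : realType} (A B : R -> R).
Implicit Types (x y t e l a b C L : R) (u v h g f p : R -> R).
Hypothesis AB : clocks A B.
Local Notation sdiff := (sdiff A B).

Let A01 x : 0 <= x <= 1 -> 0 <= A x <= 1.
Proof.
move=> /andP[x0 x1]; rewrite -{1}(clock01 AB) -(clock11 AB).
by rewrite !(clock_mono1 AB).
Qed.

Let B01 x : 0 <= x <= 1 -> 0 <= B x <= 1.
Proof.
move=> /andP[x0 x1]; rewrite -{1}(clock02 AB) -(clock12 AB).
by rewrite !(clock_mono2 AB).
Qed.

(** Both v + u and v - u increase. This stands in for bounding an integral by the integral of the
    absolute value. *)
Lemma sdiff_norm_le u v h1 h2 g1 g2 x : sdiff u h1 h2 -> sdiff v g1 g2 ->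
  (forall t, 0 <= t <= 1 -> `|h1 t| <= g1 t) -> (forall t, 0 <= t <= 1 -> `|h2 t| <= g2 t) ->
  `|u 0| <= v 0 -> 0 <= x <= 1 -> `|u x| <= v x.
Proof.
move=> Hu Hv e1 e2 e0 /andP[x0 x1].
have e1' t : 0 <= t <= 1 -> - g1 t <= h1 t <= g1 t by move=> t01; rewrite -ler_norml e1.
have e2' t : 0 <= t <= 1 -> - g2 t <= h2 t <= g2 t by move=> t01; rewrite -ler_norml e2.
move: e0; rewrite !ler_norml => /andP[u1 u2]; apply/andP; split.
  have : v 0 + u 0 <= v x + u x.
    by apply: (@sdiff_le _ _ _ AB _ _ _ 0 x (sdiffD Hv Hu)) => // t => [/e1'|/e2']; lra.
  by lra.
have : v 0 - u 0 <= v x - u x.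
  by apply: (@sdiff_le _ _ _ AB _ _ _ 0 x (sdiffB Hv Hu)) => // t => [/e1'|/e2']; lra.
by lra.
Qed.

(** The scale d of an approximant may shrink along the approximation, so its error estimate does not
    pass to the limit. Instead h1 and h2 are integrated to some w, and [sdiff_norm_le] shows that w
    and u differ by a constant. *)
Lemma sdiff_lim u h1 h2 : (forall e, 0 < e -> exists v g1 g2, sdiff v g1 g2 /\
    forall x, 0 <= x <= 1 -> [/\ `|u x - v x| <= e, `|h1 x - g1 x| <= e & `|h2 x - g2 x| <= e]) ->
  sdiff u h1 h2.
Proof.
move=> H.
have ch1 : cont h1.
  apply: unif_lim_cont => e e0; have [v [g1 [g2 [[cg1 _ _] hv]]]] := H e e0.
  by exists g1 => // x /hv[].
have ch2 : cont h2.
  apply: unif_lim_cont => e e0; have [v [g1 [g2 [[_ cg2 _] hv]]]] := H e e0.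
  by exists g2 => // x /hv[].
have [w Hw w0] := clock_primitive AB ch1 ch2.
have uw x : 0 <= x <= 1 -> w x + u 0 = u x.
  move=> x01; apply/eqP; rewrite -subr_eq0 -normr_le0; apply/ler_addgt0Pr => e e0.
  (* A + B is at most 2, so w - v + v 0 contributes e / 2, while u - v contributes e / 4 at x and at
     0. *)
  rewrite add0r; have [v [g1 [g2 [Hv hv]]]] := H (e / 4) ltac:(by rewrite divr_gt0).
  have z01 : 0 <= (0 : R) <= 1 by rewrite lexx ler01.
  have [ux _ _] := hv x x01; have [u0 _ _] := hv 0 z01.
  have bnd : `|(w x - v x) + v 0| <= e / 4 * (A x + B x).
    apply: (sdiff_norm_le (sdiffD (sdiffB Hw Hv) (sdiff_cst AB (v 0)))
      (sdiff_scale (e / 4) (sdiffD (sdiff_A AB) (sdiff_B AB))) _ _ _ x01).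
    - by move=> t t01; have [_ ht _] := hv t t01; rewrite !addr0 mulr1.
    - by move=> t t01; have [_ _ ht] := hv t t01; rewrite addr0 add0r mulr1.
    - by rewrite w0 sub0r addNr normr0 (clock01 AB) (clock02 AB) addr0 mulr0.
  have := A01 x01; have := B01 x01 => /andP[? ?] /andP[? ?].
  have e40 : 0 <= e / 4 by rewrite ltW// divr_gt0.
  have : e / 4 * (A x + B x) <= e / 4 * 2 by apply: ler_wpM2l => //; lra.
  move: bnd ux u0; rewrite !ler_norml => /andP[? ?] /andP[? ?] /andP[? ?] ?.
  by apply/andP; split; lra.
by apply: (sdiff_ext (sdiffD Hw (sdiff_cst AB (u 0))) uw) => x _; rewrite addr0.
Qed.

Lemma sdiff_BX n : sdiff (fun x => B x ^+ n.+1) (fun=> 0) (fun x => n.+1%:R * B x ^+ n).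
Proof.
elim: n => [|n IH].
  by apply: (sdiff_ext (sdiff_B AB)) => x _; rewrite ?expr1// expr0 mulr1.
apply: (sdiff_ext (sdiffM AB (sdiff_B AB) IH)) => x _; rewrite -?exprS//.
  by rewrite !mulr0 addr0.
by rewrite mulr1 mulrCA -exprS -[in RHS]natr1 mulrDl mul1r.
Qed.

(** Coefficients of the solution as a power series in l: equating powers in df = p dA, dp = - l f dB
    gives the recursion. Induction bounds the n-th terms by K B ^ n / n!, so the series converges
    for every l. *)
Lemma picard_terms a b : exists K (f p : nat -> R -> R), [/\
  forall n, sdiff (f n) (p n) (fun=> 0),
  f 0%N 0 = a /\ p 0%N 0 = b,
  forall n, f n.+1 0 = 0 /\ p n.+1 0 = 0,
  sdiff (p 0%N) (fun=> 0) (fun=> 0) /\ forall n, sdiff (p n.+1) (fun=> 0) (fun x => - f n x) &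
  forall n x, 0 <= x <= 1 -> `|f n x| <= K / n`!%:R /\ `|p n x| <= K / n`!%:R].
Proof.
have c0 : cont (fun=> 0 : R) by exact: cont_cst.
(* [JA] and [JB] integrate against dA and dB; their default value at discontinuous functions never
   arises. *)
have /choice [JA HA] : forall h, exists u, cont h -> sdiff u h (fun=> 0) /\ u 0 = 0.
  move=> h; have [ch|nch] := pselect (cont h); last by exists h.
  by have [u] := clock_primitive AB ch c0; exists u.
have /choice [JB HB] : forall h, exists u, cont h -> sdiff u (fun=> 0) h /\ u 0 = 0.
  move=> h; have [ch|nch] := pselect (cont h); last by exists h.
  by have [u] := clock_primitive AB c0 ch; exists u.
pose f0 x := a + b * A x; pose p0 (x : R) := b.
pose step (fp : (R -> R) * (R -> R)) := let p := JB (fun x => - fp.1 x) in (JA p, p).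
pose fp n := iter n step (f0, p0).
pose f n := (fp n).1; pose p n := (fp n).2.
have df0 : sdiff f0 p0 (fun=> 0).
  apply: (sdiff_ext (sdiffD (sdiff_cst AB a) (sdiff_scale b (sdiff_A AB)))) => x _ //.
    by rewrite add0r mulr1.
  by rewrite add0r mulr0.
have dp0 : sdiff p0 (fun=> 0) (fun=> 0) by exact: sdiff_cst.
have cf n : cont (f n).
  elim: n => [|n IH]; first exact: (sdiff_cont AB df0).
  have [dp _] := HB _ (contN IH).
  by have [df _] := HA _ (sdiff_cont AB dp); exact: (sdiff_cont AB df).
have dp n : sdiff (p n.+1) (fun=> 0) (fun x => - f n x) by have [] := HB _ (contN (cf n)).
have cp n : cont (p n) by case: n => [|n]; [exact: (sdiff_cont AB dp0)|exact: (sdiff_cont AB (dp n))].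
have df n : sdiff (f n) (p n) (fun=> 0).
  by case: n => [|n]; [exact: df0|have [] := HA _ (cp n.+1)].
have pS0 n : p n.+1 0 = 0 by have [] := HB _ (contN (cf n)).
have fS0 n : f n.+1 0 = 0 by have [] := HA _ (cp n.+1).
set K := `|a| + `|b|.
have K0 : 0 <= K by rewrite addr_ge0.
have bnd n : forall x, 0 <= x <= 1 ->
    `|f n x| <= K / n`!%:R * B x ^+ n /\ `|p n x| <= K / n`!%:R * B x ^+ n.
  elim: n => [|n IH].
    move=> x x01; rewrite expr0 fact0 divr1 mulr1 /f /p /fp /= /f0 /p0; split; last by rewrite lerDr.
    apply: (le_trans (ler_normD _ _)); rewrite lerD2l normrM ler_piMr//.
    by have /andP[Ax0 Ax1] := A01 x01; rewrite ger0_norm.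
  have nK : K / n`!%:R = K / (n.+1)`!%:R * n.+1%:R.
    by rewrite factS natrM invfM mulrA mulrAC divfK// pnatr_eq0.
  have bp t : 0 <= t <= 1 -> `|p n.+1 t| <= K / (n.+1)`!%:R * B t ^+ n.+1.
    move=> t01; apply: (sdiff_norm_le (dp n) (sdiff_scale (K / (n.+1)`!%:R) (sdiff_BX n)) _ _ _ t01).
    - by move=> s _; rewrite normr0 mulr0.
    - by move=> s s01; rewrite normrN mulrA -nK; have [] := IH s s01.
    - by rewrite pS0 normr0 (clock02 AB) expr0n/= mulr0.
  move=> x x01; split; last exact: bp.
  have B0 t : 0 <= t <= 1 -> 0 <= B t by move=> /B01/andP[].
  have Kn m : 0 <= K / m`!%:R by rewrite divr_ge0.
  (* This majorant works because the dA part of B ^ (n + 1) A is B ^ (n + 1), which dominates p, and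
     its dB part is non-negative. *)
  apply: (@le_trans _ _ (K / (n.+1)`!%:R * (B x ^+ n.+1 * A x))).
    apply: (sdiff_norm_le (df n.+1) (sdiff_scale (K / (n.+1)`!%:R) (sdiffM AB (sdiff_BX n) (sdiff_A AB))) _ _ _ x01).
    - by move=> s s01; rewrite mulr1 mulr0 addr0; exact: bp.
    - move=> s s01; rewrite normr0 mulr0 add0r; have /andP[As _] := A01 s01.
      by rewrite !mulr_ge0// exprn_ge0// B0.
    - by rewrite fS0 normr0 (clock01 AB) !mulr0.
  have /andP[Ax0 Ax1] := A01 x01.
  by rewrite ler_wpM2l// ler_piMr// exprn_ge0// B0.
exists K, f, p; split => //.
  by split=> //; rewrite /f /= /f0 (clock01 AB) mulr0 addr0.
move=> n x x01; have [h1 h2] := bnd n x x01; have /andP[Bx0 Bx1] := B01 x01.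
have le : K / n`!%:R * B x ^+ n <= K / n`!%:R by rewrite ler_piMr ?divr_ge0// exprn_ile1.
by split; [exact: le_trans h1 _|exact: le_trans h2 _].
Qed.

Definition solution l f p := sdiff f p (fun=> 0) /\ sdiff p (fun=> 0) (fun x => - (l * f x)).

(** The sharp factor n L ^ (n - 1) is traded for (L + 1) ^ n, which keeps the shape of an
    exponential series. *)
Lemma normr_subX_le l l' L n : `|l| <= L -> `|l'| <= L ->
  `|l ^+ n - l' ^+ n| <= `|l - l'| * (L + 1) ^+ n.
Proof.
move=> lL l'L; have L0 : 0 <= L by exact: le_trans lL.
elim: n => [|n IH]; first by rewrite subrr normr0 mulr_ge0.
rewrite !exprS (_ : _ - _ = l * (l ^+ n - l' ^+ n) + (l - l') * l' ^+ n); last by ring.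
apply: (le_trans (ler_normD _ _)); rewrite !normrM normrX.
have h1 : `|l| * `|l ^+ n - l' ^+ n| <= L * (`|l - l'| * (L + 1) ^+ n) by apply: ler_pM.
have h2 : `|l - l'| * `|l'| ^+ n <= `|l - l'| * (L + 1) ^+ n.
  by rewrite ler_wpM2l// lerXn2r ?nnegrE ?addr_ge0//; lra.
by rewrite mulrDl mul1r mulrDr mulrCA; lra.
Qed.

(** The power series is summed, and Lipschitz dependence on l comes from the same kind of majorant
    with L + 1 in place of L. It is uniform in x, as comparing angles over all of [0,1] demands. *)
Lemma solution_family a b : exists f p : R -> R -> R,
  (forall l, [/\ solution l (f l) (p l), f l 0 = a & p l 0 = b]) /\
  forall L, 0 <= L -> exists2 C, 0 < C & forall l l' x, `|l| <= L -> `|l'| <= L -> 0 <= x <= 1 ->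
    `|f l x - f l' x| <= C * `|l - l'| /\ `|p l x - p l' x| <= C * `|l - l'|.
Proof.
have [K [f [p [df [f00 p00] fpS [dp0 dp] bnd]]]] := picard_terms a b.
have K0 : 0 <= K.
  have [+ _] := bnd 0%N 0 ltac:(by rewrite lexx ler01).
  by rewrite fact0 divr1; exact: le_trans.
pose c (q : nat -> R -> R) l x : R^nat := [sequence l ^+ n * q n x]_n.
have cb q l x L : `|l| <= L -> (forall n, `|q n x| <= K / n`!%:R) ->
    forall n, `|c q l x n| <= K * (L ^+ n / n`!%:R).
  move=> lL qb n; rewrite /c /= normrM normrX [X in _ <= X]mulrCA.
  apply: ler_pM => //; rewrite ?exprn_ge0//.
  by rewrite lerXn2r ?nnegrE// (le_trans _ lL).
pose S (q : nat -> R -> R) l x := limn (series (c q l x)).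
have near_sum q l e : (forall n x, 0 <= x <= 1 -> `|q n x| <= K / n`!%:R) -> 0 < e ->
    exists N, forall n, (N <= n)%N -> forall x, 0 <= x <= 1 -> `|S q l x - series (c q l x) n| <= e.
  move=> qb e0; have [N HN] := exp_coeff_small K (normr_ge0 l) e0.
  exists N => n Nn x x01; apply: le_trans (HN n Nn).
  by apply: series_dominated => //; apply: cb => // m; exact: qb.
have dF l n : sdiff (fun x => series (c f l x) n) (fun x => series (c p l x) n) (fun=> 0).
  elim: n => [|n IH].
    by apply: (sdiff_ext (sdiff_cst AB 0)) => x _; rewrite /series/= ?big_geq.
  apply: (sdiff_ext (sdiffD IH (sdiff_scale (l ^+ n) (df n)))) => x _;
    by rewrite ?mulr0 ?addr0// /series/= big_nat_recr.
(* The index shifts by one because dp carries a factor l: n + 1 terms of p go with n terms of f. *)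
have dP l n : sdiff (fun x => series (c p l x) n.+1) (fun=> 0) (fun x => - (l * series (c f l x) n)).
  elim: n => [|n IH].
    apply: (sdiff_ext dp0) => x _ //; rewrite /series/=.
      by rewrite big_nat1 /c /= expr0 mul1r.
    by rewrite big_geq// mulr0 oppr0.
  apply: (sdiff_ext (sdiffD IH (sdiff_scale (l ^+ n.+1) (dp n)))) => x _.
  - by rewrite /series/= [RHS]big_nat_recr.
  - by rewrite mulr0 addr0.
  - by rewrite [in RHS]/series/= [in RHS]big_nat_recr//= -/(series _ _) exprS mulrDr opprD mulrN mulrA.
have fb n x (x01 : 0 <= x <= 1) := (bnd n x x01).1.
have pb n x (x01 : 0 <= x <= 1) := (bnd n x x01).2.
have S0 q l a' : q 0%N 0 = a' -> (forall n, q n.+1 0 = 0) -> S q l 0 = a'.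
  move=> q0 qS; apply: cvg_lim => //; apply/cvgrPdist_le => e e0.
  exists 1%N => // -[//|n] _; rewrite /series/= big_nat_recl//= /c /= expr0 mul1r q0.
  rewrite big1 ?addr0 ?subrr ?normr0 ?ltW// => i _.
  by rewrite qS mulr0.
exists (S f), (S p); split.
  move=> l; split; last by apply: S0 => // n; have [] := fpS n.
    2: by apply: S0 => // n; have [] := fpS n.
  split; apply: sdiff_lim => e e0.
    have [N1 H1] := near_sum f l e fb e0; have [N2 H2] := near_sum p l e pb e0.
    exists (fun x => series (c f l x) (maxn N1 N2)), (fun x => series (c p l x) (maxn N1 N2)), (fun=> 0).
    split; first exact: dF.
    move=> x x01; split; [exact: H1 (leq_maxl _ _) _ _|exact: H2 (leq_maxr _ _) _ _|].
    by rewrite subrr normr0 ltW.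
  have l1 : 0 < `|l| + 1 by rewrite ltr_wpDl.
  have [N1 H1] := near_sum f l (e / (`|l| + 1)) fb ltac:(by rewrite divr_gt0).
  have [N2 H2] := near_sum p l e pb e0.
  exists (fun x => series (c p l x) (maxn N1 N2).+1), (fun=> 0),
    (fun x => - (l * series (c f l x) (maxn N1 N2))); split; first exact: dP.
  move=> x x01; split.
  - by apply: H2 => //; rewrite (leq_trans (leq_maxr N1 N2)).
  - by rewrite subrr normr0 ltW.
  - rewrite -opprD normrN -mulrBr normrM.
    have := H1 _ (leq_maxl N1 N2) x x01; set z := `|_ - _| => hz.
    apply: (@le_trans _ _ ((`|l| + 1) * z)).
      by apply: ler_wpM2r; rewrite ?lerDl// /z normr_ge0.
    by rewrite mulrC -ler_pdivlMr.
move=> L L0; exists ((K + 1) * expR (L + 1)).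
  by rewrite mulr_gt0 ?expR_gt0// ltr_wpDl.
have key q l l' x : (forall n, `|q n x| <= K / n`!%:R) -> `|l| <= L -> `|l'| <= L ->
    `|S q l x - S q l' x| <= (K + 1) * expR (L + 1) * `|l - l'|.
  move=> qb lL l'L.
  have cv m : `|m| <= L -> cvgn (series (c q m x)).
    move=> mL; apply: normed_cvg; apply: (@series_le_cvg _ _ (K *: exp_coeff L)) => //.
    - by move=> n; exact: normr_ge0.
  - by move=> n; exact: (mulr_ge0 K0 (exp_coeff_ge0 n L0)).
    - by move=> n; exact: (cb q m x L mL qb).
    - exact/is_cvg_seriesZ/is_cvg_series_exp_coeff.
  have L1 : 0 <= L + 1 by rewrite addr_ge0.
  have dom n : `|(c q l x - c q l' x) n| <= (K * `|l - l'|) * ((L + 1) ^+ n / n`!%:R).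
    rewrite /c /= -mulrBl normrM.
    have := normr_subX_le n lL l'L => h1; have h2 := qb n.
    apply: (le_trans (ler_pM _ _ h1 h2)) => //.
    by rewrite le_eqVlt; apply/orP; left; apply/eqP; ring.
  have := series_dominated L1 dom 0%N.
  rewrite /series /= !big_geq// !subr0 -/(series _).
  have -> : limn (series (c q l x - c q l' x)) = S q l x - S q l' x.
    by rewrite lim_seriesB //; exact: cv.
  move=> h; apply: (le_trans h); rewrite mulrAC ler_wpM2r// ler_wpM2r ?expR_ge0// lerDl//.
by move=> l l' x lL l'L x01; split; apply: key => // n; [exact: fb|exact: pb].
Qed.

End linear_system.

(** * The Pruefer angle *)

Section pruefer.
Context {R : realType} (A B : R -> R).
Implicit Types (x y t e l k C L : R) (u v h g f p th : R -> R).
Hypothesis AB : clocks A B.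
Local Notation sdiff := (sdiff A B).
Local Notation solution := (solution A B).

Let zero01 : 0 <= (0 : R) <= 1. Proof. by rewrite lexx ler01. Qed.
Let one01 : 0 <= (1 : R) <= 1. Proof. by rewrite ler01 lexx. Qed.

(** The dA terms cancel, so only the difference of the two parameters drives the Wronskian. *)
Lemma wronskian l l' f p f' p' : solution l f p -> solution l' f' p' ->
  sdiff (fun x => f' x * p x - p' x * f x) (fun=> 0) (fun x => (l' - l) * (f x * f' x)).
Proof.
move=> [Hf Hp] [Hf' Hp'].
apply: (sdiff_ext (sdiffB (sdiffM AB Hf' Hp) (sdiffM AB Hp' Hf))) => x _ //; ring.
Qed.

Lemma wronskian_const l f p f' p' x : solution l f p -> solution l f' p' -> 0 <= x <= 1 ->
  f' x * p x - p' x * f x = f' 0 * p 0 - p' 0 * f 0.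
Proof.
move=> H H' x01; apply: (sdiff_const AB (wronskian H H')) => // t _.
by rewrite subrr mul0r.
Qed.

(** Two solutions S and S' with Wronskian 1 recover f and p at y by Cramer's rule from the
    Wronskians of f with S and S'; these are constant and vanish at x. This works on both sides of
    x. *)
Lemma solution_vanish l f p x y : solution l f p -> 0 <= x <= 1 -> 0 <= y <= 1 ->
  f x = 0 -> p x = 0 -> f y = 0 /\ p y = 0.
Proof.
move=> H x01 y01 fx px.
have [S [C [/(_ l) [HS S0 C0] _]]] := solution_family AB 0 1.
have [S' [C' [/(_ l) [HS' S'0 C'0] _]]] := solution_family AB 1 0.
have := wronskian_const HS' HS y01; rewrite S0 C0 S'0 C'0 => w.
have := wronskian_const H HS y01; rewrite -(wronskian_const H HS x01) fx px => w1.
have := wronskian_const H HS' y01; rewrite -(wronskian_const H HS' x01) fx px => w2.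
have e : S' l y * C l y - C' l y * S l y = 1 by lra.
split.
  rewrite -[f y]mulr1 -e (_ : _ * _ = S l y * (S' l y * p y - C' l y * f y) - S' l y * (S l y * p y - C l y * f y)); last by ring.
  by rewrite w1 w2 !mulr0 !subr0 !mulr0 subrr.
rewrite -[p y]mulr1 -e (_ : _ * _ = C l y * (S' l y * p y - C' l y * f y) - C' l y * (S l y * p y - C l y * f y)); last by ring.
by rewrite w1 w2 !mulr0 !subr0 !mulr0 subrr.
Qed.

Lemma solution_norm_gt0 l k f p x : solution l f p -> 0 < k -> (f 0 != 0) || (p 0 != 0) ->
  0 <= x <= 1 -> 0 < f x ^+ 2 + (p x / k) ^+ 2.
Proof.
move=> H k0 nz x01; rewrite lt_neqAle addr_ge0 ?sqr_ge0// andbT eq_sym.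
rewrite paddr_eq0 ?sqr_ge0// !sqrf_eq0 mulf_eq0 invr_eq0 (gt_eqF k0) orbF.
apply/negP => /andP[/eqP fx /eqP px].
have [f0 p0] := solution_vanish H x01 zero01 fx px.
by move: nz; rewrite f0 p0 eqxx.
Qed.

(* The angle of the vector (p / k, f), obtained by integrating the equation it
   satisfies; that it is the angle follows since, with [w = f cos th - q sin th],
   the quotient [w ^ 2 / (f ^ 2 + q ^ 2)] has differential zero. *)
Lemma pruefer_angle l k f p t0 : solution l f p -> 0 < k -> (f 0 != 0) || (p 0 != 0) ->
  f 0 * cos t0 = p 0 / k * sin t0 ->
  exists c th, [/\ (forall x, 0 <= x <= 1 -> 0 <= c x <= 1),
    sdiff th (fun x => k * c x) (fun x => l / k * (1 - c x)), th 0 = t0 &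
    forall x, 0 <= x <= 1 -> f x * cos (th x) = p x / k * sin (th x)].
Proof.
move=> H k0 nz h0; have r0 x := solution_norm_gt0 (x := x) H k0 nz.
case: (H) => Hf Hp.
pose q x := k^-1 * p x; pose r x := f x ^+ 2 + q x ^+ 2.
have qE x : q x = p x / k by rewrite mulrC.
have rp x : 0 <= x <= 1 -> 0 < r x by rewrite /r qE; exact: r0.
have Hq : sdiff q (fun=> 0) (fun x => - (l / k * f x)).
  by apply: (sdiff_ext (sdiff_scale k^-1 Hp)) => x _ //; ring.
(* The squared cosine is known before the angle is, so the equation for th has an explicit
   right-hand side and is solved by a primitive. *)
pose c x := q x ^+ 2 / r x.
have cq := sdiff_cont AB Hq; have cf := sdiff_cont AB Hf.
have rne x : 0 <= x <= 1 -> r x != 0 by move=> x01; rewrite gt_eqF// rp.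
have cc : cont c.
  by apply: contM; [exact: contX|apply: contV => //; apply: contD; exact: contX].
have c01 x : 0 <= x <= 1 -> 0 <= c x <= 1.
  move=> x01; rewrite divr_ge0 ?sqr_ge0 ?(ltW (rp _ x01))//= ler_pdivrMr ?rp//.
  by rewrite mul1r lerDr sqr_ge0.
have [th0 Hth0 th00] := clock_primitive AB (contM (@cont_cst _ k) cc) (contM (@cont_cst _ (l / k)) (contB (@cont_cst _ 1) cc)).
pose th x := th0 x + t0.
have Hth : sdiff th (fun x => k * c x) (fun x => l / k * (1 - c x)).
  by apply: (sdiff_ext (sdiffD Hth0 (sdiff_cst AB t0))) => x _ //; rewrite addr0.
exists c, th; split => //; first by rewrite /th th00 add0r.
have Hr := sdiffD (sdiff_sqr AB Hf) (sdiff_sqr AB Hq).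
have Hw := sdiffB (sdiffM AB Hf (sdiff_cos AB Hth)) (sdiffM AB Hq (sdiff_sin AB Hth)).
have HW := sdiffM AB (sdiff_sqr AB Hw) (sdiff_inv AB Hr rp).
move=> x x01.
have kne : k != 0 by rewrite gt_eqF.
have pE y : p y = k * q y by rewrite /q mulrA mulfV ?mul1r.
suff: (f x * cos (th x) - q x * sin (th x)) ^+ 2 / r x = 0.
  move=> /eqP; rewrite mulf_eq0 invr_eq0 (negbTE (rne x x01)) orbF sqrf_eq0 subr_eq0.
  by rewrite -qE => /eqP.
have := sdiff_const AB HW _ _ x01.
have w0 : f 0 * cos (th 0) - q 0 * sin (th 0) = 0 by rewrite /th th00 add0r qE h0 subrr.
rewrite w0 expr0n/= mul0r; apply => t t01.
- by have := rne t t01; rewrite pE /c /r => rt; field; rewrite ?rt ?kne.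
- by have := rne t t01; rewrite /c /r => rt; field; rewrite ?rt ?kne.
Qed.

(** By the intermediate value theorem |v| would otherwise reach pi / 2, where the cosine is zero. *)
Lemma angle_bound v x : cont v -> v 0 = 0 -> (forall t, 0 <= t <= 1 -> cos (v t) != 0) ->
  0 <= x <= 1 -> `|v x| < pi / 2.
Proof.
move=> cv v0 vne x01; rewrite ltNge; apply/negP => vx.
have cw : {within `[0, x], continuous (fun t => `|(v \o clamp) t|)}.
  apply: continuous_subspaceT => t.
  by apply: (@continuous_comp _ _ _ (v \o clamp) Num.norm); [exact: cv|exact: norm_continuous].
have /andP[x0 x1] := x01.
have [] := IVT x0 cw (v := pi / 2); rewrite /= ?clampE// ?v0 ?normr0.
  by rewrite min_l// max_r// vx divr_ge0// pi_ge0.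
move=> t; rewrite in_itv/= => /andP[t0 tx]; have t01 : 0 <= t <= 1 by rewrite t0 (le_trans tx).
by rewrite clampE// => vt; have := vne t t01; rewrite -cos_norm vt cos_pihalf eqxx.
Qed.

Lemma polar (a b th : R) : a * cos th = b * sin th ->
  let r := a * sin th + b * cos th in [/\ a = r * sin th, b = r * cos th & r ^+ 2 = a ^+ 2 + b ^+ 2].
Proof.
move=> h r; have e := cos2Dsin2 th.
have ha : a = r * sin th.
  rewrite (_ : r * _ = a * sin th ^+ 2 + (b * sin th) * cos th); last by rewrite /r; ring.
  rewrite -h (_ : _ + _ = a * (cos th ^+ 2 + sin th ^+ 2)); last by ring.
  by rewrite e mulr1.
have hb : b = r * cos th.
  rewrite (_ : r * _ = (a * cos th) * sin th + b * cos th ^+ 2); last by rewrite /r; ring.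
  rewrite h (_ : _ + _ = b * (cos th ^+ 2 + sin th ^+ 2)); last by ring.
  by rewrite e mulr1.
by split=> //; rewrite [X in _ = X ^+ 2 + _]ha [X in _ = _ + X ^+ 2]hb !exprMn -mulrDr addrC e mulr1.
Qed.

(** With r and r' the signed radii, f ^ 2 + p ^ 2 / (k k') = r r' cos (th' - th). The left side is
    positive, so the cosine never vanishes. *)
Lemma pruefer_compare l k k' f p th th' x : solution l f p -> 0 < k -> 0 < k' ->
  (f 0 != 0) || (p 0 != 0) -> cont th -> cont th' -> th 0 = th' 0 ->
  (forall t, 0 <= t <= 1 -> f t * cos (th t) = p t / k * sin (th t)) ->
  (forall t, 0 <= t <= 1 -> f t * cos (th' t) = p t / k' * sin (th' t)) ->
  0 <= x <= 1 -> `|th' x - th x| < pi / 2.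
Proof.
move=> H k0 k'0 nz cth cth' e0 h h'.
apply: (@angle_bound (fun x => th' x - th x)) => //; [exact: contB|by rewrite e0 subrr|move=> t t01].
have [] := polar (h t t01); set r := _ + _ => fr pr _.
have [] := polar (h' t t01); set r' := _ + _ => fr' pr' _.
have kk : 0 < f t ^+ 2 + (p t / Num.sqrt (k * k')) ^+ 2.
  by apply: (solution_norm_gt0 H) => //; rewrite sqrtr_gt0 mulr_gt0.
apply/eqP => c0; move: kk.
rewrite expr_div_n sqr_sqrtr ?mulr_ge0 ?ltW// invfM.
rewrite (_ : _ + _ = f t * f t + (p t / k) * (p t / k')); last by ring.
rewrite {1}fr fr' pr pr' (_ : _ + _ = r * r' * cos (th' t - th t)).
  by rewrite c0 mulr0 ltxx.
by rewrite cosB; ring.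
Qed.

(** Dirichlet data first, Neumann data second; t0 is the angle of (b, a). In both cases the boundary
    condition at either end reads f cos t0 - p sin t0 = 0. *)
Definition initial (a b t0 : R) := [/\ a = 0, b = 1 & t0 = 0] \/ [/\ a = 1, b = 0 & t0 = pi / 2].

Section total_angle.
Variables (a b t0 : R) (f p : R -> R -> R).
Hypothesis init : initial a b t0.
Hypothesis sol : forall l, [/\ solution l (f l) (p l), f l 0 = a & p l 0 = b].
Hypothesis lip : forall L, 0 <= L -> exists2 C, 0 < C & forall l l' x, `|l| <= L -> `|l'| <= L -> 0 <= x <= 1 ->
    `|f l x - f l' x| <= C * `|l - l'| /\ `|p l x - p l' x| <= C * `|l - l'|.
Hypothesis pos : forall l E, 0 < l -> sdiff E (fun=> 0) (fun x => f l x ^+ 2) -> E 0 < E 1.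

Let nz l : (f l 0 != 0) || (p l 0 != 0).
Proof.
by have [_ -> ->] := sol l; case: init => [[-> -> _]|[-> -> _]]; rewrite oner_eq0 ?orbT.
Qed.

Let start l k : f l 0 * cos t0 = p l 0 / k * sin t0.
Proof.
have [_ -> ->] := sol l; case: init => [[-> -> ->]|[-> -> ->]].
  by rewrite sin0 mulr0 mul0r.
by rewrite cos_pihalf mulr0 !mul0r.
Qed.

(** With r the product of the signed radii, r cos (th' - th) = p p' + f f' and r sin (th' - th) is
    the Wronskian. For l' near l the former stays close to f ^ 2 + p ^ 2, so the angles differ by
    less than pi / 2 and r > 0 at 1; there the latter is l' - l times an integral close to that of f
    ^ 2 dnu. *)
Lemma angle_local l th : 0 < l -> cont th -> th 0 = t0 ->
  (forall x, 0 <= x <= 1 -> f l x * cos (th x) = p l x * sin (th x)) ->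
  exists d K, [/\ 0 < d, 0 <= K & forall l' th', 0 < l' -> cont th' -> th' 0 = t0 ->
  (forall x, 0 <= x <= 1 -> f l' x * cos (th' x) = p l' x * sin (th' x)) ->
  `|l' - l| < d -> [/\ `|th' 1 - th 1| < pi / 2, `|sin (th' 1 - th 1)| <= K * `|l' - l|,
    l < l' -> 0 < sin (th' 1 - th 1) & l' < l -> sin (th' 1 - th 1) < 0]].
Proof.
move=> l0 cth th0 hth.
have [H f0 p0] := sol l; have [Hf Hp] := H.
have cf := sdiff_cont AB Hf; have cp := sdiff_cont AB Hp.
have [m m0 hm] : exists2 m, 0 < m & forall x, 0 <= x <= 1 -> m <= f l x ^+ 2 + p l x ^+ 2.
  apply: cont_pos; first by apply: contD; exact: contX.
  by move=> x x01; have := solution_norm_gt0 H ltr01 (nz l) x01; rewrite divr1.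
have [C1 C10 fC] := cont_bounded cf; have [C2 C20 pC] := cont_bounded cp.
have [C C0 hC] := lip (L := l + 1) ltac:(lra).
have [E0 HE0 E00] := clock_primitive AB (@cont_cst _ 0) (@contX _ _ 2 cf).
have E0p := pos l0 HE0; rewrite E00 in E0p.
set D := C * (C1 + C2).
have D0 : 0 < D by rewrite mulr_gt0// addr_gt0.
set mm := Order.min m (E0 1).
have mm0 : 0 < mm by rewrite lt_min m0.
(* The 1 keeps l' in the range where C is a Lipschitz constant; the other term gives r >= m / 2 and
   moves the integral by at most mm / 2. *)
exists (Order.min 1 (mm / (2 * D))), ((E0 1 + mm) / (m / 2)); split.
- by rewrite lt_min ltr01 divr_gt0// mulr_gt0.
- by rewrite divr_ge0 ?addr_ge0 ?divr_ge0 ?ltW.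
move=> l' th' l'0 cth' th'0 hth'; rewrite lt_min => /andP[ll1 lld].
have [H' f'0 p'0] := sol l'.
have lL : `|l| <= l + 1 by rewrite gtr0_norm//; lra.
have l'L : `|l'| <= l + 1 by move: ll1; rewrite ltr_norml gtr0_norm// => /andP[]; lra.
have DL : D * `|l' - l| < mm / 2.
  by move: lld; rewrite invfM mulrA ltr_pdivlMr// mulrC.
have mmm : mm <= m by rewrite ge_min lexx.
have mmE : mm <= E0 1 by rewrite ge_min lexx orbT.
have ff x : 0 <= x <= 1 -> `|f l x * (f l' x - f l x)| <= C1 * (C * `|l' - l|).
  by move=> x01; rewrite normrM; apply: ler_pM => //; [exact: fC|have [] := hC _ _ _ l'L lL x01].
have pp x : 0 <= x <= 1 -> `|p l x * (p l' x - p l x)| <= C2 * (C * `|l' - l|).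
  by move=> x01; rewrite normrM; apply: ler_pM => //; [exact: pC|have [] := hC _ _ _ l'L lL x01].
have DE : C1 * (C * `|l' - l|) + C2 * (C * `|l' - l|) = D * `|l' - l| by rewrite /D; ring.
have P1 : 0 <= C1 * (C * `|l' - l|) by rewrite !mulr_ge0// ltW.
have P2 : 0 <= C2 * (C * `|l' - l|) by rewrite !mulr_ge0// ltW.
have inner x : 0 <= x <= 1 -> m / 2 <= p l x * p l' x + f l x * f l' x.
  move=> x01; have := ff x x01; have := pp x x01; have := hm x x01.
  rewrite !ler_norml => ? /andP[? ?] /andP[? ?].
  rewrite (_ : _ + _ = (f l x ^+ 2 + p l x ^+ 2) + f l x * (f l' x - f l x) + p l x * (p l' x - p l x)); last by ring.
  by lra.
have pol x (x01 : 0 <= x <= 1) := polar (hth x x01).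
have pol' x (x01 : 0 <= x <= 1) := polar (hth' x x01).
have cE x : 0 <= x <= 1 ->
    exists r, [/\ r * cos (th' x - th x) = p l x * p l' x + f l x * f l' x &
                  r * sin (th' x - th x) = f l' x * p l x - p l' x * f l x].
  move=> x01; have [] := pol x x01; set r := _ + _ => fr pr _.
  have [] := pol' x x01; set r' := _ + _ => fr' pr' _.
  exists (r * r'); rewrite cosB sinB fr pr fr' pr'; split; ring.
have dlt : `|th' 1 - th 1| < pi / 2.
  apply: (@angle_bound (fun x => th' x - th x)) => //; first exact: contB.
    by rewrite th0 th'0 subrr.
  move=> t t01; have [r [hr _]] := cE t t01; apply/eqP => c0.
  by have := inner t t01; rewrite -hr c0 mulr0; lra.
have [r [rc rs]] := cE 1 one01.
have cp1 : 0 < cos (th' 1 - th 1) by apply: cos_gt0_pihalf; rewrite -ltr_norml.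
have rpos : m / 2 <= r.
  have := inner 1 one01; rewrite -rc => h; have c1 := cos_le1 (th' 1 - th 1).
  by have : r > 0; [rewrite -(pmulr_lgt0 _ cp1); lra|nra].
have [Hf' _] := H'; have cf' := sdiff_cont AB Hf'.
have [E HE E_0] := clock_primitive AB (@cont_cst _ 0) (contM cf cf').
have Ebnd : `|E 1 - E0 1| <= mm / 2 * 1.
  have := sdiff_norm_le AB (sdiffB HE HE0) (sdiff_scale (mm / 2) (sdiff_B AB)) _ _ _ one01.
  rewrite (clock12 AB); apply.
  - by move=> t _; rewrite subrr normr0 mulr0.
  - move=> t t01; rewrite mulr1 expr2 -mulrBr.
    by apply: (le_trans (ff t t01)); lra.
  - by rewrite E_0 E00 subrr normr0 (clock02 AB) mulr0.
have rsE : r * sin (th' 1 - th 1) = (l' - l) * E 1.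
  rewrite rs.
  rewrite (sdiff_eq AB (wronskian H H') (sdiff_scale (l' - l) HE) _ _ _ one01)//.
    by move=> t _; rewrite mulr0.
  by rewrite E_0 f0 p0 f'0 p'0 mulr0 [b * a]mulrC subrr.
move: Ebnd; rewrite mulr1 ler_norml => /andP[Eb1 Eb2].
have E1p : 0 < E 1 by lra.
have r0 : 0 < r by lra.
split=> //.
- have -> : sin (th' 1 - th 1) = (l' - l) * (E 1 / r).
    by rewrite mulrA -rsE mulrC mulKf// gt_eqF.
  rewrite normrM mulrC ler_wpM2r// ger0_norm; last by rewrite divr_ge0 ?ltW.
  apply: ler_pM; [exact: ltW|by rewrite invr_ge0 ltW|by lra|].
  by rewrite lef_pV2 ?posrE//; lra.
- by move=> ll'; rewrite -(pmulr_rgt0 _ r0) rsE mulr_gt0// subr_gt0.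
- by move=> ll'; rewrite -(pmulr_rlt0 _ r0) rsE nmulr_rlt0// subr_lt0.
Qed.

(** [angle_local] controls only the sine of a small difference, so T is studied locally in l and the
    result is then globalized. The last clause keeps the angle at scale 1 together with its
    companions at all other scales. *)
Lemma total_angle : exists T : R -> R, [/\
  forall l, 0 < l -> 0 <= T l,
  forall l l', 0 < l -> l < l' -> T l < T l',
  forall l, 0 < l -> {for l, continuous T},
  forall l, 0 < l -> (f l 1 * cos t0 - p l 1 * sin t0 = 0 <-> sin (T l) = 0) &
  forall l, 0 < l -> exists th, T l = th 1 - th 0 /\
    forall k, 0 < k -> exists c thk, [/\ (forall x, 0 <= x <= 1 -> 0 <= c x <= 1),
      sdiff thk (fun x => k * c x) (fun x => l / k * (1 - c x)) &
      forall x, 0 <= x <= 1 -> `|thk x - th x| < pi / 2]].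
Proof.
have /choice [th Hth] : forall l, exists th, 0 < l -> exists c,
    [/\ (forall x, 0 <= x <= 1 -> 0 <= c x <= 1),
    sdiff th (fun x => 1 * c x) (fun x => l / 1 * (1 - c x)), th 0 = t0 &
    forall x, 0 <= x <= 1 -> f l x * cos (th x) = p l x / 1 * sin (th x)].
  move=> l; have [H _ _] := sol l.
  by have [c [th h]] := pruefer_angle H ltr01 (nz l) (start l 1); exists th => _; exists c.
have cth l : 0 < l -> cont (th l).
  by move=> l0; have [c [_ H _ _]] := Hth l l0; exact: sdiff_cont H.
have th0 l : 0 < l -> th l 0 = t0 by move=> l0; have [c []] := Hth l l0.
have hth l : 0 < l -> forall x, 0 <= x <= 1 -> f l x * cos (th l x) = p l x * sin (th l x).
  by move=> l0 x x01; have [c [_ _ _ /(_ x x01)]] := Hth l l0; rewrite divr1.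
pose T l := th l 1 - t0.
have TB l l' : T l' - T l = th l' 1 - th l 1 by rewrite /T; ring.
have loc l : 0 < l -> exists d K, [/\ 0 < d, 0 <= K & forall l', 0 < l' ->
    `|l' - l| < d -> [/\ `|T l' - T l| < pi / 2, `|sin (T l' - T l)| <= K * `|l' - l|,
    l < l' -> 0 < T l' - T l & l' < l -> T l' - T l < 0]].
  move=> l0; have [d [K [d0 K0 h]]] := angle_local l0 (cth l l0) (th0 l l0) (hth l l0).
  exists d, K; split=> // l' l'0 ll'.
  have [h1 h2 h3 h4] := h l' (th l') l'0 (cth l' l'0) (th0 l' l'0) (hth l' l'0) ll'.
  rewrite TB; have pp : (pi : R) / 2 <= pi by have := @pi_gt0 R; lra.
  (* A difference of modulus below pi / 2 has the sign of its sine. *)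
  split=> // hl; rewrite ltNge; apply/negP => hs.
    have := h3 hl; rewrite ltNge => /negP; apply; rewrite -oppr_ge0 -sinN.
    apply: sin_ge0_pi; rewrite oppr_ge0 hs/=.
    by move: h1; rewrite ltr_norml => /andP[]; lra.
  have := h4 hl; rewrite ltNge => /negP; apply.
  by apply: sin_ge0_pi; rewrite hs/=; move: h1; rewrite ltr_norml => /andP[]; lra.
have Tcont l : 0 < l -> {for l, continuous T}.
  move=> l0; have [d [K [d0 K0 h]]] := loc l l0.
  apply/cvgrPdist_lt => e e0.
  (* The difference of the angles is the arcsine of its sine, which is small with l' - l. *)
  have := @continuous_asin R 0 ltac:(by rewrite ltrN10 ltr01).
  move=> /cvgrPdist_lt/(_ e e0) [d' /= d'0 hd'].
  have asin0 : asin (0 : R) = 0 by rewrite -[in LHS]sin0 sinK// in_itv/= oppr_le0 divr_ge0 ?pi_ge0.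
  have K1 : 0 < K + 1 by lra.
  exists (Order.min l (Order.min d (d' / (K + 1)))) => /=; first by rewrite !lt_min l0 d0 divr_gt0.
  move=> l'; rewrite /ball_/= !lt_min => /and3P[a1 a2 a3].
  have l'0 : 0 < l' by move: a1; rewrite ltr_norml => /andP[]; lra.
  have [h1 h2 _ _] := h l' l'0 ltac:(by rewrite distrC).
  rewrite distrC -(@sinK _ (T l' - T l)); last first.
    by move: h1; rewrite in_itv/= ltr_norml => /andP[? ?]; rewrite !ltW.
  have := hd' (sin (T l' - T l)); rewrite /ball_/= asin0 !sub0r !normrN; apply.
  apply: (le_lt_trans h2); apply: (@le_lt_trans _ _ ((K + 1) * `|l' - l|)).
    by apply: ler_wpM2r => //; lra.
  by rewrite mulrC -ltr_pdivlMr// distrC.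
exists T; split=> //.
- move=> l l0; have [c [c01 H th00 _]] := Hth l l0.
  rewrite /T subr_ge0 -th00; apply: (sdiff_le AB H) => // t t01; have /andP[? ?] := c01 t t01.
    by rewrite mul1r.
  by rewrite divr1; apply: mulr_ge0; [exact: ltW|rewrite subr_ge0].
- move=> l l' l0 ll'; rewrite ltNge; apply/negP => TT.
  have cT : {within `[l, l'], continuous T}.
    apply: continuous_in_subspaceT => x; rewrite inE/= in_itv/= => /andP[lx _].
    by apply: Tcont; exact: lt_le_trans lx.
  (* If T l' <= T l, the minimum over [l, l'] is attained at a point other than l, since a minimum
     at l is also one at l'. Just to the left of that point T is smaller still. *)
  have [c + hc] := EVT_min (ltW ll') cT.
  rewrite in_itv/= => /andP[lc cl'].
  have nomin x : l < x -> x <= l' -> (forall t, t \in `[l, l'] -> T x <= T t) -> False.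
    move=> lx xl' hx; have x0 := lt_trans l0 lx.
    have [d [K [d0 _ h]]] := loc x x0.
    pose y := Order.max l (x - d / 2).
    have yx : y < x by rewrite gt_max lx/=; lra.
    have ly : l <= y by rewrite le_max lexx.
    have xy : x - d / 2 <= y by rewrite le_max lexx orbT.
    have [] := h y (lt_le_trans l0 ly) _.
      by rewrite ltr0_norm ?subr_lt0//; lra.
    move=> _ _ _ /(_ yx); have := hx y; rewrite in_itv/= ly (le_trans (ltW yx) xl') => /(_ isT).
    by lra.
  move: lc; rewrite le_eqVlt => /predU1P[lc|lc]; last exact: (nomin c).
  apply: (nomin l') => // t tl; apply: (le_trans TT); rewrite lc; exact: hc.
- move=> l l0; have := hth l l0 1 one01 => /polar [].
  set r := _ + _ => fr pr r2.
  have rn : r != 0.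
    rewrite -sqrf_eq0 r2 gt_eqF//; have [H _ _] := sol l.
    by have := solution_norm_gt0 H ltr01 (nz l) one01; rewrite divr1.
  rewrite fr pr (_ : _ - _ = r * sin (T l)); last by rewrite /T sinB; ring.
  split=> [/eqP|->]; last by rewrite mulr0.
  by rewrite mulf_eq0 (negbTE rn) => /eqP.
- move=> l l0; exists (th l); split; first by rewrite /T th0.
  move=> k k0; have [H _ _] := sol l.
  have [c [thk [c01 Hk thk0 hk]]] := pruefer_angle H k0 (nz l) (start l k).
  exists c, thk; split => // x x01.
  apply: (pruefer_compare H ltr01 k0 (nz l) (cth l l0) (sdiff_cont AB Hk)) => //.
    by rewrite thk0 th0.
  by move=> t t01; rewrite divr1; exact: hth.
Qed.

End total_angle.

End pruefer.

(** * Boundary conditions *)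

Section boundary_problem.
Context {R : realType} (A B : R -> R).
Implicit Types (x y t e l k C L : R) (u v h g f p th E : R -> R).
Hypothesis AB : clocks A B.
Local Notation sdiff := (sdiff A B).
Local Notation solution := (solution A B).

Let zero01 : 0 <= (0 : R) <= 1. Proof. by rewrite lexx ler01. Qed.
Let one01 : 0 <= (1 : R) <= 1. Proof. by rewrite ler01 lexx. Qed.

(** If the integral of f ^ 2 dnu vanished, so would dp = - l f dB; then p is the constant b and f =
    a + b A. That is 1 for Neumann and A for Dirichlet data, neither of which is zero in L^2(nu). *)
Lemma solution_l2_gt0 l a b t0 f p E : initial a b t0 -> 0 < l ->
  (forall E', sdiff E' (fun=> 0) (fun x => A x ^+ 2) -> E' 0 < E' 1) ->
  solution l f p -> f 0 = a -> p 0 = b ->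
  sdiff E (fun=> 0) (fun x => f x ^+ 2) -> E 0 < E 1.
Proof.
move=> init l0 posA [Hf Hp] f0 p0 HE; rewrite ltNge; apply/negP => E10.
have Emono x y : 0 <= x -> x <= y -> y <= 1 -> E x <= E y.
  by apply: (sdiff_le AB HE) => // t _; exact: sqr_ge0.
have Econst x : 0 <= x <= 1 -> E x = E 0.
  move=> /andP[x0 x1]; apply/eqP; rewrite eq_le (Emono 0 x)// andbT.
  by apply: (le_trans _ E10); exact: Emono.
have pconst x : 0 <= x <= 1 -> p x = b.
  move=> x01; apply/eqP; rewrite -subr_eq0 -normr_le0; apply/ler_addgt0Pr => e e0; rewrite add0r.
  (* In |f| <= c + f ^ 2 / (4 c) the second term integrates to 0 and the first to at most c, so l c
     = e is wanted. *)
  pose c := e / l; have c0 : 0 < c by rewrite divr_gt0.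
  have : `|p x - b| <= l * (c * B x + (4 * c)^-1 * (E x - E 0)).
    apply: (sdiff_norm_le AB (sdiffB Hp (sdiff_cst AB b)) (sdiff_scale l
      (sdiffD (sdiff_scale c (sdiff_B AB)) (sdiff_scale (4 * c)^-1 (sdiffB HE (sdiff_cst AB (E 0)))))) _ _ _ x01).
    - by move=> t _; rewrite subrr normr0 !mulr0 addr0 mulr0.
    - move=> t _; rewrite !subr0 mulr1 normrN normrM (gtr0_norm l0) ler_pM2l//.
      rewrite -[f t ^+ 2]real_normK ?num_real// -subr_ge0.
      rewrite (_ : _ - _ = (4 * c)^-1 * (`|f t| - 2 * c) ^+ 2); last by field; rewrite gt_eqF.
      by rewrite mulr_ge0 ?sqr_ge0// invr_ge0 mulr_ge0// ltW.
    - by rewrite p0 !subrr normr0 (clock02 AB) !mulr0 addr0 mulr0.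
  rewrite Econst// subrr mulr0 addr0 mulrA /c mulrCA mulfV ?gt_eqF// mulr1 => /le_trans; apply.
  have /andP[x0 x1] := x01; rewrite ler_piMr ?(ltW e0)//.
  by have := clock_mono2 AB x0 x1 (lexx 1); rewrite (clock12 AB).
have fE x : 0 <= x <= 1 -> f x = a + b * A x.
  move=> x01; apply: (sdiff_eq AB Hf (sdiffD (sdiff_cst AB a) (sdiff_scale b (sdiff_A AB)))) => //.
  - by move=> t t01; rewrite add0r mulr1 pconst.
  - by move=> t t01; rewrite mulr0 addr0.
  - by rewrite (clock01 AB) mulr0 addr0.
case: init => [[a0 b1 _]|[a1 b0 _]].
  have : sdiff E (fun=> 0) (fun x => A x ^+ 2).
    by apply: (sdiff_ext HE) => // x x01; rewrite fE// a0 b1 add0r mul1r.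
  by move=> /posA; rewrite ltNge E10.
have : E 1 = B 1 + E 0.
  apply: (sdiff_eq AB HE (sdiffD (sdiff_B AB) (sdiff_cst AB (E 0)))) => //.
  - by move=> t _; rewrite addr0.
  - by move=> t t01; rewrite fE// a1 b0 mul0r !addr0 expr1n.
  - by rewrite (clock02 AB) add0r.
by rewrite (clock12 AB); lra.
Qed.

(** The eigenfunction f' and the normalized f share the condition at 0, so their Wronskian vanishes
    there and hence at 1. As (f', p') is not zero at 1, f inherits its condition. *)
Lemma boundary_match l a b t0 f p f' p' : initial a b t0 ->
  solution l f p -> f 0 = a -> p 0 = b -> solution l f' p' ->
  f' 0 * cos t0 - p' 0 * sin t0 = 0 -> f' 1 * cos t0 - p' 1 * sin t0 = 0 ->
  (exists2 x, 0 <= x <= 1 & f' x != 0) -> f 1 * cos t0 - p 1 * sin t0 = 0.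
Proof.
move=> init H f0 p0 H' b0 b1 [x x01 fx].
have := wronskian_const AB H H' one01; rewrite f0 p0.
have nv : f' 1 = 0 -> p' 1 = 0 -> False.
  by move=> f'1 p'1; have [f'x _] := solution_vanish AB H' one01 x01 f'1 p'1; rewrite f'x eqxx in fx.
case: init b0 b1 => [[-> -> ->]|[-> -> ->]].
  rewrite cos0 sin0 !mulr1 !mulr0 !subr0 => -> f'1; rewrite f'1 mul0r sub0r => /eqP.
  by rewrite oppr_eq0 mulf_eq0 => /orP[/eqP/(nv f'1)//|/eqP].
rewrite cos_pihalf sin_pihalf !mulr1 !mulr0 !sub0r => /eqP; rewrite oppr_eq0 => /eqP p'0 /eqP.
rewrite oppr_eq0 => /eqP p'1; rewrite p'0 p'1 mul0r oppr0 addr0 => /eqP.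
by rewrite mulf_eq0 => /orP[/eqP f'1|/eqP ->]; [have := nv f'1 p'1|rewrite oppr0].
Qed.

(** Integration by parts: f p increases by the integral of p ^ 2 dA minus l times that of f ^ 2 dB,
    and it is zero at both ends. *)
Lemma boundary_nonneg l a b t0 f p E : initial a b t0 -> l < 0 -> solution l f p ->
  f 0 * cos t0 - p 0 * sin t0 = 0 -> f 1 * cos t0 - p 1 * sin t0 = 0 ->
  sdiff E (fun=> 0) (fun x => f x ^+ 2) -> E 1 <= E 0.
Proof.
move=> init l0 [Hf Hp] b0 b1 HE.
have : f 0 * p 0 - - l * E 0 <= f 1 * p 1 - - l * E 1.
  apply: (sdiff_le AB (sdiffB (sdiffM AB Hf Hp) (sdiff_scale (- l) HE)) _ _ (lexx 0) ler01 (lexx 1)).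
  - by move=> t _; rewrite !mulr0 add0r subr0 -expr2 sqr_ge0.
  - by move=> t _; rewrite mulr0 addr0 le_eqVlt; apply/orP; left; apply/eqP; ring.
have fp0 : f 0 * p 0 = 0.
  case: init b0 => [[_ _ ->]|[_ _ ->]].
    by rewrite cos0 sin0 mulr1 mulr0 subr0 => ->; rewrite mul0r.
  by rewrite cos_pihalf sin_pihalf mulr1 mulr0 sub0r => /eqP; rewrite oppr_eq0 => /eqP ->; rewrite mulr0.
have fp1 : f 1 * p 1 = 0.
  case: init b1 => [[_ _ ->]|[_ _ ->]].
    by rewrite cos0 sin0 mulr1 mulr0 subr0 => ->; rewrite mul0r.
  by rewrite cos_pihalf sin_pihalf mulr1 mulr0 sub0r => /eqP; rewrite oppr_eq0 => /eqP ->; rewrite mulr0.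
rewrite fp0 fp1 !sub0r lerN2 ler_pM2l// oppr_gt0//.
Qed.

End boundary_problem.

(** * Integration against finite atomless measures *)

Section null_sets.
Context {R : realType}.
Implicit Types (m : {measure set (measurableTypeR R) -> \bar R}).

(* Rational intervals form a countable base, so the null ones among them
   cover the complement of the support by a null set. *)
Lemma measure_off_supp m (U : set R) : open U -> (forall x, U x -> ~ supp m x) -> m U = 0%E.
Proof.
move=> oU US.
pose F k : set (measurableTypeR R) := if unpickle k is Some (q, r)
  then if m `](ratr q : R), (ratr r : R)[%classic == 0%E then `](ratr q : R), (ratr r : R)[%classic else set0 else set0.
have F0 k : m.-negligible (F k).
  rewrite /F; case: unpickle => [[q r]|]; last exact: negligible_set0.
  case: eqP => [h|_]; last exact: negligible_set0.
  by apply/negligibleP => //; exact: measurable_itv.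
apply: measure_negligible; first exact: open_measurable.
apply: negligibleS (negligible_bigcup F0) => x Ux.
have [V [oV Vx mV0]] : exists V : set R, [/\ open V, V x & m V = 0%E].
  have /existsNP [V /not_implyP [oV /not_implyP [Vx /negP]]] := US x Ux.
  by rewrite -leNgt measure_le0 => /eqP mV; exists V.
have /nbhs_ballP [e /= e0 hV] := open_nbhs_nbhs (conj oV Vx).
have [q] := @rat_in_itvoo R (x - e) x ltac:(lra).
have [r] := @rat_in_itvoo R x (x + e) ltac:(lra).
rewrite !in_itv/= => /andP[xr re] /andP[eq qx].
exists (pickle (q, r)); [exact: I|rewrite /F pickleK].
have -> : m `](ratr q : R), (ratr r : R)[%classic = 0%E; last first.
  by rewrite eqxx /= in_itv/= qx xr.
apply/eqP; rewrite -measure_le0 -mV0; apply: le_measure; rewrite ?inE.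
- exact: measurable_itv.
- exact: open_measurable.
- move=> z /=; rewrite in_itv/= => /andP[qz zr]; apply: hV.
  by rewrite /ball/= ltr_norml; apply/andP; split; lra.
Qed.

End null_sets.

Section measure_clock.
Context {R : realType}.
Implicit Types (m : {finite_measure set (measurableTypeR R) -> \bar R}) (x y e : R) (h : R -> R).

Lemma Rintegral_itv_cat m h (a : itv_bound R) x y :
  m.-integrable [set` Interval a (BRight y)] (EFin \o h) ->
  (a <= BRight x)%O -> x <= y ->
  \int[m]_(t in [set` Interval a (BRight y)]) h t =
  \int[m]_(t in [set` Interval a (BRight x)]) h t + \int[m]_(t in `]x, y]) h t.
Proof.
move=> hi ax xy; have xy' : (BRight x <= BRight y)%O by rewrite bnd_simp.
have E := itv_bndbnd_setU ax xy'.
rewrite E Rintegral_setU//; [by rewrite -E|].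
apply/disj_setPS => z [/=]; rewrite !itv_boundlr => /andP[_ zx] /andP[xz _].
by move: xz zx; rewrite !bnd_simp => xz /(lt_le_trans xz); rewrite ltxx.
Qed.

Lemma distr_funB m x y : x <= y -> distr_fun m y - distr_fun m x = fine (m `]x, y]%classic).
Proof.
move=> xy; rewrite /distr_fun.
have E : `]-oo, y]%classic = `]-oo, x]%classic `|` `]x, y]%classic :> set R.
  by apply: itv_bndbnd_setU; rewrite ?bnd_simp.
rewrite E measureU//; first by rewrite fineD ?fin_num_measure// addrC addKr.
by apply/seteqP; split=> // z [] /=; rewrite !in_itv/= => zx /andP[xz _]; move: (lt_le_trans xz zx); rewrite ltxx.
Qed.

Lemma distr_fun_le m x y : x <= y -> distr_fun m x <= distr_fun m y.
Proof. by move=> xy; rewrite -subr_ge0 distr_funB// fine_ge0. Qed.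

Lemma distr_fun_continuous m : atomless m -> continuous (distr_fun m).
Proof.
move=> atom x; apply/cvgrPdist_lt => e e0.
pose F n : set (measurableTypeR R) := `]x - n.+1%:R^-1, x + n.+1%:R^-1]%classic.
have FE : \bigcap_n F n = [set x].
  apply/seteqP; split => [z Fz|_ -> n _] /=; last first.
    by rewrite /F /= in_itv/= gtrBl lerDl invr_gt0 invr_ge0 ltr0n ler0n.
  apply/eqP; rewrite -subr_eq0 -normr_le0 leNgt; apply/negP => zx.
  have := archi_boundP (x := `|z - x|^-1) ltac:(by rewrite invr_ge0).
  set n := Num.bound _ => hn.
  have nz : n.+1%:R^-1 < `|z - x|.
    by rewrite -[X in _ < X]invrK ltf_pV2 ?posrE ?invr_gt0//; apply: (lt_trans hn); rewrite ltr_nat.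
  have := Fz n I; rewrite /F/= in_itv/= => /andP[h1 h2]; move: nz; rewrite ltNge => /negP; apply.
  by move: h1 h2; set d := _^-1 => h1 h2; rewrite ler_norml; apply/andP; split; lra.
have : m \o F @ \oo --> m (\bigcap_n F n).
  apply: nonincreasing_cvg_mu.
  - by rewrite ltey_eq fin_num_measure//; exact: measurable_itv.
  - by move=> n; exact: measurable_itv.
  - by rewrite FE; exact: measurable_set1.
  - move=> n n' nn'; apply/subsetPset => z; rewrite /F/= !in_itv/= => /andP[h1 h2].
    have : (n'.+1%:R^-1 : R) <= n.+1%:R^-1 by rewrite lef_pV2 ?posrE// ler_nat.
    by move: h1 h2; set d := _^-1; set d' := _^-1 => h1 h2 ?; apply/andP; split; lra.
rewrite FE atom => /fine_cvgP[_ /cvgrPdist_lt/(_ e e0)[n _ /(_ n (leqnn n))]].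
rewrite /= sub0r normrN => mFn; pose d : R := n.+1%:R^-1.
have d0 : 0 < d by rewrite invr_gt0.
have key a b : x - d <= a -> a <= b -> b <= x + d -> `|distr_fun m b - distr_fun m a| < e.
  move=> xa ab bx; apply: le_lt_trans mFn.
  rewrite distr_funB// !ger0_norm ?fine_ge0//.
  apply: fine_le; rewrite ?fin_num_measure//; try exact: measurable_itv.
  apply: le_measure; rewrite ?inE; try exact: measurable_itv.
  move=> z; rewrite /F /= !in_itv/= -/d => /andP[az zb].
  by rewrite (le_lt_trans xa az) (le_trans zb bx).
exists d => // t; rewrite /ball_/= ltr_norml => /andP[h1 h2].
case: (leP t x) => [tx|/ltW xt]; first by apply: key; lra.
by rewrite distrC; apply: key; lra.
Qed.

Lemma cont_measurable h : cont h -> measurable_fun (`[0, 1]%classic : set (measurableTypeR R)) h.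
Proof.
move=> /cont_within ch; apply: subspace_continuous_measurable_fun => //.
Qed.

Lemma cont_integrable m h (D : set (measurableTypeR R)) : cont h -> measurable D ->
  D `<=` `[0, 1]%classic -> m.-integrable D (EFin \o h).
Proof.
move=> ch mD D01; apply: (integrableS _ mD D01); first exact: measurable_itv.
apply: measurable_bounded_integrable; first exact: measurable_itv.
- by rewrite ltey_eq fin_num_measure//; exact: measurable_itv.
- exact: cont_measurable.
- have [C C0 hC] := cont_bounded ch.
  exists C; split; first exact: num_real.
  move=> C' CC' x /=; rewrite in_itv/= => x01.
  by apply: le_trans (ltW CC'); exact: hC.
Qed.

(** The interval is closed, so vanishing at 0 rests on atomlessness. *)
Definition primitive m h x := \int[m]_(t in `[0, x]) h t.

Lemma primitiveB m h x y : cont h -> 0 <= x -> x <= y -> y <= 1 ->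
  primitive m h y - primitive m h x = \int[m]_(t in `]x, y]) h t.
Proof.
move=> ch x0 xy y1; rewrite /primitive (@Rintegral_itv_cat m h (BLeft 0) x y)//.
- by rewrite [X in X - _]addrC addrK.
- apply: cont_integrable => //.
  by move=> z /=; rewrite !in_itv/= => /andP[-> zy]; exact: le_trans y1.
Qed.

Lemma primitive_diff m h e : cont h -> 0 < e -> exists2 d, 0 < d & forall x y,
  0 <= x -> x <= y -> y <= 1 -> y - x < d ->
  `|primitive m h y - primitive m h x - h x * (distr_fun m y - distr_fun m x)|
    <= e * (distr_fun m y - distr_fun m x).
Proof.
move=> ch e0; have [d d0 hd] := cont_unif ch e0; exists d => // x y x0 xy y1 xyd.
have D01 : `]x, y]%classic `<=` (`[0, 1]%classic : set R).
  move=> z /=; rewrite !in_itv/= => /andP[xz zy].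
  by rewrite (le_trans zy y1) andbT (le_trans x0) ?ltW.
have mD : measurable (`]x, y]%classic : set (measurableTypeR R)) by exact: measurable_itv.
have ih g : cont g -> m.-integrable (`]x, y]%classic : set (measurableTypeR R)) (EFin \o g).
  by move=> cg; exact: cont_integrable.
rewrite primitiveB// distr_funB// -!Rintegral_cst// -RintegralB//; last 2 first.
- exact: ih.
- exact/ih/cont_cst.
apply: le_trans (le_normr_Rintegral mD _) _.
  by apply: ih; exact/contB/cont_cst.
apply: le_Rintegral => //.
- exact: (integrable_norm (ih _ (contB ch (@cont_cst _ (h x))))).
- exact/ih/cont_cst.
- move=> z /[dup] /D01/=; rewrite !in_itv/= => z01 /andP[xz zy].
  apply: hd => //; first by rewrite x0 (le_trans xy).
  by rewrite gtr0_norm ?subr_gt0//; lra.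
Qed.

Lemma primitive_at0 m h : atomless m -> primitive m h 0 = 0.
Proof.
move=> am; rewrite /primitive (_ : `[0, 0]%classic = [set 0]); last by rewrite set_itv1.
rewrite /Rintegral (_ : integral _ _ _ = 0%E)//.
by apply: null_set_integral; [exact: measurable_set1| |exact: am]; exact: measurable_fun_set1.
Qed.

End measure_clock.

(** * The weak Laplacian as a linear system *)

Lemma ae_imply {R : realType} (m : {measure set (measurableTypeR R) -> \bar R}) (P Q : R -> Prop) :
  (forall x, P x -> Q x) -> {ae m, forall x, P x} -> {ae m, forall x, Q x}.
Proof. by move=> PQ; exact: (@filterS _ _ (ae_filter_ringOfSetsType m) P Q PQ). Qed.

Lemma bounded_Lfun2 {R : realType} (m : {finite_measure set (measurableTypeR R) -> \bar R})
  (g : R -> R) (C : R) : measurable_fun [set: measurableTypeR R] g -> (forall y, `|g y| <= C) ->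
  g \in Lfun m 2%:E.
Proof.
move=> mg gC; rewrite inE; apply/andP; split; rewrite inE//=.
rewrite /finite_norm unlock /=; apply: poweR_lty.
have C0 : 0 <= C by exact: le_trans (gC 0).
have : m.-integrable setT (EFin \o (fun y => g y ^+ 2)).
  apply: measurable_bounded_integrable => //.
  - by rewrite ltey_eq fin_num_measure.
  - exact: measurable_funX.
  - exists (C ^+ 2); split; [exact: num_real|move=> C' CC' x _ /=].
    by apply: le_trans (ltW CC'); rewrite normrX ler_pXn2r ?nnegrE.
move=> /integrableP[_]; congr (_ < _)%E.
by apply: eq_integral => x _ /=; rewrite powR_mulrn// normrX.
Qed.

Section krein_feller.
Context {R : realType} (mu nu : probability (measurableTypeR R) R).
Implicit Types (x y e l a b : R) (f g h p : R -> R).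
Hypotheses (mu_atomless : atomless mu) (nu_atomless : atomless nu).
Hypothesis mu_out : mu (~` `[0, 1]%classic) = 0%E.
Hypothesis nu_out : nu (~` `[0, 1]%classic) = 0%E.

Let distr_fun01 (m : probability (measurableTypeR R) R) : atomless m ->
  m (~` `[0, 1]%classic) = 0%E -> distr_fun m 0 = 0 /\ distr_fun m 1 = 1.
Proof.
move=> am m0; have m01 : measurable (`[0, 1]%classic : set (measurableTypeR R)) by exact: measurable_itv.
have null (D : set (measurableTypeR R)) : measurable D -> D `<=` ~` `[0, 1]%classic -> m D = 0%E.
  move=> mD D01; apply/eqP; rewrite -measure_le0 -m0; apply: le_measure; rewrite ?inE//.
  exact: measurableC.
have z0 : m `]-oo, 0]%classic = 0%E.
  rewrite (_ : `]-oo, 0]%classic = `]-oo, 0[%classic `|` [set 0] :> set R); last by rewrite setUitv1.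
  rewrite measureU//; last first.
    by apply/seteqP; split => // z [] /=; rewrite in_itv/= => z0 zE; rewrite zE ltxx in z0.
  rewrite [X in (_ + X)%E](am 0) adde0; apply: null; first exact: measurable_itv.
  by move=> z /=; rewrite !in_itv/= => z0; rewrite leNgt z0.
split; first exact: (congr1 fine z0).
have z1 : m `]1, +oo[%classic = 0%E.
  apply: null; first exact: measurable_itv.
  by move=> z /=; rewrite !in_itv/= andbT => z1 /andP[_]; rewrite leNgt z1.
have o1 : m `]-oo, 1]%classic = 1%E.
  by rewrite -setCitvr probability_setC; [rewrite z1 sube0|exact: measurable_itv].
exact: (congr1 fine o1).
Qed.

(** Splitting the kernel expresses the formula of the weak domain by primitives, to which the
    product rule applies. *)
Lemma primitive_linear f h x (m : {finite_measure set (measurableTypeR R) -> \bar R}) : x \in `[0, 1] ->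
  cont f -> cont h ->
  \int[m]_(y in `[0, x]) ((f x - f y) * h y) = f x * primitive m h x - primitive m (fun y => f y * h y) x.
Proof.
rewrite in_itv/= => /andP[x0 x1] cf ch.
have mx : measurable (`[0, x]%classic : set (measurableTypeR R)) by exact: measurable_itv.
have sx : `[0, x]%classic `<=` (`[0, 1]%classic : set R).
  by move=> z /=; rewrite !in_itv/= => /andP[-> zx]; exact: le_trans x1.
rewrite /primitive -RintegralZl//; last exact: cont_integrable.
rewrite -RintegralB//.
- by apply: eq_Rintegral => y _; rewrite mulrBl.
- by apply: (@cont_integrable _ m (fun y => f x * h y)) => //; exact/contM/ch/cont_cst.
- by apply: (@cont_integrable _ m (fun y => f y * h y)) => //; exact: contM.
Qed.

Local Notation A := (distr_fun mu).
Local Notation B := (distr_fun nu).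

Let A_le x y : x <= y -> A x <= A y. Proof. exact: distr_fun_le. Qed.
Let B_le x y : x <= y -> B x <= B y. Proof. exact: distr_fun_le. Qed.

Lemma sdiff_primitive1 h : cont h -> sdiff A B (primitive mu h) h (fun=> 0).
Proof.
move=> ch; split=> //; first exact: cont_cst.
move=> e e0; have [d d0 hd] := primitive_diff mu ch e0; exists d => // x y x0 xy y1 xyd.
rewrite mul0r subr0; apply: (le_trans (hd x y x0 xy y1 xyd)).
by rewrite ler_pM2l//; have := B_le xy; lra.
Qed.

Lemma sdiff_primitive2 h : cont h -> sdiff A B (primitive nu h) (fun=> 0) h.
Proof.
move=> ch; split=> //; first exact: cont_cst.
move=> e e0; have [d d0 hd] := primitive_diff nu ch e0; exists d => // x y x0 xy y1 xyd.
rewrite mul0r subr0; apply: (le_trans (hd x y x0 xy y1 xyd)).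
by rewrite ler_pM2l//; have := A_le xy; lra.
Qed.

Lemma krein_feller_clocks : clocks A B.
Proof.
have [A0 A1] := distr_fun01 mu_atomless mu_out; have [B0 B1] := distr_fun01 nu_atomless nu_out.
split=> //.
- by move=> x y _ xy _; exact: A_le.
- by move=> x y _ xy _; exact: B_le.
- exact/continuous_cont/distr_fun_continuous.
- exact/continuous_cont/distr_fun_continuous.
move=> h1 h2 ch1 ch2; exists (fun x => primitive mu h1 x + primitive nu h2 x).
  by apply: (sdiff_ext (sdiffD (sdiff_primitive1 ch1) (sdiff_primitive2 ch2))) => x _;
    rewrite ?addr0 ?add0r.
by rewrite !primitive_at0 ?addr0.
Qed.

Let AB := krein_feller_clocks.
Local Notation solution := (solution A B).

Let m01 : measurable (`[0, 1]%classic : set (measurableTypeR R)).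
Proof. exact: measurable_itv. Qed.

(** With H the nu-primitive of h, the differential of A H minus the primitive of A h is H dA,
    because the dB terms cancel. Both sides thus have differential p dA and value f 0 at 0. *)
Lemma solution_formula l f p x : solution l f p -> x \in `[0, 1] ->
  f x = f 0 + p 0 * A x + \int[nu]_(y in `[0, x]) ((A x - A y) * - (l * f y)) /\
  p x = p 0 + primitive nu (fun y => - (l * f y)) x.
Proof.
move=> [Hf Hp] x01; set h := fun y => - (l * f y).
have ch : cont h by case: Hp.
have cA := clock_cont1 AB.
have x01' : 0 <= x <= 1 by move: x01; rewrite in_itv.
have pE t : 0 <= t <= 1 -> p t = p 0 + primitive nu h t.
  move=> t01; apply: (sdiff_eq AB Hp (sdiffD (sdiff_cst AB (p 0)) (sdiff_primitive2 ch)) _ _ _ t01).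
  - by move=> s _; rewrite addr0.
  - by move=> s _; rewrite add0r.
  - by rewrite primitive_at0// addr0.
split; last exact: pE.
rewrite (primitive_linear nu x01 cA ch).
apply: (sdiff_eq AB Hf (sdiffD (sdiffD (sdiff_cst AB (f 0)) (sdiff_scale (p 0) (sdiff_A AB)))
  (sdiffB (sdiffM AB (sdiff_A AB) (sdiff_primitive2 ch)) (sdiff_primitive2 (contM cA ch)))) _ _ _ x01').
- by move=> t t01; rewrite pE//; ring.
- by move=> t t01; ring.
- by rewrite !primitive_at0// (clock01 AB); ring.
Qed.

Lemma formula_solution l f a b : cont f ->
  (forall x, x \in `[0, 1] -> f x = a + b * A x + \int[nu]_(y in `[0, x]) ((A x - A y) * - (l * f y))) ->
  [/\ solution l f (fun x => b + primitive nu (fun y => - (l * f y)) x), f 0 = a &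
     b + primitive nu (fun y => - (l * f y)) 0 = b].
Proof.
move=> cf fE; set h := fun y => - (l * f y).
have ch : cont h by apply: contN; apply: contM => //; exact: cont_cst.
have cA := clock_cont1 AB.
split; last by rewrite primitive_at0// addr0.
- split.
    apply: (sdiff_ext (sdiffD (sdiffD (sdiff_cst AB a) (sdiff_scale b (sdiff_A AB)))
      (sdiffB (sdiffM AB (sdiff_A AB) (sdiff_primitive2 ch)) (sdiff_primitive2 (contM cA ch))))) => x x01.
    + by rewrite fE ?in_itv//= (primitive_linear nu _ cA ch) ?in_itv.
    + by ring.
    + by ring.
  by apply: (sdiff_ext (sdiffD (sdiff_cst AB b) (sdiff_primitive2 ch))) => x _; rewrite ?add0r.
- rewrite fE ?in_itv/= ?lexx ?ler01// (primitive_linear nu _ cA ch) ?in_itv/= ?lexx ?ler01//.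
  by rewrite !primitive_at0// (clock01 AB); ring.
Qed.

Lemma Rintegral_01 g : nu.-integrable setT (EFin \o g) ->
  \int[nu]_y g y = \int[nu]_(y in `[0, 1]) g y.
Proof.
move=> ig; rewrite /Rintegral (@negligible_integral _ _ _ nu setT (~` `[0, 1]%classic))//.
- by rewrite setTD setCK.
- exact: measurableC.
Qed.

(** The eigenvalue equation fixes g only nu-almost everywhere, so under the integral it is exchanged
    for its continuous version - l f. *)
Lemma weak_laplacian_solution l f a b g : weak_laplacian mu nu f a b g ->
  {ae nu, forall x : R, x \in `[0, 1] -> - g x = l * f x} ->
  exists p, [/\ solution l f p, f 0 = a, p 0 = b & p 1 = b + \int[nu]_y g y].
Proof.
move=> [/within_cont cf gL2 fE] gae; set h := fun y => - (l * f y).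
have ch : cont h by apply: contN; apply: contM => //; exact: cont_cst.
have ig : nu.-integrable setT (EFin \o g).
  by apply/Lfun1_integrable/Lfun_subset12 => //; rewrite fin_num_measure.
have mg : measurable_fun setT g by apply/measurable_EFinP; exact: measurable_int ig.
have swap k x : cont k -> x \in `[0, 1] ->
    \int[nu]_(y in `[0, x]) (k y * g y) = \int[nu]_(y in `[0, x]) (k y * h y).
  rewrite in_itv/= => ck /andP[x0 x1].
  have sx : `[0, x]%classic `<=` (`[0, 1]%classic : set R).
    by move=> z /=; rewrite !in_itv/= => /andP[-> zx]; exact: le_trans x1.
  have mx : measurable (`[0, x]%classic : set (measurableTypeR R)) by exact: measurable_itv.
  congr fine; apply: ae_eq_integral => //.
  - apply/measurable_EFinP/measurable_funM; last exact: measurable_funTS.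
    exact: measurable_funS (cont_measurable ck).
  - apply/measurable_EFinP; apply: (measurable_funS _ sx) => //.
    exact: cont_measurable (contM ck ch).
  - apply: ae_imply gae => y gy /= /sx y01; congr (_ * _)%:E.
    by rewrite /h -gy ?opprK.
have fE' x : x \in `[0, 1] -> f x = a + b * A x + \int[nu]_(y in `[0, x]) ((A x - A y) * h y).
  move=> x01; rewrite fE// (@swap (fun y => A x - A y))//.
  by apply: contB; [exact: cont_cst|exact: (clock_cont1 AB)].
have [Hs f0 p0] := formula_solution cf fE'.
exists (fun x => b + primitive nu h x); split=> //; congr (_ + _).
have one01 : (1 : R) \in `[0, 1] by rewrite in_itv/= ler01 lexx.
have := swap (fun=> 1) 1 (@cont_cst _ 1) one01.
under eq_Rintegral do rewrite mul1r.
under [in X in _ = X -> _]eq_Rintegral do rewrite mul1r.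
by rewrite Rintegral_01// => ->.
Qed.

(** Composition with [clamp] makes the representative continuous and bounded on the whole line,
    which puts it in [Lfun nu 2]. *)
Lemma solution_weak_laplacian l f p : solution l f p ->
  let g x := - (l * f (clamp x)) in
  [/\ weak_laplacian mu nu f (f 0) (p 0) g,
      (forall x, x \in `[0, 1] -> - g x = l * f x) & p 1 = p 0 + \int[nu]_y g y].
Proof.
move=> H g; have [Hf Hp] := H.
have cf := sdiff_cont AB Hf.
have ge y : y \in `[0, 1] -> g y = - (l * f y) by rewrite in_itv/= => y01; rewrite /g clampE.
have mg : measurable_fun [set: measurableTypeR R] g.
  by apply: (@continuous_measurable_fun R g); exact: (contN (contM (@cont_cst _ l) cf)).
have [C C0 hC] := cont_bounded (contN (contM (@cont_cst _ l) cf)).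
have gC y : `|g y| <= C by exact/hC/clamp01.
have sub x : x \in `[0, 1] -> `[0, x]%classic `<=` (`[0, 1]%classic : set R).
  rewrite in_itv/= => /andP[x0 x1] z /=; rewrite !in_itv/= => /andP[-> zx]; exact: le_trans x1.
split.
- split; first exact: cont_within.
    exact: bounded_Lfun2 gC.
  move=> x x01; have [-> _] := solution_formula H x01; congr (_ + _).
  by apply: eq_Rintegral => y; rewrite inE => y01; rewrite ge//; exact: sub y01.
- by move=> x x01; rewrite ge// opprK.
- have ig : nu.-integrable setT (EFin \o g).
    apply: measurable_bounded_integrable => //.
      by rewrite ltey_eq fin_num_measure.
    by exists C; split; [exact: num_real|move=> C' CC' x _; exact: le_trans (ltW CC')].
  rewrite Rintegral_01//; have [_ ->] := solution_formula H (ltac:(by rewrite in_itv/= ler01 lexx) : 1 \in `[0, 1]).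
  by congr (_ + _); apply: eq_Rintegral => y; rewrite inE => y01; rewrite ge.
Qed.

End krein_feller.

(** * Eigenvalues as parameters meeting the boundary condition at 1 *)

Lemma l2_zero {R : realType} (m : {finite_measure set (measurableTypeR R) -> \bar R}) (f : R -> R) :
  cont f -> (primitive m (fun x => f x ^+ 2) 1 <= 0 <->
    {ae m, forall x : R, x \in `[0, 1] -> f x = 0}).
Proof.
move=> cf; have m01 : measurable (`[0, 1]%classic : set (measurableTypeR R)) by exact: measurable_itv.
have if2 : m.-integrable (`[0, 1]%classic : set (measurableTypeR R)) (EFin \o (fun x => f x ^+ 2)).
  by apply: cont_integrable => //; exact: contX.
have mf2 := measurable_int _ if2.
have [d1 d2] := ae_eq_integral_abs m m01 mf2.
have E : (\int[m]_(x in `[0%R, 1%R]) `|(EFin \o (fun x => f x ^+ 2)%R) x|)%E =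
    (primitive m (fun x => f x ^+ 2) 1)%:E.
  rewrite /primitive /Rintegral fineK; last exact: integrable_fin_num.
  by apply: eq_integral => x _ /=; rewrite ger0_norm ?sqr_ge0.
split=> [h|h].
  have /d1 : (\int[m]_(x in `[0%R, 1%R]) `|(EFin \o (fun x => f x ^+ 2)%R) x|)%E = 0%E.
    rewrite E; apply/eqP; rewrite eqe eq_le h/=.
    by apply: Rintegral_ge0 => x _; exact: sqr_ge0.
  apply: ae_imply => x /[apply] /= /eqP; rewrite eqe sqrf_eq0 => /eqP //.
have /d2 : ae_eq m (`[0, 1]%classic : set (measurableTypeR R)) (EFin \o (fun x : R => f x ^+ 2)) (cst 0%E).
  by apply: ae_imply h => x fx x01 /=; rewrite fx// expr0n.
by rewrite E => /eqP; rewrite eqe => /eqP ->.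
Qed.

Section eigenvalues.
Context {R : realType} (mu nu : probability (measurableTypeR R) R).
Implicit Types (x y e l : R) (f g h p : R -> R).
Hypotheses (mu_atomless : atomless mu) (nu_atomless : atomless nu).
Hypothesis mu_out : mu (~` `[0, 1]%classic) = 0%E.
Hypothesis nu_out : nu (~` `[0, 1]%classic) = 0%E.
Local Notation A := (distr_fun mu).
Local Notation B := (distr_fun nu).
Hypothesis A_nonzero : 0 < primitive nu (fun x => A x ^+ 2) 1.
Local Notation solution := (solution A B).

Let AB := krein_feller_clocks mu_atomless nu_atomless mu_out nu_out.

Let zero01 : 0 <= (0 : R) <= 1. Proof. by rewrite lexx ler01. Qed.
Let one01 : 0 <= (1 : R) <= 1. Proof. by rewrite ler01 lexx. Qed.

Lemma distr_sqr_gt0 E : sdiff A B E (fun=> 0) (fun x => A x ^+ 2) -> E 0 < E 1.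
Proof.
move=> HE; have cA := clock_cont1 AB.
have := sdiff_eq AB HE (sdiffD (sdiff_primitive2 mu nu (@contX _ _ 2 cA)) (sdiff_cst AB (E 0))) _ _ _ one01.
move=> ->; first by rewrite ltrDr.
- by move=> t _; rewrite addr0.
- by move=> t _; rewrite addr0.
- by rewrite primitive_at0// add0r.
Qed.

Definition boundary_type (gamma : R * R) (a b t0 : R) :=
  [/\ gamma = (0, 0), a = 0, b = 1 & t0 = 0] \/
  [/\ gamma = (pi / 2, pi / 2), a = 1, b = 0 & t0 = pi / 2].

Variables (gamma : R * R) (a b t0 : R).
Hypothesis gammaE : boundary_type gamma a b t0.

Let init : initial a b t0.
Proof. by case: gammaE => [[_ *]|[_ *]]; [left|right]. Qed.

Lemma boundary_start (v w : R) : v * cos gamma.1 - w * sin gamma.1 = 0 <-> v * cos t0 - w * sin t0 = 0.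
Proof. by case: gammaE => [[-> _ _ ->]|[-> _ _ ->]]. Qed.

(** The opposite signs agree because the cosine or the sine vanishes; for intermediate angles the
    two conditions would differ. *)
Lemma boundary_end (v w : R) : v * cos gamma.2 + w * sin gamma.2 = 0 <-> v * cos t0 - w * sin t0 = 0.
Proof.
case: gammaE => [[-> _ _ ->]|[-> _ _ ->]] /=.
  by rewrite cos0 sin0 !mulr0 subr0 addr0.
rewrite cos_pihalf sin_pihalf !mulr0 !mulr1 add0r sub0r.
by split=> [->|/eqP]; rewrite ?oppr0// oppr_eq0 => /eqP.
Qed.

Lemma eigenvalue_of_solution l : eigenvalue_of mu nu gamma l -> exists f p,
  [/\ solution l f p, f 0 * cos t0 - p 0 * sin t0 = 0, f 1 * cos t0 - p 1 * sin t0 = 0 &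
   0 < primitive nu (fun x => f x ^+ 2) 1].
Proof.
move=> [f [g [[a' [b' [wl g0 g1]]] nz gE]]].
have [p [H f0 p0 p1]] := weak_laplacian_solution mu_atomless nu_atomless mu_out nu_out wl gE.
exists f, p; split=> //.
- by apply/boundary_start; rewrite p0.
- by apply/boundary_end; rewrite p1.
- rewrite ltNge; apply/negP => h; apply: nz; apply/l2_zero => //.
  by case: wl => /within_cont.
Qed.

Lemma eigenvalue_ge0 l : eigenvalue_of mu nu gamma l -> 0 <= l.
Proof.
move=> /eigenvalue_of_solution [f [p [H b0 b1 pos]]]; rewrite leNgt; apply/negP => l0.
have [Hf _] := H; have cf := sdiff_cont AB Hf.
have := boundary_nonneg AB init l0 H b0 b1 (sdiff_primitive2 mu nu (contX cf)).
by rewrite primitive_at0// leNgt pos.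
Qed.

Lemma eigenvalue_pos l f p : 0 < l -> solution l f p -> f 0 = a -> p 0 = b ->
  eigenvalue_of mu nu gamma l <-> f 1 * cos t0 - p 1 * sin t0 = 0.
Proof.
move=> l0 H f0 p0; have [Hf _] := H; have cf := sdiff_cont AB Hf; split.
  move=> /eigenvalue_of_solution [f' [p' [H' b0 b1 pos]]].
  apply: (boundary_match AB init H f0 p0 H' b0 b1).
  apply: contrapT => nex; move: pos; rewrite ltNge => /negP; apply.
  rewrite /primitive (_ : \int[nu]_(t in `[0, 1]) _ = \int[nu]_(t in `[0, 1]) (0 : R)).
    by rewrite Rintegral_cst ?mul0r//; exact: measurable_itv.
  apply: eq_Rintegral => x; rewrite inE/= in_itv/= => x01.
  apply/eqP; rewrite sqrf_eq0; apply/negPn/negP => fx; apply: nex; by exists x.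
move=> b1; have [wl gE p1] := solution_weak_laplacian mu_atomless nu_atomless mu_out nu_out H.
exists f, (fun x => - (l * f (clamp x))); split.
- exists (f 0), (p 0); split => //.
    apply/boundary_start; rewrite f0 p0; case: init => [[-> -> ->]|[-> -> ->]].
      by rewrite sin0 mul0r mulr0 subrr.
    by rewrite cos_pihalf mul0r mulr0 subrr.
  by apply/boundary_end; rewrite -p1.
- move=> /(l2_zero nu cf); rewrite leNgt => /negP; apply.
  rewrite -[X in X < _](primitive_at0 (fun x => f x ^+ 2) nu_atomless).
  exact: (solution_l2_gt0 AB init l0 distr_sqr_gt0 H f0 p0 (sdiff_primitive2 mu nu (contX cf))).
- by apply: (aeW nu) => x x01; exact: gE.
Qed.

End eigenvalues.

(** * Approximation by continuous functions in L^2 *)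

Section continuous_approximation.
Import HBSimple HBNNSimple.
Context {R : realType} (rho : {finite_measure set (measurableTypeR R) -> \bar R}).
Implicit Types (u v phi : measurableTypeR R -> R) (c e : R).
Local Notation mfun u := (measurable_fun [set: measurableTypeR R] u).

Definition sqint u : \bar R := (\int[rho]_x ((u x) ^+ 2)%:E)%E.

Lemma measurable_sqr_EFin u : mfun u -> mfun (fun x => ((u x) ^+ 2)%:E).
Proof. by move=> mu; apply/measurable_EFinP; exact: measurable_funX. Qed.

Lemma sqint_le u v : mfun u -> mfun v -> (forall x, (u x) ^+ 2 <= (v x) ^+ 2) -> (sqint u <= sqint v)%E.
Proof.
move=> mu mv uv; apply: ge0_le_integral => //.
- by move=> x _; rewrite lee_fin sqr_ge0.
- exact: measurable_sqr_EFin.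
- exact: measurable_sqr_EFin.
- by move=> x _; rewrite lee_fin.
Qed.

Lemma sqintZ c u : mfun u -> sqint (fun x => c * u x) = ((c ^+ 2)%:E * sqint u)%E.
Proof.
move=> mu; rewrite /sqint; under eq_integral do rewrite exprMn EFinM.
rewrite ge0_integralZl//; first exact: measurable_sqr_EFin.
- by move=> x _; rewrite lee_fin sqr_ge0.
- by rewrite lee_fin sqr_ge0.
Qed.

Lemma sqintD u v : mfun u -> mfun v ->
  (sqint (fun x => u x + v x)%R <= 2%:E * sqint u + 2%:E * sqint v)%E.
Proof.
move=> mu mv.
have m2 (w : measurableTypeR R -> R) : mfun w -> mfun (fun x => (2%:E * ((w x) ^+ 2)%:E)%E).
  by move=> mw; apply: measurable_funeM; exact: measurable_sqr_EFin.
rewrite /sqint -!ge0_integralZl//; try exact: measurable_sqr_EFin;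
  try by move=> x _; rewrite lee_fin sqr_ge0.
rewrite -ge0_integralD//; try exact: m2; try by move=> x _; rewrite mule_ge0// lee_fin sqr_ge0.
apply: ge0_le_integral => //.
- by move=> x _; rewrite lee_fin sqr_ge0.
- by apply: measurable_sqr_EFin; exact: measurable_funD.
- by apply: emeasurable_funD; exact: m2.
- by move=> x _; rewrite -!EFinM -EFinD lee_fin; have := sqr_ge0 (u x - v x); lra.
Qed.

Definition approximable u := mfun u /\ forall e, 0 < e ->
  exists2 phi, continuous (phi : R -> R) & (sqint (fun x => u x - phi x)%R <= e%:E)%E.

Lemma continuous_mfun phi : continuous (phi : R -> R) -> mfun phi.
Proof. exact: continuous_measurable_fun. Qed.

Lemma approximable_lim u : mfun u ->
  (forall e, 0 < e -> exists2 v, approximable v & (sqint (fun x => u x - v x)%R <= e%:E)%E) ->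
  approximable u.
Proof.
move=> mu H; split=> // e e0.
have [v [mv /(_ (e / 4)) Hv] uv] := H (e / 4) ltac:(by rewrite divr_gt0).
have [|phi cphi vphi] := Hv; first by rewrite divr_gt0.
exists phi => //; have mphi := continuous_mfun cphi.
have := sqintD (measurable_funB mu mv) (measurable_funB mv mphi).
rewrite (_ : (fun x => _) = (fun x => u x - phi x)); last by apply/funext => x /=; ring.
move=> /le_trans; apply.
rewrite (_ : e%:E = 2%:E * (e / 4)%:E + 2%:E * (e / 4)%:E)%E; last by rewrite -!EFinM -EFinD; congr EFin; field.
by apply: leeD; apply: lee_wpmul2l.
Qed.

Lemma approximable_continuous phi : continuous (phi : R -> R) -> approximable phi.
Proof.
move=> cphi; split; first exact: continuous_mfun.
move=> e e0; exists phi => //; rewrite /sqint.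
under eq_integral do rewrite subrr expr0n.
by rewrite integral0 lee_fin ltW.
Qed.

Lemma approximableD u v : approximable u -> approximable v -> approximable (fun x => u x + v x).
Proof.
move=> [mu Hu] [mv Hv]; split; first exact: measurable_funD.
move=> e e0; have e4 : 0 < e / 4 by rewrite divr_gt0.
have [f cf uf] := Hu _ e4; have [g cg vg] := Hv _ e4.
exists (fun x => f x + g x); first by move=> x; apply: continuousD; [exact: cf|exact: cg].
have := sqintD (measurable_funB mu (continuous_mfun cf)) (measurable_funB mv (continuous_mfun cg)).
rewrite (_ : (fun x => _) = (fun x => u x + v x - (f x + g x))); last by apply/funext => x /=; ring.
move=> /le_trans; apply.
rewrite (_ : e%:E = 2%:E * (e / 4)%:E + 2%:E * (e / 4)%:E)%E; last by rewrite -!EFinM -EFinD; congr EFin; field.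
by apply: leeD; apply: lee_wpmul2l.
Qed.

Lemma approximableZ c u : approximable u -> approximable (fun x => c * u x).
Proof.
move=> [mu Hu]; split; first exact: measurable_funM.
move=> e e0; have c1 : 0 < c ^+ 2 + 1 by rewrite ltr_wpDl ?sqr_ge0.
have [f cf uf] := Hu (e / (c ^+ 2 + 1)) ltac:(by rewrite divr_gt0).
exists (fun x => c * f x); first by move=> x; apply: continuousM; [exact: cst_continuous|exact: cf].
rewrite (_ : (fun x => _) = (fun x => c * (u x - f x))); last by apply/funext => x /=; ring.
rewrite sqintZ; last by apply: measurable_funB => //; exact: continuous_mfun.
apply: (@le_trans _ _ ((c ^+ 2)%:E * (e / (c ^+ 2 + 1))%:E)%E).
  by apply: lee_wpmul2l => //; rewrite lee_fin sqr_ge0.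
rewrite -EFinM lee_fin mulrA ler_pdivrMr// mulrC ler_pM2l//; lra.
Qed.

Lemma approximable_sum (I : Type) (s : seq I) (F : I -> measurableTypeR R -> R) :
  (forall i, approximable (F i)) -> approximable (fun x => \sum_(i <- s) F i x).
Proof.
move=> HF; elim: s => [|i s IH].
  have -> : (fun x => \sum_(i <- [::]) F i x) = (fun=> 0) by apply/funext => x; rewrite big_nil.
  by apply: approximable_continuous => x; exact: cst_continuous.
have -> : (fun x => \sum_(j <- i :: s) F j x) = (fun x => F i x + \sum_(j <- s) F j x).
  by apply/funext => x; rewrite big_cons.
exact: approximableD.
Qed.

Lemma sqint_indic (D : set (measurableTypeR R)) : measurable D -> sqint \1_D = rho D.
Proof.
move=> mD; have := integral_indic rho measurableT mD; rewrite setIT => <-.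
by apply: eq_integral => x _; rewrite indicE; case: (x \in D); rewrite ?expr1n ?expr0n.
Qed.

Lemma measure_cvg0_small (F : (set (measurableTypeR R))^nat) : (forall n, measurable (F n)) ->
  nonincreasing_seq F -> \bigcap_n F n = set0 -> forall e, 0 < e -> exists n, (rho (F n) <= e%:E)%E.
Proof.
move=> mF ndF F0 e e0.
have : rho \o F @ \oo --> rho (\bigcap_n F n).
  apply: nonincreasing_cvg_mu => //; first by rewrite ltey_eq fin_num_measure.
  by rewrite F0.
rewrite F0 measure0 => /fine_cvgP[_ /cvgrPdist_le/(_ e e0)[n _ /(_ n (leqnn n))]].
rewrite /= sub0r normrN => h; exists n.
rewrite -[rho (F n)]fineK ?fin_num_measure// lee_fin; exact: le_trans (ler_norm _) h.
Qed.

(** A ramp of slope n + 1 differs from the indicator only on ]a, a + 1/(n+1)[, and these intervals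
    shrink to the empty set. *)
Lemma approximable_ray a : approximable \1_(`]a, +oo[%classic : set (measurableTypeR R)).
Proof.
have mI := @measurable_indic _ (measurableTypeR R) R.
have mray : measurable (`]a, +oo[%classic : set (measurableTypeR R)) by exact: measurable_itv.
split; first exact: mI.
move=> e e0; pose F n : set (measurableTypeR R) := `]a, a + n.+1%:R^-1[%classic.
have mF n : measurable (F n) by exact: measurable_itv.
have [] := measure_cvg0_small mF _ _ e0.
- move=> n n' nn'; apply/subsetPset => z; rewrite /F/= !in_itv/= => /andP[-> h2] /=.
  by apply: (lt_le_trans h2); rewrite lerD2l lef_pV2 ?posrE// ler_nat.
- apply/seteqP; split => // z Fz /=.
  have /= := Fz 0%N I; rewrite /F /= in_itv/= => /andP[az _].
  have := archi_boundP (x := (z - a)^-1) ltac:(by rewrite invr_ge0 subr_ge0 ltW).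
  set n := Num.bound _ => hn.
  have nz : n.+1%:R^-1 < z - a.
    by rewrite -[X in _ < X]invrK ltf_pV2 ?posrE ?invr_gt0 ?subr_gt0//; apply: (lt_trans hn); rewrite ltr_nat.
  have := Fz n I; rewrite /F/= in_itv/= => /andP[_]; rewrite ltNge => /negP; apply.
  by rewrite -lerBrDl ltW.
move=> n hn; pose phi (x : R) : R := clamp (n.+1%:R * (x - a)).
have cphi : continuous phi.
  move=> x; apply: (@continuous_comp _ _ _ (fun x => n.+1%:R * (x - a)) clamp); last exact: continuous_clamp.
  by apply: continuousM; [exact: cst_continuous|apply: continuousB; [exact: id|exact: cst_continuous]].
exists phi => //; apply: le_trans hn; rewrite -sqint_indic//.
have n0 : 0 < (n.+1%:R : R) by rewrite ltr0n.
apply: sqint_le; [apply: measurable_funB; [exact: mI|exact: continuous_mfun]|exact: mI|].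
move=> x; rewrite !indicE.
have [xa|xa] := leP x a.
  rewrite memNset ?memNset/F/= ?in_itv/= ?ltNge ?xa//.
  suff -> : phi x = 0 by rewrite subrr.
  rewrite /phi /clamp min_l; first by rewrite max_l// pmulr_rle0// subr_le0.
  by apply: (@le_trans _ _ 0) => //; rewrite pmulr_rle0// subr_le0.
rewrite mem_set; last by rewrite /= in_itv/= xa.
have [xb|xb] := ltP x (a + n.+1%:R^-1).
  rewrite mem_set; last by rewrite /F/= in_itv/= xa xb.
  have := clamp_ge0 (n.+1%:R * (x - a)); have := clamp_le1 (n.+1%:R * (x - a)).
  by rewrite -/(phi x) => h1 h2; rewrite ler_pXn2r ?nnegrE ?subr_ge0//= lerBlDl lerDr.
suff -> : phi x = 1 by rewrite subrr expr0n sqr_ge0.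
have h : 1 <= n.+1%:R * (x - a).
  by rewrite mulrC -ler_pdivrMr// mul1r lerBrDl.
by rewrite /phi /clamp min_r// max_r.
Qed.

(** Dynkin's lemma: the rays are closed under intersection and generate the Borel sets, and the sets
    with approximable indicator are closed under complements and disjoint countable unions. *)
Lemma approximable_indic (D : set (measurableTypeR R)) : measurable D -> approximable \1_D.
Proof.
have mI := @measurable_indic _ (measurableTypeR R) R.
have mE : @measurable _ (measurableTypeR R) = <<s @RGenOInfty.G R >>.
  exact: RGenOInfty.measurableE.
rewrite mE; move: D.
apply: (@dynkin_induction _ (measurableTypeR R) (@RGenOInfty.G R) (fun D => approximable \1_D)).
- exact: mE.
- move=> _ _ [x ->] [y ->]; exists (Order.max x y); apply/seteqP; split => z /=;
    by rewrite !in_itv/= !andbT gt_max => /andP.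
- rewrite indicT; apply: approximable_continuous => x; exact: cst_continuous.
- by move=> _ [x ->]; exact: approximable_ray.
- move=> S mS aS; rewrite (_ : \1_(~` S) = (fun x => 1 + (-1) * \1_S x)).
    by apply: approximableD; [apply: approximable_continuous => x; exact: cst_continuous|exact: approximableZ].
  by apply/funext => x; rewrite !indicE in_setC; case: (x \in S) => /=; ring.
- move=> F mF tF aF; pose G n := \big[setU/set0]_(k < n) F k.
  have mG n : measurable (G n) by apply: bigsetU_measurable => i _.
  have GF n x : G n x -> exists2 k, (k < n)%N & F k x.
    by rewrite /G -bigcup_mkord => -[k kn Fk]; exists k.
  have aG n : approximable \1_(G n).
    elim: n => [|n IH].
      by rewrite /G big_ord0 indic0; apply: approximable_continuous => x; exact: cst_continuous.
    rewrite (_ : \1_(G n.+1) = (fun x => \1_(G n) x + \1_(F n) x)); first exact: approximableD.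
    apply/funext => x; rewrite !indicE {1}/G big_ord_recr /= -/(G n) in_setU.
    have [Fx|nFx] := boolP (x \in F n); last by rewrite orbF addr0.
    rewrite orbT (memNset (A := G n)) ?add0r// => /GF [k kn Fk].
    have kE : k = n by apply: tF => //; exists x; split=> //; rewrite inE in Fx.
    by move: kn; rewrite kE ltnn.
  have mU : measurable (\bigcup_n F n) by exact: bigcupT_measurable.
  apply: approximable_lim; first exact: mI.
  move=> e e0; pose H n := (\bigcup_n F n) `\` G n.
  have mH n : measurable (H n) by exact: measurableD.
  have GS n m : (n <= m)%N -> G n `<=` G m.
    by move=> nm x /GF [k kn Fk]; rewrite /G -bigcup_mkord; exists k => //=; exact: leq_trans nm.
  have [] := measure_cvg0_small mH _ _ e0.
  + by move=> n m nm; apply/subsetPset => x [Ux nG]; split => // /(GS _ _ nm).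
  + apply/seteqP; split => // x Hx; have [[k _ Fk] _] := Hx 0%N I.
    by have [_] := Hx k.+1 I; apply; rewrite /G big_ord_recr/=; right.
  + move=> n hn; exists \1_(G n) => //.
    rewrite (_ : (fun x => _) = \1_(H n)); first by rewrite sqint_indic.
    apply/funext => x; rewrite !indicE /H in_setD.
    have [Gx|nGx] := boolP (x \in G n); last by rewrite andbT subr0.
    rewrite andbF mem_set ?subrr//.
    by move: Gx; rewrite inE => /GF [k _ Fk]; exists k.
Qed.

(** Simple functions increase to u, and u ^ 2 dominates the squared differences. *)
Lemma approximable_L2 u : mfun u -> (forall x, 0 <= u x) -> (sqint u < +oo)%E -> approximable u.
Proof.
move=> mu u0 iu.
have mEu : mfun (EFin \o u) by exact/measurable_EFinP.
have [g [ndg gu]] := @approximation _ (measurableTypeR R) R setT measurableT (EFin \o u)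
  mEu (fun x _ => u0 x).
apply: approximable_lim => // e e0.
have gu' (x : measurableTypeR R) : (fun n => g n x) @ \oo --> u x by exact: (fine_cvg (gu x I)).
have gle n x : g n x <= u x.
  rewrite -(cvg_lim (@Rhausdorff R) (gu' x)); apply: nondecreasing_cvgn_le.
    by move=> a b ab; exact/lefP/ndg.
  by apply/cvg_ex; exists (u x).
have ag n : approximable (g n).
  have -> : (g n : measurableTypeR R -> R) = _ := funext (fimfunEord (g n)).
  by apply: approximable_sum => i; apply: approximableZ; exact: approximable_indic.
have mg n : mfun (g n) by [].
have [] := @dominated_convergence _ (measurableTypeR R) R rho setT measurableT
  (fun n x => ((u x - g n x) ^+ 2)%:E) (cst 0%E) (fun x => ((u x) ^+ 2)%:E).
- by move=> n; apply: measurable_sqr_EFin; exact: measurable_funB.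
- exact: measurable_cst.
- apply: aeW => x _; apply/fine_cvgP; split; first exact: nearW.
  rewrite /comp/=; have : (u x - g n x) @[n --> \oo] --> u x - u x.
    by apply: cvgB; [exact: cvg_cst|exact: gu'].
  by rewrite subrr => h; have := cvgM h h; rewrite mulr0; exact.
- apply/integrableP; split; first exact: measurable_sqr_EFin.
  under eq_integral do rewrite gee0_abs ?lee_fin ?sqr_ge0//.
  exact: iu.
- apply: aeW => x n _; rewrite /= lee_fin ger0_norm ?sqr_ge0//.
  have := gle n x; have : 0 <= g n x by []; have := u0 x => ? ? ?.
  by rewrite ler_pXn2r ?nnegrE ?subr_ge0// gerBl.
move=> _ _; rewrite integral0 => /fine_cvgP[h1 /cvgrPdist_le/(_ e e0)].
move=> h2; have [n _ /(_ n (leqnn n)) [fn hn]] := filterI h1 h2.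
exists (g n) => //; move: hn; rewrite /= sub0r normrN => hn.
rewrite /sqint -[X in (X <= _)%E]fineK// lee_fin; exact: le_trans (ler_norm _) hn.
Qed.

End continuous_approximation.

(** * Asymptotics of the angle *)

Section scaled_angles.
Context {R : realType} (A B : R -> R).
Implicit Types (x y e l k c : R) (th S G : R -> R).
Local Notation sdiff := (sdiff A B).

(** The form in which [total_angle] supplies the angle. Of the squared cosine c, the estimates below
    use only 0 <= c <= 1. *)
Definition scalable_angle l th := forall k, 0 < k -> exists c thk : R -> R,
  [/\ (forall x, 0 <= x <= 1 -> 0 <= c x <= 1),
      sdiff thk (fun x => k * c x) (fun x => l / k * (1 - c x)) &
      forall x, 0 <= x <= 1 -> `|thk x - th x| < pi / 2].

(** At scale k = sqrt l * s the angle has differential sqrt l (s c dA + ((1 - c) / s) dB), and the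
    hypothesis compares this with dS up to dG for every c. Passing from [thk] back to [th] costs pi
    / 2 at each end. *)
Lemma angle_on_piece S G l th (s a b : R) : 0 < l -> 0 < s -> scalable_angle l th ->
  0 <= a -> a <= b -> b <= 1 ->
  (forall x y c, a <= x -> x <= y -> y <= b -> 0 <= c <= 1 ->
    `|s * c * (A y - A x) + (1 - c) / s * (B y - B x) - (S y - S x)| <= G y - G x) ->
  `|th b - th a - Num.sqrt l * (S b - S a)| <= Num.sqrt l * (G b - G a) + pi.
Proof.
move=> l0 s0 sth a0 ab b1 HS.
set q := Num.sqrt l; have q0 : 0 < q by rewrite sqrtr_gt0.
have qq : l = q * q by rewrite -expr2 sqr_sqrtr// ltW.
have [c [thk [c01 [_ _ Hk] hk]]] := sth (q * s) (mulr_gt0 q0 s0).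
have ls : l / (q * s) = q / s by rewrite qq invfM mulrA mulfK ?gt_eqF.
have a01 : 0 <= a <= 1 by rewrite a0 (le_trans ab).
have b01 : 0 <= b <= 1 by rewrite b1 (le_trans a0).
have step e x y : `|thk y - thk x - q * s * c x * (A y - A x) - l / (q * s) * (1 - c x) * (B y - B x)| <= e ->
    a <= x -> x <= y -> y <= b ->
    `|thk y - thk x - q * (S y - S x)| <= q * (G y - G x) + e.
  move=> he ax xy yb; have x01 : 0 <= x <= 1 by rewrite (le_trans a0)//= (le_trans xy)// (le_trans yb).
  have := HS x y (c x) ax xy yb (c01 x x01).
  set X := _ + _ - _ => hX.
  rewrite (_ : _ - _ = q * X + (thk y - thk x - q * s * c x * (A y - A x) - l / (q * s) * (1 - c x) * (B y - B x))).
    by apply: (le_trans (ler_normD _ _)); rewrite lerD// normrM (gtr0_norm q0) ler_pM2l.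
  by rewrite ls /X; ring.
have up : thk b - q * S b - q * G b <= thk a - q * S a - q * G a.
  apply: (@mean_value_le _ (fun t => thk t - q * S t - q * G t) (fun t => A t + B t)) => // e e0.
  have [d d0 hd] := Hk e e0; exists d => // x y ax xy yb xyd.
  have := step _ x y (hd x y (le_trans a0 ax) xy (le_trans yb b1) xyd) ax xy yb.
  by rewrite ler_norml => /andP[_]; lra.
have dn : - (thk b - q * S b) - q * G b <= - (thk a - q * S a) - q * G a.
  apply: (@mean_value_le _ (fun t => - (thk t - q * S t) - q * G t) (fun t => A t + B t)) => // e e0.
  have [d d0 hd] := Hk e e0; exists d => // x y ax xy yb xyd.
  have := step _ x y (hd x y (le_trans a0 ax) xy (le_trans yb b1) xyd) ax xy yb.
  by rewrite ler_norml => /andP[+ _]; lra.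
have := hk a a01; have := hk b b01; rewrite !ltr_norml => /andP[? ?] /andP[? ?].
by rewrite ler_norml; apply/andP; split; lra.
Qed.

Lemma angle_on_pieces S G l th n (s : nat -> R) : 0 < l -> (0 < n)%N ->
  (forall i, (i < n)%N -> 0 < s i) -> scalable_angle l th ->
  (forall i x y c, (i < n)%N -> i%:R / n%:R <= x -> x <= y -> y <= i.+1%:R / n%:R -> 0 <= c <= 1 ->
    `|s i * c * (A y - A x) + (1 - c) / s i * (B y - B x) - (S y - S x)| <= G y - G x) ->
  `|th 1 - th 0 - Num.sqrt l * (S 1 - S 0)| <= Num.sqrt l * (G 1 - G 0) + pi *+ n.
Proof.
move=> l0 n0 s0 sth HS; set q := Num.sqrt l.
have n0' : 0 < (n%:R : R) by rewrite ltr0n.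
have claim m : (m <= n)%N -> `|th (m%:R / n%:R) - th 0 - q * (S (m%:R / n%:R) - S 0)| <=
    q * (G (m%:R / n%:R) - G 0) + pi *+ m.
  elim: m => [_|m IH mn]; first by rewrite mul0r !subrr mulr0 subr0 normr0 addr0.
  have := @angle_on_piece S G l th (s m) (m%:R / n%:R) (m.+1%:R / n%:R) l0 (s0 m mn) sth.
  rewrite divr_ge0// ler_pM2r ?invr_gt0// ler_nat leqnSn.
  rewrite ler_pdivrMr// mul1r ler_nat mn => /(_ isT isT isT) H.
  have := H (fun x y c => @HS m x y c mn); have := IH (ltnW mn).
  rewrite -/q mulrS !ler_norml => /andP[? ?] /andP[? ?]; apply/andP; split; lra.
by have := claim n (leqnn n); rewrite divff ?gt_eqF.
Qed.

End scaled_angles.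

(** The left side is |c (s - t) + (1 - c) (t - s) t / s|, at most 2 D + D ^ 2 / e with D = |t - s|.
    Inserting D <= 2 e + d gives 8 e + 6 d + d ^ 2 / e, and 6 d <= 3 e + 3 d ^ 2 / e yields 11 and
    4. *)
Lemma scaled_error {R : realFieldType} (e s t c d : R) : 0 < e -> e <= s -> 0 <= t -> 0 <= d ->
  0 <= c <= 1 -> `|t - s| <= 2 * e + d ->
  `|s * c + (1 - c) / s * t ^+ 2 - t| <= 11 * e + 4 / e * d ^+ 2.
Proof.
move=> e0 es t0 d0 /andP[c0 c1] ts; have s0 : 0 < s by exact: lt_le_trans es.
set D := `|t - s| in ts; have D0 : 0 <= D by exact: normr_ge0.
rewrite (_ : _ - _ = c * (s - t) + (1 - c) * ((t - s) * t / s)); last by field; rewrite gt_eqF.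
have h1 : `|c * (s - t)| <= D by rewrite normrM distrC ger0_norm// ler_piMl.
have tsD : t <= s + D by have := ler_norm (t - s); rewrite -/D; lra.
have h2 : `|(1 - c) * ((t - s) * t / s)| <= D + D ^+ 2 / e.
  have c10 : 0 <= 1 - c by rewrite subr_ge0.
  rewrite normrM (ger0_norm c10); apply: (@le_trans _ _ `|(t - s) * t / s|).
    by rewrite ler_piMl//; lra.
  rewrite normrM normrM -/D (ger0_norm t0) gtr0_norm ?invr_gt0//.
  apply: (@le_trans _ _ (D * (s + D) / s)).
    by rewrite ler_wpM2r ?invr_ge0 ?(ltW s0)// ler_wpM2l.
  rewrite mulrDr mulrDl mulfK ?gt_eqF// lerD2l -expr2 ler_wpM2l ?sqr_ge0//.
  by rewrite lef_pV2 ?posrE.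
apply: (le_trans (ler_normD _ _)); apply: (le_trans (lerD h1 h2)).
have h3 : D ^+ 2 / e <= (2 * e + d) ^+ 2 / e.
  by rewrite ler_pM2r ?invr_gt0// ler_pXn2r ?nnegrE// addr_ge0// mulr_ge0// ltW.
have h4 : 6 * d <= 3 * e + 3 * (d ^+ 2 / e).
  rewrite -subr_ge0 (_ : _ - _ = 3 / e * (d - e) ^+ 2); last by field; rewrite gt_eqF.
  by rewrite mulr_ge0 ?sqr_ge0// divr_ge0// ltW.
have h5 : (2 * e + d) ^+ 2 / e = 4 * e + 4 * d + d ^+ 2 / e by field; rewrite gt_eqF.
rewrite h5 in h3; rewrite (_ : 4 / e * d ^+ 2 = 4 * (d ^+ 2 / e)); last by field; rewrite gt_eqF.
by lra.
Qed.

(** Here the target value is 4 / e and p approximates it within d. If p >= 2 / e then s >= 1 / e;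
    otherwise d >= 2, and the quadratic term alone exceeds 1 / e >= 1 / s. The bound copies that of
    [scaled_error], so that one integrand serves both measures. *)
Lemma singular_error {R : realFieldType} (e s c d p : R) : 0 < e -> e <= 1 -> e <= s -> 0 <= d ->
  0 <= c <= 1 -> p - e <= s -> 4 / e - p <= d ->
  (1 - c) / s <= 11 * e + 4 / e * d ^+ 2.
Proof.
move=> e0 e1 es d0 /andP[c0 c1] ps dp; have s0 : 0 < s by exact: lt_le_trans es.
apply: (@le_trans _ _ s^-1); first by rewrite ler_piMl ?invr_ge0 ?(ltW s0)//; lra.
have ie1 : 1 <= e^-1 by rewrite invf_ge1.
have d2 : 0 <= 4 / e * d ^+ 2 by rewrite mulr_ge0 ?sqr_ge0// divr_ge0// ltW.
have [p2|p2] := leP (2 / e) p.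
  have : s^-1 <= e by rewrite invf_ple ?posrE//; apply: le_trans ps; lra.
  by lra.
have es' : s^-1 <= e^-1 by rewrite lef_pV2 ?posrE.
have d4 : 4 <= d ^+ 2 by rewrite (_ : 4 = 2 ^+ 2); [rewrite ler_pXn2r ?nnegrE//; lra|ring].
have : 4 / e * 4 <= 4 / e * d ^+ 2 by rewrite ler_wpM2l// divr_ge0// ltW.
by lra.
Qed.

(** One e pays for replacing p by q and one for the floor e, which is cheap because t >= 0 and keeps
    the scale away from zero. *)
Lemma max_close {R : realFieldType} (e p q t : R) : 0 <= e -> 0 <= t -> `|p - q| <= e ->
  `|t - Order.max e q| <= 2 * e + `|t - p|.
Proof.
move=> e0 t0; rewrite ler_norml => /andP[h1 h2].
have h3 := ler_norm (t - p); have := ler_norm (p - t); rewrite distrC => h4.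
by rewrite ler_norml /Order.max; case: ltP => h5; apply/andP; split; lra.
Qed.

(** * Step functions adapted to sigma and to the singular part *)

Section finite_measure_sum.
Context {R : realType} (m1 m2 : {finite_measure set (measurableTypeR R) -> \bar R}).

(** Named so that the finite measure structure can be registered on it. Approximation in L^2 of the
    sum controls the error for both measures at once. *)
Definition finite_measure_add : set (measurableTypeR R) -> \bar R := measure_add m1 m2.

HB.instance Definition _ := Measure.on finite_measure_add.

Let fin_num_add : fin_num_fun finite_measure_add.
Proof.
by move=> D mD; rewrite /finite_measure_add measure_addE fin_numD !fin_num_measure.
Qed.

HB.instance Definition _ := @Measure_isFinite.Build _ _ _ finite_measure_add fin_num_add.

End finite_measure_sum.

Section step_approximation.
Context {R : realType} (mu nu : probability (measurableTypeR R) R)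
  (eta : {finite_measure set (measurableTypeR R) -> \bar R}) (sigma : R -> R).
Implicit Types (x y e c : R).
Hypothesis eta_mu_singular : singular eta mu.
Hypothesis sigma_L2 : sigma \in Lfun mu 2%:E.
Hypothesis sigma_ge0 : {ae mu, forall x : R, 0 <= sigma x}.
Hypothesis nuE : forall A : set (measurableTypeR R), measurable A ->
  nu A = (\int[mu]_(x in A) ((sigma x ^+ 2)%:E) + eta A)%E.

Local Notation rho := (finite_measure_add mu eta).
Local Notation mfun u := (measurable_fun [set: measurableTypeR R] u).
Let mT := @measurableT _ (measurableTypeR R).

Let integral_rho (D : set (measurableTypeR R)) (f : R -> R) : measurable D -> mfun f ->
  (forall x, 0 <= f x) ->
  (\int[rho]_(x in D) (f x)%:E = \int[mu]_(x in D) (f x)%:E + \int[eta]_(x in D) (f x)%:E)%E.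
Proof.
move=> mD mf f0; apply: ge0_integral_measure_add => //.
- by move=> x _; rewrite lee_fin.
- by apply/measurable_EFinP; exact: measurable_funTS.
Qed.

Let msigma : mfun sigma.
Proof. by move: sigma_L2; rewrite inE => /andP[/[!inE]]. Qed.

Let isigma : mu.-integrable setT (EFin \o sigma).
Proof. by apply/Lfun1_integrable/Lfun_subset12 => //; rewrite fin_num_measure. Qed.

Let isigma2 : mu.-integrable setT (EFin \o (fun x => sigma x ^+ 2)).
Proof. exact: Lfun2_integrable_sqr. Qed.

(* The value [K] on the singular part makes the corresponding scale large
   there, so that [eta] contributes little to the rotation. *)
Let target (D : set (measurableTypeR R)) (K : R) : measurableTypeR R -> R :=
  fun x => \1_D x * `|sigma x| + (1 - \1_D x) * K.

Let target_approx (D : set (measurableTypeR R)) K : measurable D -> eta D = 0%E -> mu (~` D) = 0%E ->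
  0 <= K -> [/\ mfun (target D K), forall x, 0 <= target D K x,
    {ae mu, forall x, target D K x = sigma x} & approximable rho (target D K)].
Proof.
move=> mD eD mD' K0.
have mtau : mfun (target D K).
  apply: measurable_funD; apply: measurable_funM => //.
  - exact: measurableT_comp.
  - exact: measurable_funB.
have t0 x : 0 <= target D K x.
  by rewrite /target indicE; case: (x \in D); rewrite ?subrr ?subr0 ?mul1r ?mul0r ?add0r ?addr0.
have tmu : {ae mu, forall x, target D K x = sigma x}.
  have aeD : {ae mu, forall x, D x} by exists (~` D); split => //; exact: measurableC.
  have := @filterI _ _ (ae_filter_ringOfSetsType mu) _ _ aeD sigma_ge0.
  apply: (@filterS _ _ (ae_filter_ringOfSetsType mu)) => x [Dx s0].
  by rewrite /target indicE mem_set// subrr mul0r addr0 mul1r ger0_norm.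
split=> //; apply: approximable_L2 => //.
rewrite /sqint integral_rho//; last 2 first.
- exact: measurable_funX.
- by move=> x; exact: sqr_ge0.
(* The target equals sigma mu-almost everywhere and the constant K eta-almost everywhere. *)
apply: lte_add_pinfty.
  have -> : (\int[mu]_x ((target D K x) ^+ 2)%:E = \int[mu]_x (EFin \o (fun x => (sigma x ^+ 2)%R)) x)%E.
    apply: ae_eq_integral => //.
    - by apply/measurable_EFinP; exact: measurable_funX.
    - by apply/measurable_EFinP; exact: measurable_funX.
    - by apply: ae_imply tmu => x /= -> _.
  by have := integrable_fin_num mT isigma2; rewrite fin_numElt => /andP[].
have -> : (\int[eta]_x ((target D K x) ^+ 2)%:E = \int[eta]_x (cst (K ^+ 2)%:E) x)%E.
  apply: ae_eq_integral => //.
  - by apply/measurable_EFinP; exact: measurable_funX.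
  - exists D; split => // x /= nx; apply: contrapT => Dx; apply: nx => _.
    by rewrite /target indicE memNset// subr0 mul0r add0r mul1r.
rewrite integral_cst//; apply: lte_mul_pinfty => //; first by rewrite lee_fin sqr_ge0.
by rewrite ltey_eq fin_num_measure.
Qed.

Let fine_nu x y : fine (nu `]x, y]%classic) =
  \int[mu]_(t in `]x, y]) (sigma t ^+ 2) + fine (eta `]x, y]%classic).
Proof.
have mP : measurable (`]x, y]%classic : set (measurableTypeR R)) by exact: measurable_itv.
rewrite nuE// fineD ?fin_num_measure//.
by apply: integrable_fin_num => //; exact: integrableS isigma2.
Qed.

(** G is the primitive, with respect to mu + eta, of the common bound in [scaled_error] and
    [singular_error], d being the distance from the target tau to a continuous phi. It has small
    total increase because phi is close to tau in L^2. *)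
Lemma step_approximation e : 0 < e -> e <= 1 -> exists G (n : nat) (s : nat -> R),
  [/\ (0 < n)%N, (forall i, 0 < s i), G 1 - G 0 <= e * (11 * fine (rho setT) + 4) &
   forall i x y c, (i < n)%N -> i%:R / n%:R <= x -> x <= y -> y <= i.+1%:R / n%:R -> 0 <= c <= 1 ->
    `|s i * c * (distr_fun mu y - distr_fun mu x) + (1 - c) / s i * (distr_fun nu y - distr_fun nu x)
      - (primitive mu sigma y - primitive mu sigma x)| <= G y - G x].
Proof.
move=> e0 e1; have [D [mD eD mD']] := eta_mu_singular.
set K := 4 / e; have K0 : 0 <= K by rewrite divr_ge0// ltW.
have [mtau tau0 taumu atau] := target_approx mD eD mD' K0.
set tau := target D K in mtau tau0 taumu atau.
(* Accuracy e ^ 2 compensates the factor 4 / e and leaves 4 e. *)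
have [_ /(_ (e ^+ 2)) []] := atau; first by rewrite exprn_gt0.
move=> phi cphi hphi; have mphi := continuous_mfun cphi.
pose g x := 11 * e + 4 / e * (tau x - phi x) ^+ 2.
have mg : mfun g.
  by apply: measurable_funD => //; apply: measurable_funM => //; apply: measurable_funX; exact: measurable_funB.
have e00 := ltW e0.
have g0 x : 0 <= g x by rewrite addr_ge0// mulr_ge0// ?sqr_ge0// divr_ge0.
have isq : rho.-integrable setT (EFin \o (fun x => (tau x - phi x) ^+ 2)).
  apply/integrableP; split; first by apply/measurable_EFinP; apply: measurable_funX; exact: measurable_funB.
  under eq_integral do rewrite gee0_abs ?lee_fin ?sqr_ge0//.
  exact: le_lt_trans hphi (ltry _).
have icst : rho.-integrable setT (EFin \o (fun=> 11 * e)).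
  by apply: finite_measure_integrable_cst.
have isq' : rho.-integrable setT (EFin \o (fun x => 4 / e * (tau x - phi x) ^+ 2)).
  exact: (integrableZl mT (4 / e) isq).
have ig : rho.-integrable setT (EFin \o g) by exact: (integrableD mT icst isq').
have gint : \int[rho]_x g x <= e * (11 * fine (rho setT) + 4).
  rewrite (_ : \int[rho]_x g x = 11 * e * fine (rho setT) + 4 / e * \int[rho]_x ((tau x - phi x) ^+ 2)).
    have : \int[rho]_x ((tau x - phi x) ^+ 2) <= e ^+ 2.
      rewrite -lee_fin /Rintegral fineK//; exact: integrable_fin_num isq.
    rewrite -(ler_pM2l (_ : 0 < 4 / e)) ?divr_gt0// => h.
    have : 4 / e * e ^+ 2 = 4 * e by field; rewrite gt_eqF.
    by lra.
  by rewrite -RintegralZl// -Rintegral_cst// -RintegralD.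
have [d d0 hd] := cont_unif (continuous_cont cphi) e0.
have [n nd] : exists n : nat, n.+1%:R^-1 < d.
  have := archi_boundP (x := d^-1) ltac:(by rewrite invr_ge0 ltW).
  set n := Num.bound _ => hn; exists n.
  by rewrite -[X in _ < X]invrK ltf_pV2 ?posrE ?invr_gt0//; apply: (lt_trans hn); rewrite ltr_nat.
(* The scale on a piece is phi at its left end, floored at e; the pieces are short enough for phi to
   vary by at most e. *)
pose s i := Order.max e (phi (i%:R / n.+1%:R)).
pose G x := \int[rho]_(t in `[0, x]) g t.
have es i : e <= s i by rewrite le_max lexx.
have s0 i : 0 < s i by exact: lt_le_trans (es i).
exists G, n.+1, s; split=> //.
  apply: le_trans gint; apply: (@le_trans _ _ (G 1)).
    by rewrite gerBl /G; apply: Rintegral_ge0 => t _; exact: g0.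
  rewrite /G /Rintegral fine_le//.
  - apply: integrable_fin_num; first exact: measurable_itv.
    by apply: integrableS ig => //; exact: measurable_itv.
  - exact: integrable_fin_num ig.
  - have m01 : measurable (`[0, 1]%classic : set (measurableTypeR R)) by exact: measurable_itv.
    apply: (@ge0_subset_integral _ _ _ rho _ _ m01 mT (EFin \o g)) => //; first exact/measurable_EFinP.
    by move=> x _; rewrite lee_fin.
move=> i x y c iN ix xy yi c01.
have n0 : 0 < (n.+1%:R : R) by rewrite ltr0n.
have x0 : 0 <= x by apply: le_trans ix; rewrite divr_ge0.
have y1 : y <= 1 by apply: (le_trans yi); rewrite ler_pdivrMr// mul1r ler_nat.
have i01 : 0 <= (i%:R / n.+1%:R : R) <= 1 by rewrite divr_ge0// (le_trans ix)// (le_trans xy).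
set P := `]x, y]%classic : set (measurableTypeR R).
have mP : measurable P by exact: measurable_itv.
have iP (m : {measure set (measurableTypeR R) -> \bar R}) (f : R -> R) :
    m.-integrable setT (EFin \o f) -> m.-integrable P (EFin \o f).
  by move=> If; apply: integrableS If.
have SB : primitive mu sigma y - primitive mu sigma x = \int[mu]_(t in P) sigma t.
  rewrite /primitive (@Rintegral_itv_cat _ mu sigma (BLeft 0) x y)//.
    by rewrite [X in X - _]addrC addrK.
  by apply: integrableS isigma => //; exact: measurable_itv.
have GB : G y - G x = \int[rho]_(t in P) g t.
  rewrite /G (@Rintegral_itv_cat _ rho g (BLeft 0) x y)//.
    by rewrite [X in X - _]addrC addrK.
  by apply: integrableS ig => //; exact: measurable_itv.
have cl t : P t -> `|phi t - phi (i%:R / n.+1%:R)| <= e.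
  rewrite /P /= in_itv/= => /andP[xt ty]; apply: hd => //.
    by rewrite (le_trans x0 (ltW xt)) (le_trans ty y1).
  rewrite ger0_norm; last by rewrite subr_ge0 (le_trans ix)// ltW.
  apply: le_lt_trans nd; rewrite lerBlDr (le_trans ty)// (le_trans yi)//.
  by rewrite -natr1 mulrDl mul1r addrC.
have igm (m : {measure set (measurableTypeR R) -> \bar R}) :
    (\int[m]_(t in P) (g t)%:E <= \int[rho]_(t in P) (g t)%:E)%E -> m.-integrable P (EFin \o g).
  move=> h; apply/integrableP; split; first by apply/measurable_EFinP; exact: measurable_funTS.
  under eq_integral do rewrite gee0_abs ?lee_fin ?g0//.
  apply: (le_lt_trans h); have := integrable_fin_num mP (iP _ _ ig).
  by rewrite fin_numElt => /andP[].
have iPg0 (m : {measure set (measurableTypeR R) -> \bar R}) : (0 <= \int[m]_(t in P) (g t)%:E)%E.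
  by apply: integral_ge0 => t _; rewrite lee_fin.
have imu : mu.-integrable P (EFin \o g) by apply: igm; rewrite integral_rho// leeDl.
have ieta : eta.-integrable P (EFin \o g) by apply: igm; rewrite integral_rho// leeDr.
have GE : \int[rho]_(t in P) g t = \int[mu]_(t in P) g t + \int[eta]_(t in P) g t.
  by rewrite /Rintegral integral_rho// fineD//; exact: integrable_fin_num.
have c1 : 0 <= 1 - c by rewrite subr_ge0; case/andP: c01.
have ictst (m : {finite_measure set (measurableTypeR R) -> \bar R}) (z : R) : m.-integrable P (EFin \o (fun=> z)).
  by apply: (iP m); exact: finite_measure_integrable_cst.
(* The pointwise estimate is available for tau, while the density of nu involves sigma. *)
have swap (f : R -> R) : mfun f ->
    \int[mu]_(t in P) f (sigma t) = \int[mu]_(t in P) f (tau t).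
  move=> mf; congr fine; apply: ae_eq_integral => //.
  - by apply/measurable_EFinP; apply: measurable_funTS; exact: measurableT_comp.
  - by apply/measurable_EFinP; apply: measurable_funTS; exact: measurableT_comp.
  - by apply: ae_imply taumu => t /= -> _.
have part1 : `|s i * c * fine (mu P) + (1 - c) / s i * \int[mu]_(t in P) (sigma t ^+ 2) - \int[mu]_(t in P) sigma t|
   <= \int[mu]_(t in P) g t.
  have i2 : mu.-integrable P (EFin \o (fun t => (1 - c) / s i * sigma t ^+ 2)).
    exact: (iP mu _ (integrableZl mT ((1 - c) / s i) isigma2)).
  have ih : mu.-integrable P (EFin \o (fun t => s i * c + (1 - c) / s i * sigma t ^+ 2 - sigma t)).
    exact: (integrableB mP (integrableD mP (ictst mu (s i * c)) i2) (iP mu _ isigma)).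
  have -> : s i * c * fine (mu P) + (1 - c) / s i * \int[mu]_(t in P) (sigma t ^+ 2) - \int[mu]_(t in P) sigma t =
      \int[mu]_(t in P) (s i * c + (1 - c) / s i * sigma t ^+ 2 - sigma t).
    rewrite (RintegralB mP (integrableD mP (ictst mu (s i * c)) i2) (iP mu _ isigma)).
    rewrite (RintegralD mP (ictst mu (s i * c)) i2) Rintegral_cst// RintegralZl//.
    exact: (iP mu _ isigma2).
  apply: le_trans (le_normr_Rintegral mP ih) _.
  have mh : mfun (fun z : R => `|s i * c + (1 - c) / s i * z ^+ 2 - z|).
    apply: measurableT_comp => //; apply: measurable_funB => //; apply: measurable_funD => //.
    by apply: measurable_funM => //; exact: measurable_funX.
  have hg t : P t -> `|s i * c + (1 - c) / s i * tau t ^+ 2 - tau t| <= g t.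
    move=> Pt; rewrite /g -[(tau t - phi t) ^+ 2]real_normK ?num_real//.
    apply: scaled_error; [exact: e0|exact: es|exact: tau0|exact: normr_ge0|exact: c01|].
    exact: (max_close e00 (tau0 t) (cl t Pt)).
  rewrite (swap _ mh); apply: le_Rintegral => //.
  apply: (le_integrable mP _ _ imu).
    by apply/measurable_EFinP; apply: measurable_funTS; exact: (measurableT_comp mh mtau).
  by move=> t Pt /=; rewrite lee_fin normr_id (ger0_norm (g0 t)); exact: hg.
have part2 : (1 - c) / s i * fine (eta P) <= \int[eta]_(t in P) g t.
  have -> : (1 - c) / s i * fine (eta P) = \int[eta]_(t in P) ((1 - c) / s i * \1_(~` D) t).
    rewrite RintegralZl//.
      congr (_ * _); rewrite /Rintegral integral_indic//; last exact: measurableC.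
      rewrite (measureDI _ mP mD).
      rewrite [X in (_ + X)%E](_ : _ = 0%E) ?adde0; last first.
        by apply/eqP; rewrite -measure_le0 -eD; apply: le_measure; rewrite ?inE//; exact: measurableI.
      by rewrite setIC -setDE.
    by apply: (iP eta); apply: integrable_indic => //; exact: measurableC.
  apply: le_Rintegral => //.
    have iD : eta.-integrable setT (EFin \o \1_(~` D)) by apply: integrable_indic => //; exact: measurableC.
    exact: (iP eta _ (integrableZl mT ((1 - c) / s i) iD)).
  move=> t Pt; rewrite indicE; have [Dt|Dt] := boolP (t \in ~` D); last by rewrite mulr0.
  rewrite mulr1 /g -[(tau t - phi t) ^+ 2]real_normK ?num_real//.
  apply: (@singular_error _ e (s i) c _ (phi t)) => //.
    have := cl t Pt; rewrite ler_norml => /andP[_ h]; rewrite /s le_max; apply/orP; right.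
    by rewrite lerBlDr -lerBlDl.
  apply: le_trans (ler_norm _); rewrite /tau /target indicE memNset; last by move: Dt; rewrite inE.
  by rewrite mul0r add0r subr0 mul1r.
rewrite distr_funB// distr_funB// SB GB GE fine_nu -/P.
rewrite (_ : _ - _ = (s i * c * fine (mu P) + (1 - c) / s i * \int[mu]_(t in P) (sigma t ^+ 2) - \int[mu]_(t in P) sigma t)
   + (1 - c) / s i * fine (eta P)); last by ring.
apply: (le_trans (ler_normD _ _)); apply: lerD => //.
by rewrite ger0_norm// mulr_ge0 ?fine_ge0// divr_ge0// ltW.
Qed.

End step_approximation.

(** * Counting eigenvalues *)

Section counting_function.
Context {R : realType}.
Implicit Types (x y l e : R) (E : set R) (T : R -> R).

Lemma sin_natmul_pi y : 0 <= y -> (sin y = 0 <-> exists j : nat, y = j%:R * pi).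
Proof.
have pi0 := @pi_gt0 R.
have sinj (j : nat) r : sin (r + j%:R * pi) = (-1) ^+ j * sin r.
  elim: j => [|j IH]; first by rewrite mul0r addr0 expr0 mul1r.
  by rewrite -natr1 mulrDl mul1r addrA sinDpi IH exprS mulN1r mulNr.
move=> y0; split=> [sy|[j ->]]; last by rewrite -[_ * _]add0r sinj sin0 mulr0.
have yp : 0 <= y / pi by rewrite divr_ge0// ltW.
have /andP[h1 h2] := truncn_itv yp; set j := Num.truncn _ in h1 h2.
exists j; pose r := y - j%:R * pi.
have yE : y = r + j%:R * pi by rewrite /r subrK.
have r0 : 0 <= r by rewrite subr_ge0 -ler_pdivlMr.
have rpi : r < pi by move: h2; rewrite ltr_pdivrMr// -natr1 mulrDl mul1r /r; lra.
move: sy; rewrite yE sinj => /eqP; rewrite mulf_eq0 signr_eq0/= => /eqP sr.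
move: r0; rewrite le_eqVlt => /predU1P[<-|r0]; first by rewrite add0r.
by have := @sin_gt0_pi R r; rewrite r0 rpi sr ltxx => /(_ isT).
Qed.

Lemma counting_le E (s : seq R) : (forall x, E x -> x \in s) ->
  exists2 n : nat, counting E = n%:R%:E :> \bar R & (n <= size s)%N.
Proof.
move=> Es; have fE : finite_set E.
  by apply: (@sub_finite_set _ E [set` s]); [exact: Es|apply/finite_seqP; exists s].
exists (size (finmap.enum_fset (fset_set E))); first by rewrite /counting; case: asboolP.
apply: uniq_leq_size; first exact: finmap.fset_uniq.
by move=> x; rewrite in_fset_set// => /set_mem/Es.
Qed.

Lemma counting_ge E (s : seq R) (n : nat) : counting E = n%:R%:E :> \bar R -> uniq s ->
  (forall x, x \in s -> E x) -> (size s <= n)%N.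
Proof.
rewrite /counting; case: asboolP => // fE [/eqP]; rewrite eqr_nat => /eqP <- us sE.
by apply: uniq_leq_size => // x /sE Ex; rewrite in_fset_set//; exact/mem_set.
Qed.

(** Positive members of S are the points where T is a multiple of pi. Every multiple between T 1 and
    T x is attained once, and what lies below 1 adds a bounded number. Starting at 1 avoids the
    behaviour of T near 0. *)
Lemma counting_limit (S : R -> Prop) T I :
  (forall l, S l -> 0 <= l) ->
  (forall l, 0 < l -> 0 <= T l) ->
  (forall l l', 0 < l -> l < l' -> T l < T l') ->
  (forall l, 0 < l -> {for l, continuous T}) ->
  (forall l, 0 < l -> (S l <-> sin (T l) = 0)) ->
  (forall e, 0 < e -> exists C, forall l, 0 < l -> `|T l - Num.sqrt l * I| <= Num.sqrt l * e + C) ->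
  (counting [set l : R | S l /\ (l <= x)%R] * ((x `^ (1 / 2))^-1)%:E)%E @[x --> +oo] --> (pi^-1 * I)%:E.
Proof.
move=> S0 T0 Tincr Tcont ST Tasym; have pi0 := @pi_gt0 R.
have Tinj l l' : 0 < l -> 0 < l' -> T l = T l' -> l = l'.
  move=> l0 l'0 TT; case: (ltgtP l l') => // h.
    by have := Tincr l l' l0 h; rewrite TT ltxx.
  by have := Tincr l' l l'0 h; rewrite TT ltxx.
have Tle l l' : 0 < l -> l <= l' -> T l <= T l'.
  by move=> l0; rewrite le_eqVlt => /predU1P[->//|h]; exact/ltW/Tincr.
have Sj l : 0 < l -> (S l <-> exists j : nat, T l = j%:R * pi).
  by move=> l0; rewrite ST// sin_natmul_pi// T0.
pose C1 := T 1 / pi + 2.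
have T10 : 0 <= T 1 / pi by rewrite divr_ge0 ?T0// ltW.
have count x : 1 < x -> exists2 n : nat, counting [set l | S l /\ l <= x] = n%:R%:E :> \bar R &
    `|n%:R - T x / pi| <= C1.
  move=> x1; have x0 : 0 < x by exact: lt_trans x1.
  have Txp : 0 <= T x / pi by rewrite divr_ge0 ?T0// ltW.
  set J := Num.truncn (T x / pi); set J1 := Num.truncn (T 1 / pi).
  have /andP[Jl Ju] := truncn_itv Txp; have /andP[J1l J1u] := truncn_itv T10.
  rewrite -/J in Jl Ju; rewrite -/J1 in J1l J1u.
  (* [h j] is the positive point with T = j pi; its default value 0 is harmless. *)
  have [h hh] : {h : nat -> R & forall j l, 0 < l -> T l = j%:R * pi -> h j = l}.
    apply: (@choice nat R (fun j y => forall l, 0 < l -> T l = j%:R * pi -> y = l)) => j.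
    have [[l [l0 lj]]|nl] := pselect (exists l, 0 < l /\ T l = j%:R * pi).
      by exists l => l' l'0 l'j; apply: Tinj => //; rewrite lj.
    by exists 0 => l l0 lj; case: nl; exists l.
  have [n nE nle] : exists2 n : nat, counting [set l | S l /\ l <= x] = n%:R%:E :> \bar R &
      (* The candidates are l = 0 and the levels 0 to J, so n <= J + 2, which explains the 2 in
         [C1]. *)
      (n <= size (0%R :: [seq h j | j <- iota 0 J.+1]))%N.
    apply: counting_le => l [Sl lx]; have := S0 l Sl; rewrite le_eqVlt => /predU1P[<-|l0].
      by rewrite inE eqxx.
    have [j lj] := (Sj l l0).1 Sl.
    rewrite inE; apply/orP; right; apply/mapP; exists j; last by rewrite (hh j l).
    rewrite mem_iota/= add0n ltnS truncn_ge_nat// ler_pdivlMr// -lj; exact: Tle.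
  exists n => //.
  move: nle; rewrite /= size_map size_iota => nle.
  have lower : (J - J1 <= n)%N.
    have hT j : (J1 < j)%N -> (j <= J)%N -> [/\ 0 < h j, h j <= x & T (h j) = j%:R * pi].
      move=> J1j jJ.
      have a1 : T 1 <= j%:R * pi.
        rewrite -ler_pdivrMr//; apply: (le_trans (ltW J1u)); by rewrite ler_nat.
      have a2 : j%:R * pi <= T x.
        by rewrite -ler_pdivlMr//; apply: le_trans Jl; rewrite ler_nat.
      have cT : {within `[1, x], continuous T}.
        apply: continuous_in_subspaceT => y; rewrite inE/= in_itv/= => /andP[y1 _].
        by apply: Tcont; exact: lt_le_trans y1.
      have [] := IVT (ltW x1) cT (v := j%:R * pi).
        by rewrite ge_min a1/= le_max a2 orbT.
      move=> l; rewrite in_itv/= => /andP[l1 lx] lj.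
      have l0 : 0 < l by exact: lt_le_trans l1.
      by rewrite (hh j l).
    have -> : (J - J1)%N = size [seq h j | j <- iota J1.+1 (J - J1)] by rewrite size_map size_iota.
    apply: (counting_ge nE).
      rewrite map_inj_in_uniq ?iota_uniq// => i j; rewrite !mem_iota => /andP[i1 i2] /andP[j1 j2] hij.
      have [_ _ hi] := hT i i1 ltac:(by move: i1 i2; lia).
      have [_ _ hj] := hT j j1 ltac:(by move: j1 j2; lia).
      have : (i%:R * pi : R) = j%:R * pi by rewrite -hi -hj hij.
      by move=> /(mulIf (lt0r_neq0 pi0))/eqP; rewrite eqr_nat => /eqP.
    move=> y /mapP[j]; rewrite mem_iota => /andP[j1 j2] ->.
    have [h0 hx hj] := hT j j1 ltac:(by move: j1 j2; lia).
    by split => //; apply/Sj => //; exists j.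
  have u1 : (n%:R : R) <= J%:R + 2 by rewrite -natrD ler_nat addn2.
  have u2 : (J%:R : R) <= n%:R + J1%:R by rewrite -natrD ler_nat addnC -leq_subLR.
  move: Ju; rewrite -natr1 => Ju.
  by rewrite ler_norml /C1; apply/andP; split; lra.
apply/fine_cvgP; split.
  near=> x; have x1 : 1 < x by near: x; exact: nbhs_pinfty_gt.
  by have [n -> _] := count x x1; rewrite -EFinM.
apply/cvgrPdist_le => e e0.
have [C hC] := Tasym (e * pi / 2) ltac:(by rewrite divr_gt0// mulr_gt0).
pose C2 := `|C| / pi + C1 + 1.
have C10 : 0 <= C1 by rewrite /C1; lra.
have C20 : 0 < C2 by rewrite /C2 ltr_wpDl// addr_ge0// divr_ge0// ltW.
near=> x.
have x1 : 1 < x by near: x; exact: nbhs_pinfty_gt.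
have x0 : 0 < x by exact: lt_trans x1.
(* From here on the constant error [C2] is at most half of e sqrt x. *)
have xC : (2 * C2 / e) ^+ 2 < x by near: x; apply: nbhs_pinfty_gt; exact: num_real.
have [n nE hn] := count x x1.
rewrite /= nE -EFinM/= mul1r powR12_sqrt ?(ltW x0)//.
set q := Num.sqrt x; have q0 : 0 < q by rewrite sqrtr_gt0.
have qC : C2 <= q * (e / 2).
  have c0 : 0 <= 2 * C2 / e by rewrite divr_ge0 ?mulr_ge0 ?ltW.
  have : 2 * C2 / e < q by rewrite -[X in X < _](ger0_norm c0) -sqrtr_sqr ltr_sqrt.
  by rewrite ltr_pdivrMr// => h; lra.
have hT := hC x x0; rewrite -/q in hT.
have hT' : `|T x / pi - q * (pi^-1 * I)| <= q * (e / 2) + `|C| / pi.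
  rewrite (_ : _ - _ = (T x - q * I) / pi); last by rewrite mulrBl -mulrA [pi^-1 * I]mulrC.
  rewrite normrM (gtr0_norm (_ : 0 < pi^-1)) ?invr_gt0// ler_pdivrMr// mulrDl divfK ?gt_eqF//.
  by have := ler_norm C; lra.
rewrite (_ : _ - _ = (q * (pi^-1 * I) - n%:R) / q); last by rewrite mulrBl [q * _]mulrC mulfK ?gt_eqF.
rewrite normrM (gtr0_norm (_ : 0 < q^-1)) ?invr_gt0// ler_pdivrMr//.
move: hn hT'; rewrite !ler_norml => /andP[? ?] /andP[? ?].
by move: qC; rewrite /C2 => ?; apply/andP; split; lra.
Unshelve. all: end_near. Qed.

End counting_function.

(** * Null sets and the zeros of the distribution function of mu *)

Section density_facts.
Context {R : realType} (mu nu : probability (measurableTypeR R) R)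
  (eta : {finite_measure set (measurableTypeR R) -> \bar R}) (sigma : R -> R).
Hypothesis mu_atomless : atomless mu.
Hypothesis eta_atomless : atomless eta.
Hypothesis supp_eta_mu : supp eta `<=` supp mu.
Hypothesis supp_mu_01 : supp mu `<=` `[0, 1].
Hypothesis sigma_L2 : sigma \in Lfun mu 2%:E.
Hypothesis nuE : forall A : set (measurableTypeR R), measurable A ->
  nu A = (\int[mu]_(x in A) ((sigma x ^+ 2)%:E) + eta A)%E.

Lemma density_null (D : set (measurableTypeR R)) : measurable D -> mu D = 0%E -> eta D = 0%E -> nu D = 0%E.
Proof.
move=> mD muD etaD; rewrite nuE// etaD adde0; apply: null_set_integral => //.
move: sigma_L2; rewrite inE => /andP[/[!inE]/= ms _].
by apply/measurable_EFinP/measurable_funX; exact: measurable_funTS.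
Qed.

Let m01C : measurable (~` `[0, 1]%classic : set (measurableTypeR R)).
Proof. by apply: measurableC; exact: measurable_itv. Qed.

Let open01C : open (~` `[0, 1]%classic : set R).
Proof. by apply: closed_openC; exact: interval_closed. Qed.

Lemma mu_out : mu (~` `[0, 1]%classic) = 0%E.
Proof. by apply: measure_off_supp => // x nx sx; apply: nx; exact: supp_mu_01. Qed.

Lemma nu_out : nu (~` `[0, 1]%classic) = 0%E.
Proof.
apply: density_null => //; first exact: mu_out.
by apply: measure_off_supp => // x nx sx; apply: nx; exact/supp_mu_01/supp_eta_mu.
Qed.

Lemma nu_atomless : atomless nu.
Proof. by move=> x; apply: density_null; [exact: measurable_set1|exact: mu_atomless|exact: eta_atomless]. Qed.

Let AB := krein_feller_clocks mu_atomless nu_atomless mu_out nu_out.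
Local Notation A := (distr_fun mu).

Lemma measurable_distr_zero : measurable ([set x | A x = 0] : set (measurableTypeR R)).
Proof.
rewrite (_ : [set x | A x = 0] = ~` (A @^-1` [set~ 0])); last first.
  by apply/seteqP; split => x /=; [move=> h; exact|exact: contrapT].
apply: measurableC; apply: open_measurable.
have /continuousP := distr_fun_continuous mu_atomless; apply.
by apply: closed_openC; exact: (@closed_eq R 0).
Qed.

(* Only the largest zero of [A] can lie in the support of [mu], so this is
   where [supp eta `<=` supp mu] matters. *)
Lemma nu_distr_zero : nu [set x | A x = 0] = 0%E.
Proof.
set Z : set (measurableTypeR R) := [set x | A x = 0].
have cA : continuous A by exact: distr_fun_continuous.
have mZ : measurable Z by exact: measurable_distr_zero.
have ray0 x : A x = 0 -> mu `]-oo, x]%classic = 0%E.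
  by move=> Ax; rewrite -[LHS]fineK ?fin_num_measure//; exact: (congr1 EFin Ax).
apply: density_null => //.
  apply/eqP; rewrite -measure_le0; apply/lee_addgt0Pr => e e0; rewrite add0e.
  (* A takes the value d at some x, and all zeros of A lie to the left of x, in a ray of measure
     d. *)
  pose d := Order.min e 1; have d0 : 0 < d by rewrite lt_min e0 ltr01.
  have de : d <= e by rewrite ge_min lexx.
  have d1 : d <= 1 by rewrite ge_min lexx orbT.
  have [] := IVT (ler01 : (0 : R) <= 1) (continuous_subspaceT cA) (v := d).
    by rewrite (clock01 AB) (clock11 AB) min_l// max_r// d1 ltW.
  move=> x _ Ax; apply: (@le_trans _ _ (mu `]-oo, x]%classic)).
    apply: le_measure; rewrite ?inE//.
    move=> z Zz /=; rewrite in_itv/= leNgt; apply/negP => xz.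
    by have := distr_fun_le mu (ltW xz); rewrite Ax Zz leNgt d0.
  by rewrite -[X in (X <= _)%E]fineK ?fin_num_measure// lee_fin -/(distr_fun mu x) Ax.
(* An open ray ending at a zero of A is mu-null, so it misses supp mu and with it supp eta. Only a
   largest zero can escape the union of these rays. *)
pose U : set R := \bigcup_(x in Z) `]-oo, x[%classic.
have U0 : eta U = 0%E.
  apply: measure_off_supp => [|x [z Zz]]; first by apply: bigcup_open => z _; exact: interval_open.
  rewrite /= in_itv/= => xz /supp_eta_mu/(_ `]-oo, z[%classic) H.
  have := H ltac:(exact: interval_open); rewrite /= in_itv/= => /(_ xz); rewrite ltNge => /negP; apply.
  rewrite -(ray0 z Zz); apply: le_measure; rewrite ?inE; try exact: measurable_itv.
  by move=> t /=; rewrite !in_itv/= => /ltW.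
have mU : measurable (U : set (measurableTypeR R)).
  by apply: open_measurable; apply: bigcup_open => z _; exact: interval_open.
have [z ZU] : exists z : R, Z `<=` U `|` [set z].
  have [[z [Zz nUz]]|nz] := pselect (exists z, Z z /\ ~ U z).
    exists z => x Zx; case: (ltgtP x z) => [xz|zx|->]; [left|exfalso|by right].
      by exists z => //=; rewrite in_itv.
    by apply: nUz; exists x => //=; rewrite in_itv.
  by exists 0 => x Zx; left; apply: contrapT => nUx; apply: nz; exists x.
apply/eqP; rewrite -measure_le0; apply: (@le_trans _ _ (eta (U `|` [set z]))).
  by apply: le_measure; rewrite ?inE//; apply: measurableU => //; exact: measurable_set1.
apply: (le_trans (measureU2 _ mU (measurable_set1 z))).
rewrite -[leRHS]adde0; apply: leeD; rewrite le_eqVlt; apply/orP; left; apply/eqP; first exact: U0.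
exact: eta_atomless.
Qed.

Lemma distr_sqr_nonzero : 0 < primitive nu (fun x => A x ^+ 2) 1.
Proof.
rewrite ltNge; apply/negP => /(l2_zero nu (clock_cont1 AB)) nA.
have nZ : nu.-negligible [set x | A x = 0] by exists [set x | A x = 0]; split; [exact: measurable_distr_zero|exact: nu_distr_zero|].
have no : nu.-negligible (~` `[0, 1]%classic : set R).
  by exists (~` `[0, 1]%classic); split; [exact: m01C|exact: nu_out|].
have : nu setT = 0%E.
  apply: measure_negligible; first exact: measurableT.
  apply: negligibleS (negligibleU nZ (negligibleU no nA)) => x _.
  have [x01|nx01] := boolP (x \in `[0, 1]); last by right; left; exact/negP.
  by have [Ax|nAx] := pselect (A x = 0); [left|right; right => /(_ x01)].
by rewrite probability_setT => /eqP; rewrite eqe oner_eq0.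
Qed.

End density_facts.

(** * The limit law *)

Unset Implicit Arguments.

Theorem theorem19 (R : realType)
    (mu nu : probability (measurableTypeR R) R)
    (eta : {finite_measure set (measurableTypeR R) -> \bar R})
    (sigma : R -> R) (gamma : R * R)
    (mu_atomless : atomless mu)
    (eta_atomless : atomless eta)
    (supp_eta_mu : supp eta `<=` supp mu)
    (supp_mu_01 : supp mu `<=` `[0, 1])
    (eta_mu_singular : singular eta mu)
    (sigma_L2 : sigma \in Lfun mu 2%:E)
    (sigma_ge0 : {ae mu, forall x : R, 0 <= sigma x})
    (nuE : forall A : set (measurableTypeR R), measurable A ->
       nu A = (\int[mu]_(x in A) ((sigma x ^+ 2)%:E) + eta A)%E)
    (gammaE : gamma = (0, 0) \/ gamma = (pi / 2, pi / 2)) :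
  (eigenvalue_count mu nu gamma x * ((x `^ (1 / 2))^-1)%:E)%E @[x --> +oo]
    --> (pi^-1 * \int[mu]_x sigma x)%:E.
Proof.
have mo := mu_out supp_mu_01.
have no := nu_out supp_eta_mu supp_mu_01 sigma_L2 nuE.
have na := nu_atomless mu_atomless eta_atomless sigma_L2 nuE.
have AB := krein_feller_clocks mu_atomless na mo no.
have Apos := distr_sqr_nonzero mu_atomless eta_atomless supp_eta_mu supp_mu_01 sigma_L2 nuE.
have [a [b [t0 bt]]] : exists a b t0, boundary_type gamma a b t0.
  by case: gammaE => ->; [exists 0, 1, 0; left|exists 1, 0, (pi / 2); right].
have init : initial a b t0 by case: bt => [[_ *]|[_ *]]; [left|right].
have [f [p [sol lip]]] := solution_family AB a b.
have [|T [T0 Tincr Tcont Tzero Tangle]] := total_angle AB init sol lip.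
  move=> l E l0; have [H f0 p0] := sol l.
  exact: (solution_l2_gt0 AB init l0 (distr_sqr_gt0 mu_atomless na mo no Apos) H f0 p0).
apply: (@counting_limit _ (eigenvalue_of mu nu gamma) T) => //.
- by move=> l; exact: (eigenvalue_ge0 mu_atomless na mo no bt).
- move=> l l0; have [H f0 p0] := sol l.
  by rewrite -Tzero//; exact: (eigenvalue_pos mu_atomless na mo no Apos bt l0 H f0 p0).
move=> e e0.
set M := 11 * fine (finite_measure_add mu eta setT) + 4.
have M0 : 0 < M by rewrite ltr_wpDl// mulr_ge0// fine_ge0.
(* Division by M makes the total increase of G at most e; the 1 meets the bound e <= 1 of
   [step_approximation]. *)
have e'0 : 0 < Order.min 1 (e / M) by rewrite lt_min ltr01 divr_gt0.
have e'1 : Order.min 1 (e / M) <= 1 by rewrite ge_min lexx.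
have [G [n [s [n0 s0 Ge hs]]]] := step_approximation eta_mu_singular sigma_L2 sigma_ge0 nuE e'0 e'1.
(* The n changes of scale cost pi each, and n was fixed before l. *)
exists (pi *+ n) => l l0; have [th [-> hth]] := Tangle l l0.
have hsc : scalable_angle (distr_fun mu) (distr_fun nu) l th by [].
have := angle_on_pieces l0 n0 (fun i _ => s0 i) hsc hs.
have -> : primitive mu sigma 1 - primitive mu sigma 0 = \int[mu]_x sigma x.
  rewrite primitive_at0// subr0 /primitive -(Rintegral_01 mo)//.
  by apply/Lfun1_integrable/Lfun_subset12 => //; rewrite fin_num_measure.
move=> h; apply: (le_trans h); rewrite lerD2r; apply: ler_wpM2l; first exact: sqrtr_ge0.
apply: (le_trans Ge); rewrite -/M -ler_pdivlMr//.
by rewrite ge_min lexx orbT.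
Qed.
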